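(* Let $d\ge 1$ be an integer. Then there exists a constant $\kappa_d$ such that, for every set $\Sigma\subset\mathbb{R}^d$ of finite positive measure and every $\varphi\in L^2(\mathbb{R}^d)$, $$\int_\Sigma|\widehat{\varphi}(\xi)|^2\,d\xi\le\kappa_d\int_{B(0,\tau)}\left|\widehat{|\varphi|^*}(\xi)\right|^2\,d\xi,$$ where $\tau$ is such that $|B(0,\tau)|=|\Sigma|$.
   Context: $\langle\cdot,\cdot\rangle$ and $|\cdot|$ are the standard scalar product and Euclidean norm on $\mathbb{R}^d$; $B(a,r)$ is the open ball of center $a$ and radius $r$; $|E|$ also denotes the Lebesgue measure of a Borel set $E$. Fourier transform: $\widehat{\varphi}(\xi)=\int_{\mathbb{R}^d}\varphi(t)e^{-2i\pi\langle t,\xi\rangle}\,dt$ for $\varphi\in L^1(\mathbb{R}^d)$, extended from $L^1\cap L^2$ to $L^2(\mathbb{R}^d)$ in the standard way. Symmetric rearrangement: for a Borel set $E\subset\mathbb{R}^d$ of finite measure, $E^*=B(0,r)$ with $|B(0,r)|=|E|$. For a measurable function $\varphi$ whose level sets $\{|\varphi|>\lambda\}$ have finite measure for all $\lambda>0$, $|\varphi|^*(x)=\int_0^{+\infty}\chi_{\{y\in\mathbb{R}^d:\,|\varphi(y)|>\lambda\}^*}(x)\,d\lambda$, where $\chi_A$ is the characteristic function of $A$. *)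

(* Defs.v *)
From HB Require Import structures.
From mathcomp Require Import all_boot all_order all_algebra.
From mathcomp Require Import all_classical all_reals all_analysis.
From mathcomp Require Import complex.

Set Implicit Arguments.
Unset Strict Implicit.
Unset Printing Implicit Defensive.

Import Order.TTheory GRing.Theory Num.Theory.
Import numFieldNormedType.Exports.

Local Open Scope classical_set_scope.
Local Open Scope ring_scope.

(* R^d is d.-tuple R with the library's product sigma-algebra, which is the
   Borel sigma-algebra of R^d. *)

Section lebesgue_measure_tuple.
Context {R : realType}.

Definition tcons {d} (x : measurableTypeR R * d.-tuple R) : d.+1.-tuple R :=
  [tuple of x.1 :: x.2].

Lemma measurable_tcons d : measurable_fun setT (@tcons d).
Proof.
apply: (@measurable_cons _ _ _ R (fun x => x.1 : R) d (fun x => x.2)).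
  exact: measurable_fst.
exact: measurable_snd.
Qed.

Section step.
Context d (m : {sigma_finite_measure set (d.-tuple R) -> \bar R}).

Definition leb_step : set (d.+1.-tuple R) -> \bar R :=
  pushforward (@lebesgue_measure R \x m)%E (@tcons d).

Let measurable_preimage A : measurable A -> measurable (@tcons d @^-1` A).
Proof. by move=> mA; rewrite -[X in measurable X]setTI; exact: measurable_tcons. Qed.

Let leb_step0 : leb_step set0 = 0%E.
Proof. by rewrite /leb_step/pushforward preimage_set0 measure0. Qed.

Let leb_step_ge0 A : (0 <= leb_step A)%E.
Proof. exact: (measure_ge0 (@lebesgue_measure R \x m)%E). Qed.

Let leb_step_sigma_additive : semi_sigma_additive leb_step.
Proof.
move=> F mF tF mUF; rewrite /leb_step/pushforward preimage_bigcup.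
apply: measure_semi_sigma_additive.
- by move=> n; exact: measurable_preimage.
- apply/trivIsetP => i j _ _ ij; rewrite -preimage_setI.
  by move/trivIsetP : tF => /(_ _ _ _ _ ij) ->//; rewrite preimage_set0.
- by rewrite -preimage_bigcup; exact: measurable_preimage.
Qed.

HB.instance Definition _ := isMeasure.Build _ _ _ leb_step
  leb_step0 leb_step_ge0 leb_step_sigma_additive.

Let uncons (y : d.+1.-tuple R) : measurableTypeR R * d.-tuple R :=
  (thead y, [tuple of behead y]).

Let tconsK : cancel (@tcons d) uncons.
Proof. by move=> [x y]; congr pair; exact: val_inj. Qed.

Let measurable_uncons : measurable_fun setT uncons.
Proof.
apply/measurable_fun_pair; last exact: (@measurable_behead _ R).
exact: (@measurable_tnth _ R).
Qed.

Let leb_step_sigma_finite : sigma_finite setT leb_step.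
Proof.
have /sigma_finiteP[F [TF ndF Foo]] := sigma_finiteT (@lebesgue_measure R).
have /sigma_finiteP[G [TG ndG Goo]] := sigma_finiteT m.
exists (fun k => uncons @^-1` (F k `*` G k)).
  rewrite -preimage_bigcup -[LHS](preimage_setT uncons); congr (_ @^-1` _).
  rewrite -setXTT TF TG predeqE => -[x y]; split.
    move=> [/= [n _ Fnx] [k _ Gky]]; exists (maxn n k) => //; split.
    - by move: x Fnx; exact/subsetPset/ndF/leq_maxl.
    - by move: y Gky; exact/subsetPset/ndG/leq_maxr.
  by move=> [n _ []/= ? ?]; split; exists n.
move=> k; have [mFk Fk] := Foo k; have [mGk Gk] := Goo k; split.
  rewrite -[X in measurable X]setTI; apply: measurable_uncons => //.
  exact: measurableX.
rewrite /leb_step/pushforward -comp_preimage.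
rewrite (_ : uncons \o _ = id); last exact/funext/tconsK.
by rewrite preimage_id product_measure1E// lte_mul_pinfty// ge0_fin_numE.
Qed.

HB.instance Definition _ :=
  Measure_isSigmaFinite.Build _ _ _ leb_step leb_step_sigma_finite.

End step.

Fixpoint lebesgue_tuple (d : nat) :
    {sigma_finite_measure set (d.-tuple R) -> \bar R} :=
  if d is d'.+1 then leb_step (lebesgue_tuple d') else \d_[tuple].

End lebesgue_measure_tuple.

Lemma lebesgue_tuple_box {R : realType} (d : nat) (A : 'I_d -> set R) :
  (forall i, measurable (A i)) ->
  lebesgue_tuple d [set x | forall i, A i (tnth x i)] =
  (\prod_(i < d) lebesgue_measure (A i))%E.
Proof.
elim: d A => [|d IH] A mA.
  rewrite big_ord0 /= diracE (_ : _ \in _) ?mem_set//= => -[].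
  by [].
rewrite big_ord_recl /= -IH; last by [].
rewrite -product_measure1E//.
  rewrite /leb_step/pushforward; congr (_ _); apply/seteqP; split=> -[x y] /=.
    move=> Axy; split; first by have := Axy ord0; rewrite tnth0.
    by move=> i; have := Axy (lift ord0 i); rewrite tnthS.
  move=> [Ax Ay] i; have [j ->|->] := unliftP ord0 i; first by rewrite tnthS.
  by rewrite tnth0.
  exact: (mA ord0).
rewrite (_ : [set x | _] = \bigcap_(i in [set: 'I_d])
    ((fun y => tnth y i) @^-1` A (lift ord0 i))); last first.
  by apply/seteqP; split=> y /= H i => [_|]; [exact: H|exact: (H i)].
apply: fin_bigcap_measurable => // i _.
by rewrite -[X in measurable X]setTI; exact: (@measurable_tnth _ R).
Qed.

Section euclidean.
Context {R : realType} {d : nat}.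
Implicit Types x y : d.-tuple R.

Definition dotp x y : R := \sum_(i < d) tnth x i * tnth y i.
Definition enorm x : R := Num.sqrt (dotp x x).

(* B(0, r); it is empty when r <= 0. *)
Definition oball0 (r : R) : set (d.-tuple R) := [set x | enorm x < r].

End euclidean.

Section complex_functions.
Context {R : realType} {d : nat}.
Local Notation mu := (lebesgue_tuple d : {measure set (d.-tuple R) -> \bar R}).
Implicit Types f g : d.-tuple R -> R[i].

Definition cabs (z : R[i]) : R := ComplexField.Normc.normc z.

Definition cmeasurable f :=
  measurable_fun setT (fun x => complex.Re (f x)) /\
  measurable_fun setT (fun x => complex.Im (f x)).

Definition cLnorm (p : \bar R) f : \bar R :=
  Lnorm mu p (fun x => (cabs (f x))%:E).

Definition cLp (p : \bar R) f := cmeasurable f /\ (cLnorm p f < +oo)%E.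

Definition cintegral f : R[i] :=
  Complex (\int[mu]_(x in setT) complex.Re (f x))
          (\int[mu]_(x in setT) complex.Im (f x)).

(* e^{-2 i pi <t, xi>} *)
Definition fourier_kernel (t xi : d.-tuple R) : R[i] :=
  Complex (cos (2 * pi * dotp t xi)) (- sin (2 * pi * dotp t xi)).

Definition fourier_L1 f : d.-tuple R -> R[i] :=
  fun xi => cintegral (fun t => f t * fourier_kernel t xi).

(* g is an L^2-limit of transforms of functions of L^1 /\ L^2 that converge to
   f in L^2; by Plancherel's theorem such a g exists for every f in L^2, and is
   unique up to a null set. *)
Definition is_fourier_L2 f g :=
  cLp 2%:E g /\
  exists2 u : (d.-tuple R -> R[i])^nat,
    (forall n, cLp 1%:E (u n) /\ cLp 2%:E (u n)) &
    (fun n => cLnorm 2%:E (fun x => u n x - f x)) @ \oo --> 0%E /\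
    (fun n => cLnorm 2%:E (fun xi => fourier_L1 (u n) xi - g xi)) @ \oo --> 0%E.

(* A representative of the class of the transform of f, for f in L^2. *)
Definition fourier f : d.-tuple R -> R[i] :=
  xget (fun=> 0) [set g | is_fourier_L2 f g].

End complex_functions.

Section rearrangement.
Context {R : realType} {d : nat}.
Local Notation mu := (lebesgue_tuple d : {measure set (d.-tuple R) -> \bar R}).

(* The r such that |B(0, r)| = |E|, for E of finite measure; it is only
   determined up to r <= 0 when |E| = 0, and then B(0, r) is empty. *)
Definition vradius (E : set (d.-tuple R)) : R :=
  xget 0 [set r | mu (oball0 r) = mu E].

Definition srearr_set (E : set (d.-tuple R)) : set (d.-tuple R) :=
  oball0 (vradius E).

(* The value can be +oo at the origin, hence the codomain. *)
Definition srearr (f : d.-tuple R -> R[i]) (x : d.-tuple R) : \bar R :=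
  (\int[lebesgue_measure]_(l in `]0%R, +oo[)
     (\1_(srearr_set [set y | l < cabs (f y)]) x)%:E)%E.

(* As an (a.e. defined) complex-valued function; the value at the origin is
   immaterial, and fine sends +oo to 0 there. *)
Definition csrearr (f : d.-tuple R -> R[i]) (x : d.-tuple R) : R[i] :=
  Complex (fine (srearr f x)) 0.

End rearrangement.

(* Main.v *)
(* Write g for the radially decreasing rearrangement of |phi|, and let rho be of
   order 1 / tau.  Split phi at twice the level lam = g(rho).  The large part
   has L^1 norm at most a constant times I = int_{B(0, rho)} g, so the square of
   its transform contributes at most |Sigma| I^2 to the left-hand side.  The
   small part is handled by Bessel's inequality; by equimeasurability the square
   of its L^2 norm is at most a constant times J + lam^2 |B(0, rho)|, with J the
   integral of g^2 outside B(0, rho), and lam |B(0, rho)| <= I.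
   Conversely, a product H of one-dimensional triangle functions is supported in
   B(0, tau), bounded by 1, and has a positive transform K (a Fejer kernel), so
     int H(xi) Re (g^ (xi) conj (w^ (xi))) dxi = int int g(x) w(y) K(x - y) dx dy
   for every real w.  The choices w = indicator of B(0, rho) and
   w = g outside B(0, rho), with the monotonicity of g and a lower bound of K
   near 0, give I^2 / |B(0, rho)| and J as lower bounds of the right-hand side,
   up to constants.  Bessel's inequality follows from the same formula by Schur's
   test, and letting the support of H exhaust R^d. *)
Require Import Defs.
From HB Require Import structures.
From mathcomp Require Import all_boot all_order all_algebra.
From mathcomp Require Import all_classical all_reals all_analysis.
From mathcomp Require Import measurable_realfun.
From mathcomp Require Import complex.
From mathcomp Require Import ring lra.

Set Implicit Arguments.
Unset Strict Implicit.
Unset Printing Implicit Defensive.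

Import Order.TTheory GRing.Theory Num.Theory.
Import numFieldNormedType.Exports.

Local Open Scope classical_set_scope.
Local Open Scope ring_scope.

(** * Integration on R^d *)

(** The rearrangement [g] is only known to lie in L^2, whereas the pairing formula is a Fubini
    argument in L^1. The lower bounds are therefore proved for the cut-offs of [g] to the sets where
    it exceeds a level t, which are integrable and still radially decreasing; an error that is
    arbitrarily small with t is removed afterwards. Since [fourier] is a chosen representative, only
    its stability under L^2 approximation by integrable functions is used. The indicator of B(0,
    tau) would be a poor weight, as its transform changes sign. A nonnegative kernel can be bounded
    below pointwise, and the weight [H], being at most 1, is dropped after an arithmetic-geometric
    mean inequality with a free parameter; the transform of [w] is then paid for by Bessel's
    inequality. For the part outside B(0, rho), a point x compared with y has to be near y, for the
    kernel, and closer to 0 than y, for the monotonicity of [g]: a ball touching the sphere through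
    y from inside satisfies both. The width of the triangles is proportional to tau and rho to 1 /
    tau, so that tau cancels from every constant. *)

Section affine_line.
Context {R : realType}.
Variables (a b : R).
Hypothesis a0 : 0 < a.
Local Notation mu := (@lebesgue_measure R).

Let aff (x : measurableTypeR R) : measurableTypeR R := a * x + b.

Let maff : measurable_fun setT aff.
Proof. by apply: measurable_funD => //; exact: measurable_funM. Qed.

Let scaled : {measure set (measurableTypeR R) -> \bar R} :=
  mscale (NngNum (ltW a0))
    (measure_function_pushforward__canonical__measure_function_Measure mu maff).

(** The two measures agree on half-open intervals, which determine Lebesgue measure. *)
Let scaledE A : measurable A -> mu A = scaled A.
Proof.
move=> mA; apply: lebesgue_measure_unique => // _ [[u v]] _ <-.
rewrite /scaled/= /mscale/= /pushforward.
have -> : aff @^-1` `]u, v] = `](u - b) / a, (v - b) / a]%classic.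
  apply/seteqP; split => x /=; rewrite !in_itv/= /aff => /andP[h1 h2].
    by rewrite ltr_pdivrMr// ler_pdivlMr// ltrBlDr lerBrDr mulrC h1.
  move: h1 h2; rewrite ltr_pdivrMr// ler_pdivlMr// ltrBlDr lerBrDr mulrC.
  by move=> -> ->.
rewrite !lebesgue_measure_itv/= !lte_fin ltr_pM2r ?invr_gt0// ltrD2r.
case: ifPn => uv; last by rewrite mule0.
rewrite -!EFinB -EFinM; congr EFin; field; exact: lt0r_neq0.
Qed.

Lemma ge0_integral_affine (f : R -> \bar R) :
  measurable_fun setT (f : measurableTypeR R -> \bar R) ->
  (forall x, 0 <= f x)%E ->
  (\int[mu]_x f (a * x + b)%R = a^-1%:E * \int[mu]_x f x)%E.
Proof.
move=> mf f0; rewrite [in RHS](@eq_measure_integral _ _ _ _ scaled); last first.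
  by move=> A mA _; exact: scaledE.
rewrite ge0_integral_mscale//= muleA -EFinM mulVf ?gt_eqF// mul1e.
by rewrite ge0_integral_pushforward.
Qed.

End affine_line.

Section tuple_integral.
Context {R : realType}.
Local Notation T d := (d.-tuple R).
Local Notation lam := (@lebesgue_measure R).
Local Notation leb d :=
  (lebesgue_tuple d : {sigma_finite_measure set (T d) -> \bar R}).

Lemma ge0_integral_tcons d (f : T d.+1 -> \bar R) :
  measurable_fun setT f -> (forall x, 0 <= f x)%E ->
  (\int[leb d.+1]_x f x = \int[lam]_x \int[leb d]_y f (tcons (x, y)))%E.
Proof.
move=> mf f0.
have mft : measurable_fun setT (f \o @tcons R d).
  by apply: measurableT_comp => //; exact: measurable_tcons.
rewrite -(fubini_tonelli1 (f \o @tcons R d))//=.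
exact: (ge0_integral_pushforward (@measurable_tcons R d) (lam \x leb d)%E measurableT mf).
Qed.

Lemma integrable_tcons d (f : T d.+1 -> \bar R) :
  (leb d.+1).-integrable setT f -> (lam \x leb d)%E.-integrable setT (f \o @tcons R d).
Proof.
move=> /integrableP[mf fi]; apply/integrableP; split.
  by apply: measurableT_comp => //; exact: measurable_tcons.
move: fi; rewrite ge0_integral_tcons//; last exact: measurableT_comp.
rewrite (fubini_tonelli1 (abse \o (f \o @tcons R d)))//.
  apply: measurableT_comp => //.
  by apply: measurableT_comp => //; exact: measurable_tcons.
by move=> x; exact: abse_ge0.
Qed.

Lemma integral_tcons d (f : T d.+1 -> \bar R) :
  (leb d.+1).-integrable setT f ->
  (\int[leb d.+1]_x f x = \int[lam]_x \int[leb d]_y f (tcons (x, y)))%E.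
Proof.
move=> fi; have fti := integrable_tcons fi.
rewrite (integral12_prod_meas1 fti).
have /integrableP[mf _] := fi.
exact: (integral_pushforward (@measurable_tcons R d) mf fti measurableT).
Qed.

Lemma ge0_integral_tuple0 (f : T 0 -> \bar R) :
  (\int[leb 0]_x f x = f [tuple])%E.
Proof.
rewrite /=; have mf : measurable_fun setT f.
  move=> _ Y _; rewrite setTI; have [h|h] := pselect (Y (f [tuple])).
    rewrite [X in measurable X](_ : _ = setT)//; apply/seteqP; split => // x _ /=.
    by rewrite tuple0.
  rewrite [X in measurable X](_ : _ = set0)//; apply/seteqP; split => // x /=.
  by rewrite tuple0.
by rewrite integral_dirac// diracT mul1e.
Qed.

(** Dilation and translation in one map: a single change of variables gives the volume of balls and
    of their translates. *)
Definition taff d (a : R) (b x : T d) : T d := [tuple a * tnth x i + tnth b i | i < d].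

Lemma measurable_taff d a (b : T d) : measurable_fun setT (taff a b).
Proof.
apply/measurable_fun_tnthP => i.
rewrite [X in measurable_fun _ X](_ : _ = (fun x => a * tnth x i + tnth b i)); last first.
  by apply/funext => x /=; rewrite tnth_mktuple.
apply: measurable_funD => //; apply: measurable_funM => //.
exact: (@measurable_tnth _ (measurableTypeR R)).
Qed.

Lemma taff_tcons d a b0 (b : T d) x y :
  taff a (tcons (b0, b)) (tcons (x, y)) = tcons (a * x + b0, taff a b y).
Proof.
apply: eq_from_tnth => i; rewrite tnth_mktuple.
have [j ->|->] := unliftP ord0 i; first by rewrite /tcons/= !tnthS tnth_mktuple.
by rewrite /tcons/= !tnth0.
Qed.

Lemma tcons_surj d (b : T d.+1) : b = tcons (thead b, [tuple of behead b]).
Proof. by rewrite /tcons/=; exact: tuple_eta. Qed.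

(** Induction on the dimension: Tonelli splits off the first coordinate, whose affine substitution
    contributes one factor [a^-1]. *)
Lemma ge0_integral_taff d a (b : T d) (f : T d -> \bar R) : 0 < a ->
  measurable_fun setT f -> (forall x, 0 <= f x)%E ->
  (\int[leb d]_x f (taff a b x) = (a ^- d)%:E * \int[leb d]_x f x)%E.
Proof.
move=> a0; elim: d b f => [|d IH] b f mf f0.
  by rewrite !ge0_integral_tuple0 expr0 invr1 mul1e; congr f; rewrite !tuple0.
have mft : measurable_fun setT (f \o @tcons R d).
  by apply: measurableT_comp => //; exact: measurable_tcons.
rewrite ge0_integral_tcons//; last first.
  by apply: measurableT_comp => //; exact: measurable_taff.
rewrite (tcons_surj b).
under eq_integral.
  move=> x _; under eq_integral do rewrite taff_tcons.
  rewrite (IH _ (fun y => f (tcons (a * x + thead b, y))))//; last first.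
    by apply: measurableT_comp mft (pair1_measurable _).
  over.
have mF := measurable_fun_fubini_tonelli_F (m2 := leb d) _ mft (fun _ => f0 _).
rewrite (@ge0_integralZl_EFin _ _ _ _ _ measurableT)//=; last 3 first.
- by move=> x _; exact: integral_ge0.
- apply: (measurableT_comp mF).
  by apply: measurable_funD => //; exact: measurable_funM.
- by rewrite invr_ge0 exprn_ge0// ltW.
rewrite (@ge0_integral_affine _ _ _ a0 (fun x => \int[leb d]_y f (tcons (x, y)))%E)//; last first.
  by move=> x; exact: integral_ge0.
by rewrite -ge0_integral_tcons// muleA -EFinM -invfM exprS mulrC.
Qed.

End tuple_integral.

Section euclidean_norm.
Context {R : realType} {d : nat}.
Implicit Types x y b : d.-tuple R.

Lemma dotp_ge0 x : 0 <= dotp x x.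
Proof. by apply: sumr_ge0 => i _; rewrite -expr2 sqr_ge0. Qed.

Lemma enorm_ge0 x : 0 <= enorm x.
Proof. exact: sqrtr_ge0. Qed.

Lemma sqr_enorm x : enorm x ^+ 2 = dotp x x.
Proof. by rewrite sqr_sqrtr// dotp_ge0. Qed.

Lemma dotp_taff a b x :
  dotp (taff a b x) (taff a b x) = a ^+ 2 * dotp x x + 2 * a * dotp x b + dotp b b.
Proof.
rewrite /dotp !mulr_sumr -!big_split/=; apply: eq_bigr => i _.
by rewrite !tnth_mktuple; ring.
Qed.

(** Expand the sum of the squares of [enorm y * tnth x i - enorm x * tnth y i] and divide by
    [enorm x * enorm y]; vanishing norms are treated apart. *)
Lemma cauchy_schwarz_dotp x y : dotp x y <= enorm x * enorm y.
Proof.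
have [x0|x0] := eqVneq (enorm x) 0.
  have xi i : tnth x i = 0.
    have /eqP : dotp x x = 0 by rewrite -sqr_enorm x0 expr0n.
    rewrite psumr_eq0 => [|j _]; last by rewrite -expr2 sqr_ge0.
    by move=> /allP/(_ i (mem_index_enum _))/=; rewrite -expr2 sqrf_eq0 => /eqP.
  by rewrite x0 mul0r /dotp big1// => i _; rewrite xi mul0r.
have {}x0 : 0 < enorm x by rewrite lt_neqAle eq_sym x0 enorm_ge0.
have : 0 <= \sum_(i < d) (enorm y * tnth x i - enorm x * tnth y i) ^+ 2.
  by apply: sumr_ge0 => i _; exact: sqr_ge0.
have -> : \sum_(i < d) (enorm y * tnth x i - enorm x * tnth y i) ^+ 2 =
    enorm y ^+ 2 * dotp x x + enorm x ^+ 2 * dotp y y - 2 * enorm x * enorm y * dotp x y.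
  rewrite /dotp !mulr_sumr -sumrN -!big_split/=; apply: eq_bigr => i _; ring.
rewrite -!sqr_enorm => h.
have [y0|y0] := eqVneq (enorm y) 0.
  rewrite y0 mulr0 /dotp big1// => i _.
  have /eqP : dotp y y = 0 by rewrite -sqr_enorm y0 expr0n.
  rewrite psumr_eq0 => [|j _]; last by rewrite -expr2 sqr_ge0.
  move=> /allP/(_ i (mem_index_enum _))/=; rewrite -expr2 sqrf_eq0 => /eqP ->.
  by rewrite mulr0.
have {}y0 : 0 < enorm y by rewrite lt_neqAle eq_sym y0 enorm_ge0.
have xy0 : 0 < enorm x * enorm y by exact: mulr_gt0.
rewrite -subr_ge0 -(pmulr_rge0 _ xy0).
have -> : enorm x * enorm y * (enorm x * enorm y - dotp x y) =
    (enorm y ^+ 2 * enorm x ^+ 2 + enorm x ^+ 2 * enorm y ^+ 2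
     - 2 * enorm x * enorm y * dotp x y) / 2 by field.
by rewrite divr_ge0.
Qed.

Lemma enorm_taff a b x : 0 <= a -> enorm (taff a b x) <= a * enorm x + enorm b.
Proof.
move=> a0; rewrite -(@ler_pXn2r _ 2)// ?nnegrE ?enorm_ge0 ?addr_ge0 ?mulr_ge0 ?enorm_ge0//.
rewrite sqr_enorm dotp_taff -!sqr_enorm.
have := ler_wpM2l a0 (cauchy_schwarz_dotp x b); lra.
Qed.

Lemma normr_tnth_le_enorm x i : `|tnth x i| <= enorm x.
Proof.
rewrite -sqrtr_sqr ler_sqrt ?dotp_ge0// /dotp (bigD1 i)//= -expr2 lerDl.
by apply: sumr_ge0 => j _; rewrite -expr2 sqr_ge0.
Qed.

Lemma enorm_le_sum x : enorm x <= \sum_(i < d) `|tnth x i|.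
Proof.
rewrite -(@ler_pXn2r _ 2)// ?nnegrE ?enorm_ge0 ?sumr_ge0// sqr_enorm /dotp.
rewrite [leRHS]expr2 mulr_suml; apply: ler_sum => i _.
rewrite (le_trans (ler_norm _))// normrM ler_wpM2l//.
by rewrite (bigD1 i)//= lerDl sumr_ge0.
Qed.

Lemma measurable_enorm : measurable_fun setT (@enorm R d).
Proof.
have -> : @enorm R d = (fun s => s `^ (2^-1)) \o (fun x => dotp x x).
  by apply/funext => x; rewrite /enorm /= powR12_sqrt// dotp_ge0.
apply: measurableT_comp; first exact: measurable_powR.
apply: measurable_sum => i.
by apply: measurable_funM; exact: (@measurable_tnth _ (measurableTypeR R)).
Qed.

Lemma measurable_oball0 r : measurable (@oball0 R d r).
Proof.
have := @measurable_fun_ltr _ _ R setT (@enorm R d) (cst r) measurable_enorm.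
move=> /(_ (measurable_cst _) measurableT [set true] I).
by rewrite setTI.
Qed.

End euclidean_norm.

Section ball_volume.
Context {R : realType}.
Local Notation leb d :=
  (lebesgue_tuple d : {sigma_finite_measure set (d.-tuple R) -> \bar R}).

Definition vball1 d : R := fine (leb d (oball0 1)).

Lemma measurable_box d (A : 'I_d -> set R) : (forall i, measurable (A i)) ->
  measurable [set x : d.-tuple R | forall i, A i (tnth x i)].
Proof.
move=> mA; rewrite (_ : [set x | _] = \bigcap_(i in [set: 'I_d])
    ((fun y => tnth y i) @^-1` A i)); last first.
  by apply/seteqP; split=> y /= H i => [_|]; [exact: H|exact: (H i)].
apply: fin_bigcap_measurable => // i _.
by rewrite -[X in measurable X]setTI; exact: (@measurable_tnth _ R).
Qed.

Lemma lebesgue_tuple_ball1_lty d : (leb d (oball0 1) < +oo)%E.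
Proof.
pose A (i : 'I_d) : set R := `]-1, 1[%classic.
have mA i : measurable (A i) by exact: measurable_itv.
apply: (@le_lt_trans _ _ (leb d [set x | forall i, A i (tnth x i)])).
  apply: le_measure; rewrite ?inE//; first exact: measurable_oball0.
    exact: measurable_box.
  move=> x /= x1 i; rewrite /A/= in_itv/= -ltr_norml.
  exact: le_lt_trans (normr_tnth_le_enorm x i) x1.
rewrite lebesgue_tuple_box//.
under eq_bigr do rewrite /A lebesgue_measure_itv/= lte_fin (lt_trans (ltrN10 _) ltr01) -EFinB.
by rewrite prodEFin ltry.
Qed.

Lemma vball1E d : leb d (oball0 1) = (vball1 d)%:E.
Proof. by rewrite /vball1 fineK// ge0_fin_numE// lebesgue_tuple_ball1_lty. Qed.

Lemma vball1_gt0 d : 0 < vball1 d.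
Proof.
rewrite -lte_fin -vball1E.
(* With [d + 1] in place of [d] the coordinates of a point of the cube have absolute sum at most
   [d / (d + 1) < 1], and [e] makes sense for [d = 0] too. *)
pose e : R := d.+1%:R^-1; have e0 : 0 < e by rewrite invr_gt0.
pose A (i : 'I_d) : set R := `]-e, e[%classic.
have mA i : measurable (A i) by exact: measurable_itv.
apply: (@lt_le_trans _ _ (leb d [set x | forall i, A i (tnth x i)])).
  rewrite lebesgue_tuple_box//.
  under eq_bigr do rewrite /A lebesgue_measure_itv/= lte_fin gtrN// -EFinB opprK.
  by rewrite prodEFin lte_fin prodr_gt0// => i _; rewrite addr_gt0.
apply: le_measure; rewrite ?inE//; last 2 first.
- exact: measurable_oball0.
- move=> x /= Ax; rewrite /oball0/= (le_lt_trans (enorm_le_sum x))//.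
  apply: (@le_lt_trans _ _ (\sum_(i < d) e)).
    apply: ler_sum => i _; have := Ax i; rewrite /A/= in_itv/= -ltr_norml.
    exact: ltW.
  by rewrite sumr_const card_ord -mulr_natl /e ltr_pdivrMr// mul1r ltr_nat.
exact: measurable_box.
Qed.

Lemma lebesgue_tuple_taff_preimage d a (b : d.-tuple R) (A : set (d.-tuple R)) :
  0 < a -> measurable A ->
  (leb d (taff a b @^-1` A) = (a ^- d)%:E * leb d A)%E.
Proof.
move=> a0 mA.
have mtA : measurable (taff a b @^-1` A).
  by rewrite -[X in measurable X]setTI; exact: measurable_taff.
have -> : leb d (taff a b @^-1` A) = (\int[leb d]_x (\1_A (taff a b x))%:E)%E.
  by rewrite -[X in leb d X]setIT -integral_indic.
rewrite (ge0_integral_taff b a0 (f := fun x => (\1_A x)%:E))//.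
- by rewrite integral_indic// setIT.
- by apply/measurable_EFinP; exact: measurable_indic.
Qed.

Lemma lebesgue_tuple_ball d r : 0 < r -> leb d (oball0 r) = (r ^+ d * vball1 d)%:E.
Proof.
move=> r0; have := lebesgue_tuple_taff_preimage [tuple 0 | i < d] r0 (measurable_oball0 r).
have -> : taff r [tuple 0 | i < d] @^-1` oball0 r = oball0 1.
  have e (x : d.-tuple R) : enorm (taff r [tuple 0 | i < d] x) = r * enorm x.
    have dot0 y : dotp y [tuple 0 | i < d] = 0 :> R.
      by rewrite /dotp big1// => i _; rewrite tnth_mktuple mulr0.
    by rewrite {1}/enorm dotp_taff !dot0 mulr0 !addr0 sqrtrM ?sqr_ge0// sqrtr_sqr gtr0_norm.
  by apply/seteqP; split => x /=; rewrite /oball0/= e mulrC -ltr_pdivlMr// divff ?gt_eqF.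
rewrite vball1E EFinM => ->; rewrite muleA -EFinM mulfV ?mul1e// gt_eqF//.
exact: exprn_gt0.
Qed.

Lemma oball0_le0 d r : r <= 0 -> @oball0 R d r = set0.
Proof.
by move=> r0; apply/seteqP; split => // x; rewrite /oball0/= ltNge (le_trans r0)// enorm_ge0.
Qed.

(** At [r = 0] the ball is empty, while the formula would give [0 ^+ 0 = 1] in dimension 0. *)
Lemma lebesgue_tuple_ball_ge0 d r : (0 < d)%N -> 0 <= r ->
  leb d (oball0 r) = (r ^+ d * vball1 d)%:E.
Proof.
move=> d0; rewrite le_eqVlt => /predU1P[<-|]; last exact: lebesgue_tuple_ball.
by rewrite oball0_le0// measure0 expr0n gtn_eqF// mul0r.
Qed.

Lemma lebesgue_tuple_ball_surj d (m : \bar R) : (0 < d)%N ->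
  (0 <= m < +oo)%E -> exists r, leb d (oball0 r) = m.
Proof.
move=> d0 /andP[m0 moo].
have mE : m = (fine m)%:E by rewrite fineK// ge0_fin_numE.
exists ((fine m / vball1 d) `^ d%:R^-1).
rewrite lebesgue_tuple_ball_ge0 ?powR_ge0// -powR_mulrn ?powR_ge0// -powRrM.
have v0 := vball1_gt0 d.
have mv0 : 0 <= fine m / vball1 d by rewrite divr_ge0 ?fine_ge0// ltW.
by rewrite mulVf ?pnatr_eq0 -?lt0n// powRr1// divfK ?gt_eqF.
Qed.

End ball_volume.

(** * Triangle functions and Fejer kernels *)

Section triangle.
Context {R : realType}.
Local Notation mu := (@lebesgue_measure R).

Definition tri (a x : R) : R := Num.max 0 (1 - `|x| / a).

(* The transform of [tri a]; the value at the origin is the limit. *)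
Definition fejer (a z : R) : R :=
  if z == 0 then a else
  2 * (1 - cos (2 * pi * z * a)) / (a * (2 * pi * z) ^+ 2).

Lemma integral_itv_derive (f F : R -> R) (u v : R) : u < v ->
  continuous f -> (forall x : R, is_derive x 1 F (f x)) ->
  (\int[mu]_(x in `[u, v]) (f x)%:E = (F v - F u)%:E)%E.
Proof.
move=> uv cf dF.
have cF : continuous F.
  by move=> x; apply: differentiable_continuous; apply/derivable1_diffP; apply: ex_derive.
rewrite (@continuous_FTC2 _ f F)//.
- exact: continuous_subspaceT.
- split.
  + by move=> x _; apply: ex_derive.
  + by apply: cvg_at_right_filter; exact: cF.
  + by apply: cvg_at_left_filter; exact: cF.
- by move=> x _; rewrite derive1E; exact: derive_val.
Qed.

Lemma tri_ge0 a x : 0 <= tri a x.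
Proof. by rewrite /tri le_max lexx. Qed.

Lemma tri_le1 a x : 0 < a -> tri a x <= 1.
Proof. by move=> a0; rewrite /tri ge_max ler01/= gerBl divr_ge0// ltW. Qed.

Lemma measurable_tri a : measurable_fun setT (tri a).
Proof.
apply: measurable_maxr => //; apply: measurable_funB => //.
by apply: measurable_funM => //; exact: measurableT_comp.
Qed.

Section integrals.
Variables (a th b : R).
Hypothesis a0 : 0 < a.

Let L (x : R) := th + b * x.

Let dL (x : R) : is_derive x 1 L b.
Proof.
have dl := is_deriveD (is_derive_cst th x 1) (is_deriveZ b (is_derive_id x 1)).
by apply: (is_derive_eq dl); rewrite add0r /GRing.scale/= mulr1.
Qed.

Let dcosL (x : R) : is_derive x 1 (fun x => cos (L x)) (b * - sin (L x)).
Proof.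
rewrite mulrC; exact: (is_derive1_comp (is_derive_cos _) (dL x)).
Qed.

Let dsinL (x : R) : is_derive x 1 (fun x => sin (L x)) (b * cos (L x)).
Proof.
rewrite mulrC; exact: (is_derive1_comp (is_derive_sin _) (dL x)).
Qed.

(* [e] is the slope [1 / a] on the left half of the triangle and [- 1 / a] on the right one. *)
Let dF e : b != 0 -> forall x : R,
  is_derive x 1 (fun x => (1 + e * x) * (sin (L x) / b) + e * (cos (L x) / b ^+ 2))
    ((1 + e * x) * cos (L x)).
Proof.
move=> b0 x.
have dl := is_deriveD (is_deriveM (is_deriveD (is_derive_cst (1 : R) x 1)
    (is_deriveZ e (is_derive_id x 1))) (is_deriveZ b^-1 (dsinL x)))
  (is_deriveZ (e / b ^+ 2) (dcosL x)).
have -> : (fun x => (1 + e * x) * (sin (L x) / b) + e * (cos (L x) / b ^+ 2)) =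
   ((cst 1 + e \*: (@idfun R)) * (b^-1 \*: (fun x => sin (L x)))) +
   (e / b ^+ 2) \*: (fun x => cos (L x)).
  by apply/funext => y; rewrite !fctE/= /GRing.scale/=; field.
apply: (is_derive_eq dl); rewrite !fctE /GRing.scale/=.
transitivity ((1 + e * x) * (b^-1 * (b * cos (L x))) + b^-1 * sin (L x) * (0 + e * 1) +
  e / b ^+ 2 * (b * - sin (L x))) => //; field; exact: b0.
Qed.

Let cf e : continuous (fun x : R => (1 + e * x) * cos (L x)).
Proof.
move=> x; apply: cvgM.
  by apply: cvgD; [exact: cvg_cst|apply: cvgM; [exact: cvg_cst|exact: cvg_id]].
apply: continuous_comp; last exact: continuous_cos.
by apply: cvgD; [exact: cvg_cst|apply: cvgM; [exact: cvg_cst|exact: cvg_id]].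
Qed.

Let f x := (tri a x * cos (L x))%:E.

Let mf : measurable_fun setT f.
Proof.
apply/measurable_EFinP; apply: measurable_funM; first exact: measurable_tri.
apply: (@measurableT_comp _ _ _ _ _ _ (@cos R)).
  by apply: continuous_measurable_fun; exact: continuous_cos.
by apply: measurable_funD => //; exact: measurable_funM.
Qed.

Let f_out x : x \notin `[- a, a] -> f x = 0%E.
Proof.
rewrite in_itv/= -ler_norml -ltNge => ax; rewrite /f /tri max_l ?mul0r//.
by rewrite subr_le0 ler_pdivlMr// mul1r ltW.
Qed.

Let intf : mu.-integrable setT f.
Proof.
apply: (@le_integrable _ _ R mu setT measurableT f (EFin \o \1_(`[- a, a]%classic : set (measurableTypeR R)))).
- exact: mf.
- move=> x _; have [xa|xa] := boolP (x \in `[- a, a]).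
    rewrite /f lee_fin indicE mem_set//= normrM normr1.
    by rewrite mulr_ile1 ?normr_ge0 ?cos_max// ger0_norm ?tri_ge0 ?tri_le1.
  by rewrite f_out// abse0 abse_ge0.
- by apply: integrable_indic_itv.
Qed.

Lemma integral_tri_cos_split : (\int[mu]_x (tri a x * cos (L x))%:E =
   \int[mu]_(x in `[(- a)%R, 0%R]) ((1 + a^-1 * x) * cos (L x))%:E +
   \int[mu]_(x in `[0%R, a]) ((1 + - a^-1 * x) * cos (L x))%:E)%E.
Proof.
transitivity (\int[mu]_(x in `[(- a)%R, a]) f x)%E.
  rewrite [RHS]integral_mkcond; apply: eq_integral => x _; rewrite patchE.
  by case: ifPn => //; rewrite notin_setE/= => /negP; exact: f_out.
have -> : [set` `[- a, a]] = [set` `[- a, 0%R[] `|` [set` `[0, a]].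
  apply/seteqP; split => x /=; rewrite !in_itv/=.
    by move=> /andP[h1 h2]; case: (ltP x 0) => x0; [left|right]; rewrite ?h1 ?h2.
  move=> [/andP[h1 h2]|/andP[h1 h2]]; apply/andP; split => //.
    by rewrite (le_trans (ltW h2))// ltW.
  by rewrite (le_trans _ h1)// oppr_le0 ltW.
have iS A : measurable A -> mu.-integrable A f.
  by move=> mA; exact: (integrableS measurableT).
rewrite integral_setU//=; last 2 first.
- exact: measurable_funTS.
- apply/disj_setPS => x /= []; rewrite !in_itv/= => /andP[_ h1] /andP[h2 _].
  by move: h1; rewrite ltNge h2.
rewrite integral_itv_bndo_bndc; last exact: measurable_funTS.
congr (_ + _)%E; apply: eq_integral => x; rewrite inE/= in_itv/= => /andP[h1 h2].
  rewrite /f /tri ler0_norm// max_r; first by congr (_ * _)%:E; field; rewrite gt_eqF.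
  by rewrite subr_ge0 ler_pdivrMr// mul1r lerNl.
rewrite /f /tri ger0_norm// max_r; first by congr (_ * _)%:E; field; rewrite gt_eqF.
by rewrite subr_ge0 ler_pdivrMr// mul1r.
Qed.

Lemma integrable_tri_cos : mu.-integrable setT (fun x => (tri a x * cos (th + b * x))%:E).
Proof. exact: intf. Qed.

Lemma integral_tri_cos_neq0 : b != 0 ->
  (\int[mu]_x (tri a x * cos (th + b * x))%:E =
   (cos th * (2 * (1 - cos (b * a)) / (a * b ^+ 2)))%:E)%E.
Proof.
move=> b0; rewrite integral_tri_cos_split.
rewrite (integral_itv_derive _ (@cf a^-1) (@dF a^-1 b0)) ?oppr_lt0//.
rewrite (integral_itv_derive _ (@cf (- a^-1)) (@dF (- a^-1) b0))//.
rewrite -EFinD; congr EFin; rewrite /L !mulr0 !addr0 !mulrN (cosB th) (cosD th).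
field; by rewrite b0 gt_eqF.
Qed.

End integrals.

(** The split at frequency 0; the primitive used above divides by the frequency, so a quadratic
    polynomial replaces it. *)
Lemma integral_tri a : 0 < a -> (\int[mu]_x (tri a x)%:E = a%:E)%E.
Proof.
move=> a0; have := @integral_tri_cos_split a 0 0 a0.
have c1 (x : R) : cos (0 + 0 * x) = 1 by rewrite mul0r addr0 cos0.
under eq_integral do rewrite c1 mulr1.
under [in X in _ = X -> _]eq_integral do rewrite c1 mulr1.
under [in X in _ = (_ + X)%E -> _]eq_integral do rewrite c1 mulr1.
move=> ->.
have dG e (x : R) : is_derive x 1 (fun x => x + e / 2 * (x * x)) (1 + e * x).
  have dl := is_deriveD (is_derive_id x 1)
    (is_deriveZ (e / 2) (is_deriveM (is_derive_id x 1) (is_derive_id x 1))).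
  apply: (is_derive_eq dl); rewrite /GRing.scale/=.
  transitivity (1 + e / 2 * (x * 1 + x * 1)) => //. by field.
have cg e : continuous (fun x : R => 1 + e * x).
  by move=> x; apply: cvgD; [exact: cvg_cst|apply: cvgM; [exact: cvg_cst|exact: cvg_id]].
rewrite (integral_itv_derive _ (@cg a^-1) (@dG a^-1)) ?oppr_lt0//.
rewrite (integral_itv_derive _ (@cg (- a^-1)) (@dG (- a^-1)))//.
rewrite -EFinD; congr EFin; field; by rewrite gt_eqF.
Qed.

Lemma integrable_tri a : 0 < a -> mu.-integrable setT (fun x => (tri a x)%:E).
Proof.
move=> a0; have := @integrable_tri_cos a 0 0 a0.
by under eq_fun do rewrite mul0r addr0 cos0 mulr1.
Qed.

(** The triangle is even, so the phase comes out as the factor [cos th]. The free phase is what the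
    induction on the dimension consumes. *)
Lemma integral_tri_cos a th z : 0 < a ->
  (\int[mu]_x (tri a x * cos (th + 2 * pi * z * x))%:E = (cos th * fejer a z)%:E)%E.
Proof.
move=> a0; rewrite /fejer; have [->|z0] := eqVneq z 0.
  under eq_integral do rewrite mulr0 mul0r addr0 mulrC EFinM.
  by rewrite integralZl//= ?integral_tri//; exact: integrable_tri.
by rewrite integral_tri_cos_neq0// !mulf_neq0// gt_eqF// pi_gt0.
Qed.

Lemma fejer_ge0 a z : 0 < a -> 0 <= fejer a z.
Proof.
move=> a0; rewrite /fejer; case: ifPn => _; first exact: ltW.
by rewrite divr_ge0// mulr_ge0// ?subr_ge0 ?cos_le1 ?sqr_ge0 ?ltW.
Qed.

Lemma measurable_fejer a : 0 < a -> measurable_fun setT (fejer a).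
Proof.
(* The denominator is nonnegative, so its inverse is a real power, whose measurability is at
   hand. *)
move=> a0; have -> : fejer a = fun z => if z == 0 then a else
    2 * (1 - cos (2 * pi * z * a)) * (a * (2 * pi * z) ^+ 2) `^ (-1).
  apply/funext => z; rewrite /fejer; case: ifPn => // _.
  by rewrite powR_inv1// mulr_ge0 ?sqr_ge0// ltW.
apply: measurable_fun_ifT => //; first by apply: measurable_fun_eqr.
apply: measurable_funM.
  apply: measurable_funM => //; apply: measurable_funB => //.
  apply: (@measurableT_comp _ _ _ _ _ _ (@cos R)).
    by apply: continuous_measurable_fun; exact: continuous_cos.
  by apply: measurable_funM => //; exact: measurable_funM.
apply: (@measurableT_comp _ _ _ _ _ _ (@powR R ^~ (-1))); first exact: measurable_powR.
apply: measurable_funM => //; apply: measurable_funX; exact: measurable_funM.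
Qed.

Lemma fejer_integral a z : 0 < a ->
  ((fejer a z)%:E = \int[mu]_x (tri a x * cos (0 + 2 * pi * z * x))%:E)%E.
Proof. by move=> a0; rewrite integral_tri_cos// cos0 mul1r. Qed.

Lemma fejer_le a z : 0 < a -> fejer a z <= a.
Proof.
move=> a0; rewrite -lee_fin fejer_integral// -[leRHS]integral_tri//.
apply: le_integral => //; [exact: integrable_tri_cos|exact: integrable_tri|].
by move=> x _; rewrite lee_fin -[leRHS]mulr1 ler_wpM2l ?tri_ge0 ?cos_le1.
Qed.

(** Adds the bound [a], good near 0, to the quadratic decay coming from [1 - cos <= 2]. The majorant
    is a multiple of a Cauchy density whose integral, [2 * pi], does not depend on [a]. *)
Lemma fejer_decay a z : 0 < a -> fejer a z <= 2 * a / (1 + (a * z) ^+ 2).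
Proof.
move=> a0; have D0 : 0 < 1 + (a * z) ^+ 2 by rewrite ltr_pwDl// sqr_ge0.
rewrite ler_pdivlMr// mulrDr mulr1 mulr_natl mulr2n lerD ?fejer_le//.
rewrite /fejer; case: ifPn => [/eqP->|z0]; first by rewrite mulr0 expr0n mulr0 ltW.
have pi1 : 1 <= pi :> R by have := @pi_ge2 R; lra.
have p0 : pi != 0 :> R by rewrite gt_eqF// pi_gt0.
move: pi1 p0; move: (pi : R) => p pi1 p0.
have -> : 2 * (1 - cos (2 * p * z * a)) / (a * (2 * p * z) ^+ 2) * (a * z) ^+ 2 =
    a * ((1 - cos (2 * p * z * a)) / (2 * p ^+ 2)).
  by field; rewrite p0 z0 gt_eqF.
rewrite -[leRHS]mulr1 ler_wpM2l ?(ltW a0)// ler_pdivrMr ?mul1r; last first.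
  by rewrite mulr_gt0// exprn_gt0// (lt_le_trans _ pi1).
have := cos_geN1 (2 * p * z * a); have : 1 <= p ^+ 2 by rewrite exprn_ege1.
lra.
Qed.

(** Under this condition the phase stays in [-1, 1] on the support of the triangle, so the cosine
    under the integral is at least [cos 1], which is positive. *)
Lemma fejer_lower a z : 0 < a -> 2 * pi * `|z| * a <= 1 -> a * cos 1 <= fejer a z.
Proof.
move=> a0 za; rewrite -lee_fin fejer_integral//.
have -> : (a * cos 1)%:E = (\int[mu]_x ((cos 1)%:E * (tri a x)%:E))%E.
  by rewrite integralZl// ?integral_tri// -?EFinM 1?mulrC//; exact: integrable_tri.
apply: le_integral => //; [|exact: integrable_tri_cos|].
  by apply: integrableZl => //; exact: integrable_tri.
move=> x _; rewrite -EFinM lee_fin mulrC.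
have [xa|xa] := leP a `|x|.
  rewrite /tri max_l ?mul0r// subr_le0 ler_pdivlMr// mul1r//.
apply: ler_wpM2l; first exact: tri_ge0.
rewrite add0r -(cos_norm (2 * pi * z * x)).
have p0 := @pi_gt0 R.
have h : `|2 * pi * z * x| <= 1.
  rewrite !normrM gtr0_norm// (gtr0_norm p0); apply: le_trans za.
  by apply: ler_wpM2l; [rewrite !mulr_ge0// ltW|exact: ltW].
have := @ltr_cos R; have := @pi_ge2 R => p2.
move=> lc; rewrite leNgt; apply/negP.
have in1 : (1 : R) \in `[0, pi] by rewrite in_itv/= ler01/=; lra.
have in2 : `|2 * pi * z * x| \in `[0, pi].
  by rewrite in_itv/= normr_ge0/= (le_trans h)//; lra.
by rewrite (lc _ _ in1 in2) ltNge h.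
Qed.

(** Uniformity in [a] is the point, since [a] tends to infinity in the proof of Bessel's inequality.
    The exact value is 1; the arctangent integral of the majorant of [fejer_decay] gives
    [2 * pi]. *)
Lemma integral_fejer a z : 0 < a ->
  (\int[mu]_y (fejer a (z - y))%:E <= (2 * pi)%:E)%E.
Proof.
move=> a0.
have mo : measurable_fun setT (fun y : R => (oneDsqr y)^-1).
  by apply: continuous_measurable_fun; exact: continuous_oneDsqrV.
have -> : ((2 * pi)%:E = \int[mu]_y ((2 * a)%:E * ((oneDsqr (a * y + - (a * z)))^-1)%:E))%E.
  rewrite (@ge0_integralZl_EFin _ _ _ _ _ measurableT)//=; last 2 first.
  - apply/measurable_EFinP; apply: (measurableT_comp mo).
    by apply: measurable_funB => //; exact: measurable_funM.
  - by rewrite mulr_ge0// ltW.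
  rewrite (@ge0_integral_affine R a (- (a * z)) a0 (fun y => ((oneDsqr y)^-1)%:E)); last 2 first.
  - exact/measurable_EFinP.
  - by move=> y; rewrite lee_fin invr_ge0.
  rewrite (@ge0_symfun_integralT R (fun y => (oneDsqr y)^-1)).
  - rewrite -set_itvcy integral0y_oneDsqr -!EFinM; congr EFin; field; by rewrite gt_eqF.
  - by move=> y; rewrite invr_ge0.
  - exact: continuous_oneDsqrV.
  - by move=> y; rewrite /= /oneDsqr sqrrN.
apply: ge0_le_integral => //.
- by move=> y _; rewrite lee_fin fejer_ge0.
- apply/measurable_EFinP; apply: (measurableT_comp (measurable_fejer a0)).
  by apply: measurable_funB.
- apply/measurable_EFinP; apply: measurable_funM => //; apply: (measurableT_comp mo).
  by apply: measurable_funB => //; exact: measurable_funM.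
- move=> y _; rewrite -EFinM lee_fin; apply: (le_trans (fejer_decay _ a0)).
  by rewrite /oneDsqr -mulrBr -(sqrrN (a * _)) -mulrN opprB.
Qed.

End triangle.

(** * Products of sigma-finite measures *)

Section product_measure_facts.
Context d1 d2 (T1 : measurableType d1) (T2 : measurableType d2) {R : realType}.
Variable m1 : {sigma_finite_measure set T1 -> \bar R}.
Variable m2 : {sigma_finite_measure set T2 -> \bar R}.
Local Open Scope ereal_scope.

(* An alias, as the library only has a finite measure instance on [m1 \x m2]. *)
Definition sfprod : set (T1 * T2) -> \bar R := m1 \x m2.

HB.instance Definition _ := Measure.on sfprod.

Let prod_sigma_finite : sigma_finite setT sfprod.
Proof.
have /sigma_finiteP[F [TF ndF Foo]] := sigma_finiteT m1.
have /sigma_finiteP[G [TG ndG Goo]] := sigma_finiteT m2.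
exists (fun k => F k `*` G k).
  rewrite -setXTT TF TG predeqE => -[x y]; split.
    move=> [/= [n _ Fnx] [k _ Gky]]; exists (maxn n k) => //; split.
    - by move: x Fnx; exact/subsetPset/ndF/leq_maxl.
    - by move: y Gky; exact/subsetPset/ndG/leq_maxr.
  by move=> [n _ []/= ? ?]; split; exists n.
move=> k; have [mFk Fk] := Foo k; have [mGk Gk] := Goo k; split.
  exact: measurableX.
by rewrite /sfprod product_measure1E// lte_mul_pinfty// ge0_fin_numE.
Qed.

HB.instance Definition _ :=
  Measure_isSigmaFinite.Build _ _ _ sfprod prod_sigma_finite.

Lemma integrable_prodM (u : T1 -> R) (v : T2 -> R) :
  m1.-integrable setT (EFin \o u) -> m2.-integrable setT (EFin \o v) ->
  sfprod.-integrable setT (fun p => (u p.1 * v p.2)%:E).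
Proof.
move=> iu iv; have /integrableP[/measurable_EFinP mu _] := iu.
have /integrableP[/measurable_EFinP mv fv] := iv.
apply/integrable12ltyP => /=.
  apply/measurable_EFinP; apply: measurable_funM.
    exact: measurableT_comp.
  exact: measurableT_comp.
under eq_integral.
  move=> x _; under eq_integral do rewrite normrM EFinM.
  rewrite (@ge0_integralZl_EFin _ _ _ _ _ measurableT)//; last first.
    by apply/measurable_EFinP; exact: measurableT_comp.
  over.
rewrite ge0_integralZr//; last 2 first.
- by apply/measurable_EFinP; exact: measurableT_comp.
- exact: integral_ge0.
rewrite lte_mul_pinfty//; first exact: integral_ge0.
have /integrableP[_ fu] := iu.
by rewrite ge0_fin_numE//; exact: integral_ge0.
Qed.

Lemma integral_prodM (u : T1 -> R) (v : T2 -> R) :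
  m1.-integrable setT (EFin \o u) -> m2.-integrable setT (EFin \o v) ->
  \int[sfprod]_p (u p.1 * v p.2)%:E = \int[m1]_x (u x)%:E * \int[m2]_y (v y)%:E.
Proof.
move=> iu iv; rewrite -(integral12_prod_meas1 (integrable_prodM iu iv))/=.
have fv := integrable_fin_num measurableT iv.
have e (x : T1) : \int[m2]_y (u x * v y)%:E = (u x)%:E * \int[m2]_y (v y)%:E.
  by under eq_integral do rewrite EFinM; rewrite integralZl.
rewrite /fubini_F/=; under eq_integral do rewrite e -(fineK fv) muleC.
by rewrite integralZl// fineK// muleC.
Qed.

(** Tonelli for the positive and the negative part. It yields the measurability of transforms, which
    are integrals in the first variable. *)
Lemma measurable_integral_fst (f : T1 * T2 -> \bar R) : measurable_fun setT f ->
  measurable_fun setT (fun y => \int[m1]_x f (x, y)).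
Proof.
move=> mf; rewrite (_ : (fun y => _) = (fun y => \int[m1]_x f^\+ (x, y)) \-
    (fun y => \int[m1]_x f^\- (x, y))); last first.
  by apply/funext => y; rewrite [LHS]integralE/=; congr (_ - _);
    apply: eq_integral => x _; rewrite ?funeposE ?funenegE.
by apply: emeasurable_funB; apply: measurable_fun_fubini_tonelli_G => //;
  (exact: measurable_funepos || exact: measurable_funeneg).
Qed.

End product_measure_facts.

(** * Product functions on R^d *)

Section tensor.
Context {R : realType}.
Local Notation T d := (d.-tuple R).
Local Notation lam := (@lebesgue_measure R).
Local Notation leb d :=
  (lebesgue_tuple d : {sigma_finite_measure set (T d) -> \bar R}).

Lemma measurable_prod d1 (S : measurableType d1) (I : Type) (s : seq I)
    (f : I -> S -> R) : (forall i, measurable_fun setT (f i)) ->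
  measurable_fun setT (fun x => \prod_(i <- s) f i x).
Proof.
move=> mf; elim: s => [|i s IH].
  by under eq_fun do rewrite big_nil; exact: measurable_cst.
under eq_fun do rewrite big_cons; exact: measurable_funM.
Qed.

Definition tprod d (f : 'I_d -> R -> R) (x : T d) : R := \prod_(i < d) f i (tnth x i).

Lemma measurable_tprod d (f : 'I_d -> R -> R) :
  (forall i, measurable_fun setT (f i)) -> measurable_fun setT (tprod f).
Proof.
move=> mf; apply: measurable_prod => i; apply: measurableT_comp => //.
exact: (@measurable_tnth _ (measurableTypeR R)).
Qed.

Lemma tprod_tcons d (f : 'I_d.+1 -> R -> R) x (y : T d) :
  tprod f (tcons (x, y)) = f ord0 x * tprod (fun i => f (lift ord0 i)) y.
Proof.
rewrite /tprod big_ord_recl /tcons/= tnth0; congr (_ * _).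
by apply: eq_bigr => i _; rewrite tnthS.
Qed.

Lemma tprod_ge0 d (f : 'I_d -> R -> R) x : (forall i y, 0 <= f i y) -> 0 <= tprod f x.
Proof. by move=> f0; apply: prodr_ge0. Qed.

Lemma ge0_integral_tprod d (f : 'I_d -> R -> R) :
  (forall i, measurable_fun setT (f i)) -> (forall i x, 0 <= f i x) ->
  (\int[leb d]_x (tprod f x)%:E = \prod_(i < d) \int[lam]_x (f i x)%:E)%E.
Proof.
elim: d f => [|d IH] f mf f0.
  by rewrite ge0_integral_tuple0 big_ord0 /tprod big_ord0.
rewrite ge0_integral_tcons//; last 2 first.
- by apply/measurable_EFinP; exact: measurable_tprod.
- by move=> x; rewrite lee_fin tprod_ge0.
rewrite big_ord_recl -IH//.
have mt : measurable_fun setT (tprod (fun i : 'I_d => f (lift ord0 i))).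
  exact: measurable_tprod.
under eq_integral.
  move=> x _; under eq_integral do rewrite tprod_tcons EFinM.
  rewrite (@ge0_integralZl_EFin _ _ _ _ _ measurableT)//; last 2 first.
  - by move=> y _; rewrite lee_fin tprod_ge0.
  - by apply/measurable_EFinP; exact: measurable_tprod.
  over.
rewrite ge0_integralZr//.
- by apply/measurable_EFinP; exact: mf.
- by move=> x _; rewrite lee_fin.
- by apply: integral_ge0 => y _; rewrite lee_fin tprod_ge0.
Qed.

(** The weight [H] of the overview, supported in a cube, and on the next line its transform, the
    kernel [K]. *)
Definition ttri d (a : R) : T d -> R := tprod (fun _ => tri a).
Definition tfejer d (a : R) : T d -> R := tprod (fun _ => fejer a).
Definition tsub d (x y : T d) : T d := [tuple tnth x i - tnth y i | i < d].

Lemma dotp_tsub d (x y z : T d) : dotp (tsub x y) z = dotp x z - dotp y z.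
Proof.
by rewrite /dotp -sumrB; apply: eq_bigr => i _; rewrite tnth_mktuple mulrBl.
Qed.

Lemma dotp_tcons d x0 y0 (x y : T d) :
  dotp (tcons (x0, x)) (tcons (y0, y)) = x0 * y0 + dotp x y.
Proof.
rewrite /dotp big_ord_recl /tcons/= !tnth0; congr (_ + _).
by apply: eq_bigr => i _; rewrite !tnthS.
Qed.

Lemma measurable_dotp d1 (S : measurableType d1) d (f g : S -> T d) :
  measurable_fun setT f -> measurable_fun setT g ->
  measurable_fun setT (fun x => dotp (f x) (g x)).
Proof.
move=> mf mg; apply: measurable_sum => i; apply: measurable_funM.
  exact: (measurableT_comp (@measurable_tnth _ (measurableTypeR R) d _) mf).
exact: (measurableT_comp (@measurable_tnth _ (measurableTypeR R) d _) mg).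
Qed.

Lemma measurable_tsub d1 (S : measurableType d1) d (f g : S -> T d) :
  measurable_fun setT f -> measurable_fun setT g ->
  measurable_fun setT (fun x => tsub (f x) (g x)).
Proof.
move=> mf mg; apply/measurable_fun_tnthP => i.
rewrite [X in measurable_fun _ X](_ : _ = (fun x => tnth (f x) i - tnth (g x) i)); last first.
  by apply/funext => x /=; rewrite tnth_mktuple.
apply: measurable_funB.
  exact: (measurableT_comp (@measurable_tnth _ (measurableTypeR R) d _) mf).
exact: (measurableT_comp (@measurable_tnth _ (measurableTypeR R) d _) mg).
Qed.

Lemma measurable_cosR d1 (S : measurableType d1) (f : S -> R) :
  measurable_fun setT f -> measurable_fun setT (fun x => cos (f x)).
Proof.
move=> mf; apply: (measurableT_comp _ mf).
by apply: continuous_measurable_fun; exact: continuous_cos.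
Qed.

Lemma measurable_sinR d1 (S : measurableType d1) (f : S -> R) :
  measurable_fun setT f -> measurable_fun setT (fun x => sin (f x)).
Proof.
move=> mf; apply: (measurableT_comp _ mf).
by apply: continuous_measurable_fun; exact: continuous_sin.
Qed.

Section ttri.
Variables (a : R).
Hypothesis a0 : 0 < a.

Lemma measurable_ttri d : measurable_fun setT (@ttri d a).
Proof. by apply: measurable_tprod => i; exact: measurable_tri. Qed.

Lemma ttri_ge0 d (x : T d) : 0 <= ttri a x.
Proof. by apply: tprod_ge0 => i y; exact: tri_ge0. Qed.

Lemma ttri_le1 d (x : T d) : ttri a x <= 1.
Proof. by apply: prodr_ile1 => i _; rewrite tri_ge0 tri_le1. Qed.

Lemma integrable_ttri d : (leb d).-integrable setT (EFin \o @ttri d a).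
Proof.
apply/integrableP; split; first by apply/measurable_EFinP; exact: measurable_ttri.
under eq_integral => x _ do rewrite /= ger0_norm ?ttri_ge0//.
rewrite ge0_integral_tprod//; last 2 first.
- by move=> i; exact: measurable_tri.
- by move=> i x; exact: tri_ge0.
under eq_bigr do rewrite integral_tri//.
by rewrite prodEFin ltry.
Qed.

Lemma measurable_tfejer d : measurable_fun setT (@tfejer d a).
Proof. by apply: measurable_tprod => i; exact: measurable_fejer. Qed.

Lemma tfejer_ge0 d (x : T d) : 0 <= tfejer a x.
Proof. by apply: tprod_ge0 => i y; exact: fejer_ge0. Qed.

Lemma tfejer_lower d (x : T d) : (forall i, 2 * pi * `|tnth x i| * a <= 1) ->
  (a * cos 1) ^+ d <= tfejer a x.
Proof.
move=> hx; rewrite -[X in _ ^+ X]card_ord -prodr_const; apply: ler_prod => i _.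
by rewrite fejer_lower// mulr_ge0// ltW// cos1_gt0.
Qed.

Lemma integral_tfejer d (x : T d) :
  (\int[leb d]_y (tfejer a (tsub x y))%:E <= ((2 * pi) ^+ d)%:E)%E.
Proof.
have e (y : T d) : tfejer a (tsub x y) = tprod (fun i t => fejer a (tnth x i - t)) y.
  by apply: eq_bigr => i _; rewrite tnth_mktuple.
under eq_integral do rewrite e.
rewrite ge0_integral_tprod//; last 2 first.
- move=> i; apply: measurableT_comp; first exact: measurable_fejer.
  exact: measurable_funB.
- by move=> i y; exact: fejer_ge0.
have -> : ((2 * pi) ^+ d)%:E = (\prod_(i < d) (2 * pi : R)%:E)%E.
  by rewrite prodEFin prodr_const card_ord.
have f0 i : (0 <= \int[lam]_y (fejer a (tnth x i - y))%:E)%E.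
  by apply: integral_ge0 => y _; rewrite lee_fin fejer_ge0.
have : (0 <= \prod_(i < d) \int[lam]_y (fejer a (tnth x i - y))%:E <=
    \prod_(i < d) (2 * pi : R)%:E)%E.
  elim/big_ind2 : _ => [|u v u' v' /andP[u0 uv] /andP[u'0 uv']|i _].
  - by rewrite lee01 lexx.
  - by rewrite mule_ge0//= lee_pmul.
  - by rewrite f0 integral_fejer.
by move=> /andP[].
Qed.

Lemma integrable_ttri_bounded d (f : T d -> R) : measurable_fun setT f ->
  (forall x, `|f x| <= 1) -> (leb d).-integrable setT (fun x => (ttri a x * f x)%:E).
Proof.
move=> mf f1; apply: (le_integrable measurableT _ _ (integrable_ttri d)).
  by apply/measurable_EFinP; apply: measurable_funM => //; exact: measurable_ttri.
move=> x _; rewrite /= lee_fin normrM ler_piMr//.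
Qed.

(** Induction on the dimension: in the inner integral, the contribution of the first coordinate is
    absorbed into the phase, so the cosine of the sum is never expanded. *)
Lemma integral_ttri_cos d th (z : T d) :
  (\int[leb d]_x (ttri a x * cos (th + 2 * pi * dotp z x))%:E =
   (cos th * tfejer a z)%:E)%E.
Proof.
elim: d th z => [|d IH] th z.
  by rewrite ge0_integral_tuple0 /ttri /tfejer /tprod /dotp !big_ord0 mulr0 addr0 mul1r mulr1.
have mc d' th' (z' : T d') : measurable_fun setT (fun x => cos (th' + 2 * pi * dotp z' x)).
  apply: measurable_cosR; apply: measurable_funD => //; apply: measurable_funM => //.
  by apply: measurable_dotp.
rewrite integral_tcons; last first.
  by apply: integrable_ttri_bounded => // x; exact: cos_max.
rewrite (tcons_surj z); set z0 := thead z; set z' := [tuple of _].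
rewrite /tfejer tprod_tcons -/(tfejer a z').
transitivity (\int[lam]_x ((tfejer a z')%:E * (tri a x * cos (th + 2 * pi * z0 * x))%:E))%E.
  apply: eq_integral => x _.
  transitivity (\int[leb d]_y ((tri a x)%:E *
      (ttri a y * cos ((th + 2 * pi * z0 * x) + 2 * pi * dotp z' y))%:E))%E.
    apply: eq_integral => y _; rewrite dotp_tcons /ttri tprod_tcons -EFinM -mulrA.
    by congr (_ * (_ * cos _))%:E; ring.
  rewrite integralZl//; last first.
    by apply: (integrable_ttri_bounded (mc d _ _)) => y; exact: cos_max.
  by rewrite IH -!EFinM; congr EFin; ring.
rewrite integralZl//; last exact: integrable_tri_cos.
by rewrite integral_tri_cos// -EFinM; congr EFin; ring.
Qed.

End ttri.

End tensor.

(** * Pairing formula and Bessel's inequality *)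

Section real_transforms.
Context {R : realType} {d : nat}.
Local Notation T := (d.-tuple R).
Local Notation mu :=
  (lebesgue_tuple d : {sigma_finite_measure set T -> \bar R}).
Implicit Types g w : T -> R.

(** For real [g] the transform is [fcos g - i fsin g]; these real integrals keep complex values out
    of the pairing formula. *)
Definition fcos g (xi : T) : R := \int[mu]_x (g x * cos (2 * pi * dotp x xi)).
Definition fsin g (xi : T) : R := \int[mu]_x (g x * sin (2 * pi * dotp x xi)).
(** The real part of the transform of [g] times the conjugate of that of [w]; [fdot g g] is a
    squared modulus. *)
Definition fdot g w xi := fcos g xi * fcos w xi + fsin g xi * fsin w xi.

Lemma measurable_phase : measurable_fun setT (fun p : T * T => 2 * pi * dotp p.1 p.2).
Proof. by apply: measurable_funM => //; exact: measurable_dotp. Qed.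

Lemma measurable_fcos g : measurable_fun setT g -> measurable_fun setT (fcos g).
Proof.
move=> mg; apply: (measurableT_comp (@fine_measurable _ _ measurableT)).
apply: (measurable_integral_fst mu (f := fun p : T * T =>
  (g p.1 * cos (2 * pi * dotp p.1 p.2))%:E)).
apply/measurable_EFinP; apply: measurable_funM; first exact: measurableT_comp.
by apply: measurable_cosR; exact: measurable_phase.
Qed.

Lemma measurable_fsin g : measurable_fun setT g -> measurable_fun setT (fsin g).
Proof.
move=> mg; apply: (measurableT_comp (@fine_measurable _ _ measurableT)).
apply: (measurable_integral_fst mu (f := fun p : T * T =>
  (g p.1 * sin (2 * pi * dotp p.1 p.2))%:E)).
apply/measurable_EFinP; apply: measurable_funM; first exact: measurableT_comp.
by apply: measurable_sinR; exact: measurable_phase.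
Qed.

Lemma measurable_fdot g w : measurable_fun setT g -> measurable_fun setT w ->
  measurable_fun setT (fdot g w).
Proof.
move=> mg mw; apply: measurable_funD; apply: measurable_funM;
  (exact: measurable_fcos || exact: measurable_fsin).
Qed.

Lemma measurable_phase1 (xi : T) : measurable_fun setT (fun x : T => 2 * pi * dotp x xi).
Proof. by apply: measurable_funM => //; exact: measurable_dotp. Qed.

Lemma sin_max (x : R) : `|sin x| <= 1.
Proof. by rewrite -cosBpihalf cos_max. Qed.

Lemma integrableM_bounded g (h : T -> R) : mu.-integrable setT (EFin \o g) ->
  measurable_fun setT h -> (forall x, `|h x| <= 1) ->
  mu.-integrable setT (fun x => (g x * h x)%:E).
Proof.
move=> ig mh h1; have /integrableP[/measurable_EFinP mg _] := ig.
apply: (le_integrable measurableT _ _ ig).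
  by apply/measurable_EFinP; exact: measurable_funM.
by move=> x _; rewrite /= lee_fin normrM ler_piMr.
Qed.

Lemma integrable_cos g xi : mu.-integrable setT (EFin \o g) ->
  mu.-integrable setT (fun x => (g x * cos (2 * pi * dotp x xi))%:E).
Proof.
move=> ig; apply: integrableM_bounded => // [|x]; last exact: cos_max.
by apply: measurable_cosR; exact: measurable_phase1.
Qed.

Lemma integrable_sin g xi : mu.-integrable setT (EFin \o g) ->
  mu.-integrable setT (fun x => (g x * sin (2 * pi * dotp x xi))%:E).
Proof.
move=> ig; apply: integrableM_bounded => // [|x]; last exact: sin_max.
by apply: measurable_sinR; exact: measurable_phase1.
Qed.

Lemma EFin_fcos g xi : mu.-integrable setT (EFin \o g) ->
  ((fcos g xi)%:E = \int[mu]_x (g x * cos (2 * pi * dotp x xi))%:E)%E.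
Proof. by move=> ig; rewrite fineK//; apply: integrable_fin_num => //; exact: integrable_cos. Qed.

Lemma EFin_fsin g xi : mu.-integrable setT (EFin \o g) ->
  ((fsin g xi)%:E = \int[mu]_x (g x * sin (2 * pi * dotp x xi))%:E)%E.
Proof. by move=> ig; rewrite fineK//; apply: integrable_fin_num => //; exact: integrable_sin. Qed.

(** The products of integrals are integrals over pairs, and the subtraction formula of the cosine
    merges the two phases. *)
Lemma EFin_fdot g w xi : mu.-integrable setT (EFin \o g) -> mu.-integrable setT (EFin \o w) ->
  ((fdot g w xi)%:E = \int[sfprod mu mu]_p
    (g p.1 * w p.2 * cos (2 * pi * dotp (tsub p.1 p.2) xi))%:E)%E.
Proof.
move=> ig iw; rewrite EFinD !EFinM !EFin_fcos// !EFin_fsin//.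
rewrite -integral_prodM; [|exact: integrable_cos|exact: integrable_cos].
rewrite -integral_prodM; [|exact: integrable_sin|exact: integrable_sin].
rewrite -integralD//.
- apply: eq_integral => p _; rewrite -EFinD dotp_tsub mulrBr cosB.
  by congr EFin; ring.
- by apply: (integrable_prodM (integrable_cos xi ig) (integrable_cos xi iw)).
- by apply: (integrable_prodM (integrable_sin xi ig) (integrable_sin xi iw)).
Qed.

Section pairing.
Variables (a : R) (g w : T -> R).
Hypothesis a0 : 0 < a.
Hypothesis ig : mu.-integrable setT (EFin \o g).
Hypothesis iw : mu.-integrable setT (EFin \o w).

Let mg : measurable_fun setT g.
Proof. by have /integrableP[/measurable_EFinP]:= ig. Qed.
Let mw : measurable_fun setT w.
Proof. by have /integrableP[/measurable_EFinP]:= iw. Qed.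

Let F (q : T * (T * T)) :=
  (ttri a q.1 * (g q.2.1 * w q.2.2 * cos (2 * pi * dotp (tsub q.2.1 q.2.2) q.1)))%:E.

(** Domination by the product of the weight with [g] and [w], which are all integrable; this is what
    permits Fubini's theorem. *)
Let iF : (mu \x sfprod mu mu)%E.-integrable setT F.
Proof.
have := integrable_prodM (m2 := sfprod mu mu) (v := fun p => g p.1 * w p.2)
  (integrable_ttri a0 d) (integrable_prodM ig iw).
move=> i2; apply: (le_integrable measurableT _ _ i2).
  apply/measurable_EFinP; apply: measurable_funM.
    exact: (measurableT_comp (@measurable_ttri R a d) measurable_fst).
  have m21 : measurable_fun setT (fun q : T * (T * T) => q.2.1).
    exact: (measurableT_comp measurable_fst measurable_snd).
  have m22 : measurable_fun setT (fun q : T * (T * T) => q.2.2).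
    exact: (measurableT_comp measurable_snd measurable_snd).
  apply: measurable_funM.
    apply: measurable_funM.
      exact: (measurableT_comp mg m21).
    exact: (measurableT_comp mw m22).
  apply: measurable_cosR; apply: measurable_funM => //.
  by apply: measurable_dotp; [exact: measurable_tsub|exact: measurable_fst].
move=> q _; rewrite /F/= lee_fin !normrM !mulrA ler_piMr// ?cos_max//.
Qed.

Lemma integrable_ttri_fdot : mu.-integrable setT (fun xi => (ttri a xi * fdot g w xi)%:E).
Proof.
have := integrable_fubini_F iF; apply: eq_integrable => // xi _.
rewrite /fubini_F/= EFinM EFin_fdot// -integralZl//; last first.
  apply: (le_integrable measurableT _ _ (integrable_prodM ig iw)).
    apply/measurable_EFinP; apply: measurable_funM.
      by apply: measurable_funM; exact: measurableT_comp.
    apply: measurable_cosR; apply: measurable_funM => //.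
    by apply: measurable_dotp => //; exact: measurable_tsub.
  by move=> p _; rewrite /= lee_fin normrM ler_piMr ?cos_max.
Qed.

(* The multiplication formula, with the positive kernel [tfejer] in place of a
   delta function: this takes the role of Plancherel's identity. *)
Lemma integral_ttri_fdot :
  (\int[mu]_xi (ttri a xi * fdot g w xi)%:E =
   \int[sfprod mu mu]_p (g p.1 * w p.2 * tfejer a (tsub p.1 p.2))%:E)%E.
Proof.
transitivity (\int[mu]_xi \int[sfprod mu mu]_p F (xi, p))%E.
  apply: eq_integral => xi _; rewrite EFinM EFin_fdot// -integralZl//.
  apply: (le_integrable measurableT _ _ (integrable_prodM ig iw)).
    apply/measurable_EFinP; apply: measurable_funM.
      by apply: measurable_funM; exact: measurableT_comp.
    apply: measurable_cosR; apply: measurable_funM => //.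
    by apply: measurable_dotp => //; exact: measurable_tsub.
  by move=> p _; rewrite /= lee_fin normrM ler_piMr ?cos_max.
rewrite Fubini//; apply: eq_integral => p _.
transitivity (\int[mu]_xi ((g p.1 * w p.2)%:E *
    (ttri a xi * cos (0 + 2 * pi * dotp (tsub p.1 p.2) xi))%:E))%E.
  by apply: eq_integral => xi _; rewrite /F/= add0r -EFinM; congr EFin; ring.
rewrite integralZl//; last first.
  apply: integrable_ttri_bounded => // [|x]; last exact: cos_max.
  apply: measurable_cosR; apply: measurable_funD => //; apply: measurable_funM => //.
  by apply: measurable_dotp.
by rewrite integral_ttri_cos// cos0 mul1r -EFinM.
Qed.

End pairing.
End real_transforms.

Section bessel.
Context {R : realType} {d : nat}.
Local Notation T := (d.-tuple R).
Local Notation mu :=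
  (lebesgue_tuple d : {sigma_finite_measure set T -> \bar R}).
Implicit Types g w : T -> R.

Definition sqint g : \bar R := (\int[mu]_x (g x ^+ 2)%:E)%E.

Lemma sqint_ge0 g : (0 <= sqint g)%E.
Proof. by apply: integral_ge0 => x _; rewrite lee_fin sqr_ge0. Qed.

Lemma fdot_ge0 g xi : 0 <= fdot g g xi.
Proof. by rewrite addr_ge0// -expr2 sqr_ge0. Qed.

Lemma fejerN a z : fejer a (- z) = fejer a z :> R.
Proof. by rewrite /fejer oppr_eq0 mulrN sqrrN mulNr cosN. Qed.

Lemma tfejer_tsubC a (x y : T) : tfejer a (tsub x y) = tfejer a (tsub y x).
Proof. by apply: eq_bigr => i _; rewrite !tnth_mktuple -fejerN opprB. Qed.

Lemma measurable_tfejer_tsub a : 0 < a ->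
  measurable_fun setT (fun p : T * T => tfejer a (tsub p.1 p.2)).
Proof.
move=> a0; have mt : measurable_fun setT (fun p : T * T => tsub p.1 p.2).
  exact: measurable_tsub.
exact: (measurableT_comp (@measurable_tfejer R a a0 d) mt).
Qed.

(* Schur's test for the kernel [tfejer a (tsub x y)]. *)
Lemma schur_tfejer a g : 0 < a -> measurable_fun setT g ->
  (\int[sfprod mu mu]_p (`|g p.1 * g p.2| * tfejer a (tsub p.1 p.2))%:E <=
   ((2 * pi) ^+ d)%:E * sqint g)%E.
Proof.
move=> a0 mg; have mK := measurable_tfejer_tsub a0.
have mg1 : measurable_fun setT (fun p : T * T => g p.1) by exact: measurableT_comp.
have mg2 : measurable_fun setT (fun p : T * T => g p.2) by exact: measurableT_comp.
have mq (h : T * T -> R) : measurable_fun setT h ->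
    measurable_fun setT (fun p => (2^-1 * h p ^+ 2 * tfejer a (tsub p.1 p.2))%:E).
  move=> mh; apply/measurable_EFinP; apply: measurable_funM => //.
  by apply: measurable_funM => //; exact: measurable_funX.
have q0 (h : T * T -> R) p : (0 <= (2^-1 * h p ^+ 2 * tfejer a (tsub p.1 p.2))%:E)%E.
  rewrite lee_fin; apply: mulr_ge0; last exact: tfejer_ge0.
  by apply: mulr_ge0 => //; exact: sqr_ge0.
have half (x : T) : (\int[mu]_y (2^-1 * g x ^+ 2 * tfejer a (tsub x y))%:E <=
    ((2 * pi) ^+ d)%:E * (2^-1 * g x ^+ 2)%:E)%E.
  under eq_integral do rewrite EFinM.
  rewrite (@ge0_integralZl_EFin _ _ _ _ _ measurableT)//; last 3 first.
  - by move=> y _; rewrite lee_fin tfejer_ge0.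
  - apply/measurable_EFinP; have mt : measurable_fun setT (fun y : T => tsub x y).
      exact: measurable_tsub.
    exact: (measurableT_comp (@measurable_tfejer R a a0 d) mt).
  - by rewrite mulr_ge0// sqr_ge0.
  rewrite muleC lee_wpmul2r//; last exact: integral_tfejer.
  by rewrite lee_fin mulr_ge0// sqr_ge0.
have mgh : measurable_fun setT (fun x => (2^-1 * g x ^+ 2)%:E).
  by apply/measurable_EFinP; apply: measurable_funM => //; exact: measurable_funX.
have half_int : (\int[mu]_x (((2 * pi) ^+ d)%:E * (2^-1 * g x ^+ 2)%:E) =
    ((2 * pi) ^+ d)%:E * (2^-1%:E * sqint g))%E.
  have gh0 x : (0 <= (2^-1 * g x ^+ 2)%:E)%E by rewrite lee_fin mulr_ge0// sqr_ge0.
  rewrite (@ge0_integralZl_EFin _ _ _ _ _ measurableT)//; last first.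
    by rewrite exprn_ge0// mulr_ge0// pi_ge0.
  under eq_integral do rewrite EFinM.
  rewrite (@ge0_integralZl_EFin _ _ _ _ _ measurableT)//.
  - by move=> x _; rewrite lee_fin sqr_ge0.
  - by apply/measurable_EFinP; exact: measurable_funX.
(* [|g x * g y| <= (g x ^+ 2 + g y ^+ 2) / 2]. In each half the kernel is integrated first in the
   variable that the square does not contain, which [half] bounds; the kernel is even, so [half]
   serves for both. *)
apply: (@le_trans _ _ (\int[sfprod mu mu]_p
    ((2^-1 * g p.1 ^+ 2 * tfejer a (tsub p.1 p.2))%:E +
     (2^-1 * g p.2 ^+ 2 * tfejer a (tsub p.1 p.2))%:E))%E).
  apply: ge0_le_integral => //.
  - by move=> p _; rewrite lee_fin mulr_ge0// tfejer_ge0.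
  - apply/measurable_EFinP; apply: measurable_funM => //.
    by apply: measurableT_comp => //; exact: measurable_funM.
  - by apply: emeasurable_funD; [exact: (mq _ mg1)|exact: (mq _ mg2)].
  - move=> p _; rewrite -EFinD lee_fin -mulrDl ler_wpM2r ?tfejer_ge0// normrM.
    rewrite -(real_normK (num_real (g p.1))) -(real_normK (num_real (g p.2))).
    have := sqr_ge0 (`|g p.1| - `|g p.2|); lra.
rewrite ge0_integralD//; last 4 first.
- by move=> p _; exact: (q0 (fun p => g p.1)).
- exact: (mq _ mg1).
- by move=> p _; exact: (q0 (fun p => g p.2)).
- exact: (mq _ mg2).
have -> : sqint g = (2^-1%:E * sqint g + 2^-1%:E * sqint g)%E.
  rewrite -ge0_muleDl ?lee_fin// -EFinD (_ : 2^-1 + 2^-1 = 1) ?mul1e//; by field.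
rewrite ge0_muleDr ?mule_ge0 ?sqint_ge0 ?lee_fin// leeD//.
- rewrite /sfprod (fubini_tonelli1 (fun p : T * T =>
    (2^-1 * g p.1 ^+ 2 * tfejer a (tsub p.1 p.2))%:E))//; last 2 first.
    exact: (mq _ mg1).
    exact: (q0 (fun p => g p.1)).
  rewrite -half_int; apply: ge0_le_integral => //.
  + by move=> x _; apply: integral_ge0 => y _; exact: (q0 (fun p => g p.1) (x, y)).
  + apply: measurable_fun_fubini_tonelli_F => //; first exact: (mq _ mg1).
    exact: (q0 (fun p => g p.1)).
  + by apply: measurable_funeM.
  + by move=> x _; exact: half.
- rewrite /sfprod (fubini_tonelli2 (fun p : T * T =>
    (2^-1 * g p.2 ^+ 2 * tfejer a (tsub p.1 p.2))%:E))//; last 2 first.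
    exact: (mq _ mg2).
    exact: (q0 (fun p => g p.2)).
  rewrite -half_int; apply: ge0_le_integral => //.
  + by move=> y _; apply: integral_ge0 => x _; exact: (q0 (fun p => g p.2) (x, y)).
  + apply: measurable_fun_fubini_tonelli_G => //; first exact: (mq _ mg2).
    exact: (q0 (fun p => g p.2)).
  + by apply: measurable_funeM.
  + by move=> y _; rewrite /fubini_G/=; under eq_integral do rewrite tfejer_tsubC; exact: half.
Qed.

Lemma bessel_ttri a g : 0 < a -> mu.-integrable setT (EFin \o g) ->
  (\int[mu]_xi (ttri a xi * fdot g g xi)%:E <= ((2 * pi) ^+ d)%:E * sqint g)%E.
Proof.
move=> a0 ig; have /integrableP[/measurable_EFinP mg _] := ig.
rewrite integral_ttri_fdot//; apply: le_trans (schur_tfejer a0 mg).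
have mF : measurable_fun setT (fun p : T * T => (g p.1 * g p.2 * tfejer a (tsub p.1 p.2))%:E).
  apply/measurable_EFinP; apply: measurable_funM; last exact: measurable_tfejer_tsub.
  by apply: measurable_funM; exact: measurableT_comp.
apply: (le_trans (lee_abs _)); apply: (le_trans (le_abse_integral _ measurableT mF)).
rewrite le_eqVlt; apply/orP; left; apply/eqP; apply: eq_integral => p _ /=.
by rewrite normrM (ger0_norm (tfejer_ge0 _ _)).
Qed.

(** With [a = 2 (n + 1)] every triangle is at least 1/2 on the ball of radius [n + 1], so inserting
    the weight costs [2 ^+ d], whence [4 * pi] instead of [2 * pi]. The bound of [bessel_ttri] is
    uniform in [a], and n tends to infinity by monotone convergence. *)
Lemma bessel g : mu.-integrable setT (EFin \o g) ->
  (\int[mu]_xi (fdot g g xi)%:E <= ((4 * pi) ^+ d)%:E * sqint g)%E.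
Proof.
move=> ig; have /integrableP[/measurable_EFinP mg _] := ig.
have mfd : measurable_fun setT (EFin \o fdot g g).
  by apply/measurable_EFinP; exact: measurable_fdot.
have UE : \bigcup_n (@oball0 R d n.+1%:R) = setT.
  apply/seteqP; split => // x _; exists (Num.truncn (enorm x)) => //.
  by rewrite /oball0/= truncnS_gt.
have cv : (\int[mu]_(xi in oball0 n.+1%:R) (fdot g g xi)%:E @[n --> \oo] -->
    \int[mu]_(xi in \bigcup_n (@oball0 R d n.+1%:R)) (fdot g g xi)%:E)%E.
  apply: ge0_nondecreasing_set_cvg_integral => //.
  - move=> m n mn; apply/subsetPset => x /=; rewrite /oball0/= => /lt_le_trans; apply.
    by rewrite ler_nat.
  - by move=> n; exact: measurable_oball0.
  - by move=> n; exact: measurable_funTS.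
  - by move=> n x _; rewrite lee_fin fdot_ge0.
rewrite -UE -(cvg_lim _ cv)//; apply: lime_le; first by apply: cvgP cv.
apply: nearW => n; have a0 : 0 < 2 * n.+1%:R :> R by rewrite mulr_gt0.
have mtri : measurable_fun setT (fun xi : T => (ttri (2 * n.+1%:R) xi * fdot g g xi)%:E).
  apply/measurable_EFinP; apply: measurable_funM; first exact: measurable_ttri.
  exact: measurable_fdot.
have tri0 xi : (0 <= (ttri (2 * n.+1%:R) xi * fdot g g xi)%:E)%E.
  by rewrite lee_fin mulr_ge0 ?ttri_ge0 ?fdot_ge0.
apply: (@le_trans _ _ ((2 ^+ d)%:E *
    \int[mu]_xi (ttri (2 * n.+1%:R) xi * fdot g g xi)%:E)%E); last first.
  have -> : ((4 * pi) ^+ d = 2 ^+ d * (2 * pi) ^+ d :> R)%R by rewrite -exprMn; congr (_ ^+ _); ring.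
  by rewrite EFinM -muleA lee_pmul2l// ?lte_fin ?exprn_gt0//; exact: bessel_ttri.
rewrite -(@ge0_integralZl_EFin _ _ _ _ _ measurableT)// (integral_mkcond (oball0 _)).
apply: ge0_le_integral => //.
- by move=> x _; apply: erestrict_ge0 => y _; rewrite lee_fin fdot_ge0.
- by apply/(measurable_restrictT _ (measurable_oball0 _)); exact: measurable_funTS.
- exact: measurable_funeM.
move=> xi _; rewrite patchE; case: ifPn => [|_]; last by rewrite mule_ge0.
rewrite inE /oball0/= => xin; rewrite -EFinM lee_fin mulrA -[leLHS]mul1r.
rewrite ler_wpM2r ?fdot_ge0// -ler_pdivrMl ?exprn_gt0// mulr1 -exprVn.
rewrite -[X in _ ^+ X]card_ord -prodr_const; apply: ler_prod => i _.
rewrite invr_ge0 ler0n/= /tri le_max; apply/orP; right.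
have : `|tnth xi i| / (2 * n.+1%:R) <= 2^-1.
  rewrite ler_pdivrMr// mulrA mulVf// mul1r.
  by rewrite (le_trans (normr_tnth_le_enorm xi i))// ltW.
by move: (_ / _) => u hu; lra.
Qed.

(** Twice the product is at most t times one square plus 1/t times the other, pointwise in xi. The
    weight lies in [0, 1] and vanishes off [A], so the term of [g] is localized to [A]; that of [w]
    is left on the whole space, ready for Bessel's inequality. *)
Lemma pairing_le a (t : R) (A : set T) g w : 0 < a -> 0 < t -> measurable A ->
  (forall xi, ~ A xi -> ttri a xi = 0) ->
  mu.-integrable setT (EFin \o g) -> mu.-integrable setT (EFin \o w) ->
  (sqint g < +oo)%E -> (sqint w < +oo)%E ->
  (2%:E * \int[sfprod mu mu]_p (g p.1 * w p.2 * tfejer a (tsub p.1 p.2))%:E <=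
   t%:E * \int[mu]_(xi in A) (fdot g g xi)%:E + (t^-1)%:E * \int[mu]_xi (fdot w w xi)%:E)%E.
Proof.
move=> a0 t0 mA Aa ig iw g2 w2.
have /integrableP[/measurable_EFinP mg _] := ig.
have /integrableP[/measurable_EFinP mw _] := iw.
have ifd h : mu.-integrable setT (EFin \o h) -> (sqint h < +oo)%E ->
    mu.-integrable setT (EFin \o fdot h h).
  move=> ih h2; have /integrableP[/measurable_EFinP mh _] := ih.
  apply/integrableP; split; first by apply/measurable_EFinP; exact: measurable_fdot.
  under eq_integral do rewrite /= ger0_norm ?fdot_ge0//.
  apply: (le_lt_trans (bessel ih)).
  by rewrite lte_mul_pinfty// lee_fin exprn_ge0// mulr_ge0// pi_ge0.
rewrite -integral_ttri_fdot// -integralZl//; last exact: integrable_ttri_fdot.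
rewrite -integralZl//; last by apply: (integrableS measurableT) => //; exact: ifd.
rewrite -integralZl//; last exact: ifd.
rewrite (integral_mkcond A) -integralD//; last 2 first.
- apply/(integrable_mkcond _ mA); apply: integrableZl => //.
  by apply: (integrableS measurableT) => //; exact: ifd.
- by apply: integrableZl => //; exact: ifd.
apply: le_integral => //.
- by apply: integrableZl => //; exact: integrable_ttri_fdot.
- apply: integrableD => //.
    apply/(integrable_mkcond _ mA); apply: integrableZl => //.
    by apply: (integrableS measurableT) => //; exact: ifd.
  by apply: integrableZl => //; exact: ifd.
move=> xi _; rewrite patchE.
have key : 0 <= t * fdot g g xi + t^-1 * fdot w w xi - 2 * fdot g w xi.
  have -> : t * fdot g g xi + t^-1 * fdot w w xi - 2 * fdot g w xi =
      t * ((fcos g xi - t^-1 * fcos w xi) ^+ 2 + (fsin g xi - t^-1 * fsin w xi) ^+ 2).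
    by rewrite /fdot; field; rewrite gt_eqF.
  by apply: mulr_ge0; [exact: ltW|rewrite addr_ge0// sqr_ge0].
have t1 := ttri_le1 a0 xi; have tr0 := ttri_ge0 a xi.
have u0 : 0 <= t * fdot g g xi by rewrite mulr_ge0 ?fdot_ge0// ltW.
have v0 : 0 <= t^-1 * fdot w w xi by rewrite mulr_ge0 ?fdot_ge0// invr_ge0 ltW.
case: ifPn => [_|]; last first.
  by rewrite notin_setE => /Aa ->; rewrite mul0r mule0 add0e -EFinM lee_fin.
rewrite -!EFinM -EFinD lee_fin.
have := mulr_ge0 tr0 key.
have : 0 <= (1 - ttri a xi) * (t * fdot g g xi + t^-1 * fdot w w xi).
  by apply: mulr_ge0; [rewrite subr_ge0|exact: addr_ge0].
lra.
Qed.

End bessel.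

(** * The transform on L^2 *)

Section complex_square_norm.
Context {R : realType} {d : nat}.
Local Notation T := (d.-tuple R).
Local Notation mu :=
  (lebesgue_tuple d : {sigma_finite_measure set T -> \bar R}).
Implicit Types f g : T -> R[i].

(** The square of the L^2 norm, see [cLnorm2E]: the estimates below then involve no roots. *)
Definition nsq f : \bar R := (\int[mu]_x ((cabs (f x)) ^+ 2)%:E)%E.

Lemma cabs_ge0 (z : R[i]) : 0 <= cabs z.
Proof. by case: z => a b; exact: sqrtr_ge0. Qed.

Lemma sqr_cabs (z : R[i]) : cabs z ^+ 2 = complex.Re z ^+ 2 + complex.Im z ^+ 2.
Proof. by case: z => a b; rewrite /cabs/= sqr_sqrtr// addr_ge0// sqr_ge0. Qed.

Lemma ReD (z w : R[i]) : complex.Re (z + w) = complex.Re z + complex.Re w.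
Proof. by case: z; case: w. Qed.

Lemma ImD (z w : R[i]) : complex.Im (z + w) = complex.Im z + complex.Im w.
Proof. by case: z; case: w. Qed.

Lemma ReB (z w : R[i]) : complex.Re (z - w) = complex.Re z - complex.Re w.
Proof. by case: z; case: w. Qed.

Lemma ImB (z w : R[i]) : complex.Im (z - w) = complex.Im z - complex.Im w.
Proof. by case: z; case: w. Qed.

Lemma cabs_real (r : R) : cabs (Complex r 0) = `|r|.
Proof. by rewrite /cabs/= expr0n addr0 sqrtr_sqr. Qed.

Lemma normr_Re (z : R[i]) : `|complex.Re z| <= cabs z.
Proof.
rewrite -(@ler_pXn2r _ 2)// ?nnegrE ?cabs_ge0// real_normK ?num_real// sqr_cabs.
by rewrite lerDl sqr_ge0.
Qed.

Lemma normr_Im (z : R[i]) : `|complex.Im z| <= cabs z.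
Proof.
rewrite -(@ler_pXn2r _ 2)// ?nnegrE ?cabs_ge0// real_normK ?num_real// sqr_cabs.
by rewrite lerDr sqr_ge0.
Qed.

Lemma sqr_cabsD (z w : R[i]) : cabs (z + w) ^+ 2 <= 2 * cabs z ^+ 2 + 2 * cabs w ^+ 2.
Proof.
rewrite !sqr_cabs ReD ImD.
have := sqr_ge0 (complex.Re z - complex.Re w).
have := sqr_ge0 (complex.Im z - complex.Im w); lra.
Qed.

Lemma cabsBC (z w : R[i]) : cabs (z - w) = cabs (w - z).
Proof. by case: z => a b; case: w => u v; rewrite /cabs/=; congr Num.sqrt; ring. Qed.

Lemma measurable_cabs f : cmeasurable f -> measurable_fun setT (fun x => cabs (f x)).
Proof.
move=> [mr mi]; have -> : (fun x => cabs (f x)) =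
    (fun x => (complex.Re (f x) ^+ 2 + complex.Im (f x) ^+ 2) `^ 2^-1).
  apply/funext => x; rewrite powR12_sqrt ?addr_ge0 ?sqr_ge0// -sqr_cabs.
  by rewrite sqrtr_sqr ger0_norm// cabs_ge0.
have ms : measurable_fun setT (fun x => complex.Re (f x) ^+ 2 + complex.Im (f x) ^+ 2).
  by apply: measurable_funD; exact: measurable_funX.
exact: (measurableT_comp (measurable_powR _) ms).
Qed.

Lemma measurable_sqr_cabs f : cmeasurable f ->
  measurable_fun setT (fun x => (cabs (f x) ^+ 2)%:E).
Proof.
by move=> mf; apply/measurable_EFinP; apply: measurable_funX; exact: measurable_cabs.
Qed.

Lemma cmeasurableB f g : cmeasurable f -> cmeasurable g -> cmeasurable (fun x => f x - g x).
Proof.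
move=> [fr fi] [gr gi]; split.
  by under eq_fun do rewrite ReB; exact: measurable_funB.
by under eq_fun do rewrite ImB; exact: measurable_funB.
Qed.

Lemma nsq_ge0 f : (0 <= nsq f)%E.
Proof. by apply: integral_ge0 => x _; rewrite lee_fin sqr_ge0. Qed.

Lemma le_nsq f g : cmeasurable f -> cmeasurable g ->
  (forall x, cabs (f x) <= cabs (g x)) -> (nsq f <= nsq g)%E.
Proof.
move=> mf mg fg; apply: ge0_le_integral => //.
- by move=> x _; rewrite lee_fin sqr_ge0.
- exact: measurable_sqr_cabs.
- exact: measurable_sqr_cabs.
- by move=> x _; rewrite lee_fin ler_pXn2r ?nnegrE ?cabs_ge0.
Qed.

(** A substitute for Minkowski's inequality between squared norms; the factors 2 only enter the
    final constant. *)
Lemma integral_sqr_cabs_triangle (A : set T) f g h : measurable A ->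
  cmeasurable f -> cmeasurable g -> cmeasurable h ->
  (\int[mu]_(x in A) (cabs (f x - h x) ^+ 2)%:E <=
   2%:E * \int[mu]_(x in A) (cabs (f x - g x) ^+ 2)%:E +
   2%:E * \int[mu]_(x in A) (cabs (g x - h x) ^+ 2)%:E)%E.
Proof.
move=> mA mf mg mh.
have m0 u v : cmeasurable u -> cmeasurable v ->
    measurable_fun A (fun x => (cabs (u x - v x) ^+ 2)%:E).
  by move=> mu' mv; apply: measurable_funTS; apply: measurable_sqr_cabs; exact: cmeasurableB.
have e0 (u v : T -> R[i]) x : (0 <= (cabs (u x - v x) ^+ 2)%:E)%E by rewrite lee_fin sqr_ge0.
rewrite -!(@ge0_integralZl_EFin _ _ _ _ _ mA)//; [|exact: m0|exact: m0].
rewrite -ge0_integralD//; last 4 first.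
- by move=> x _; rewrite mule_ge0// lee_fin.
- by apply: measurable_funeM; exact: m0.
- by move=> x _; rewrite mule_ge0// lee_fin.
- by apply: measurable_funeM; exact: m0.
apply: ge0_le_integral => //.
- exact: m0.
- by apply: emeasurable_funD; apply: measurable_funeM; exact: m0.
- move=> x _; rewrite -!EFinM -EFinD lee_fin.
  by rewrite (_ : f x - h x = (f x - g x) + (g x - h x)) ?sqr_cabsD// addrA subrK.
Qed.

Lemma nsq_triangle f g h : cmeasurable f -> cmeasurable g -> cmeasurable h ->
  (nsq (fun x => f x - h x)%R <=
   2%:E * nsq (fun x => f x - g x)%R + 2%:E * nsq (fun x => g x - h x)%R)%E.
Proof. exact: integral_sqr_cabs_triangle. Qed.

Lemma nsqBC f g : nsq (fun x => f x - g x) = nsq (fun x => g x - f x).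
Proof. by apply: eq_integral => x _; rewrite cabsBC. Qed.

Lemma cLnorm2E f : cLnorm 2%:E f = (nsq f `^ 2^-1)%E.
Proof.
rewrite /cLnorm unlock; congr (_ `^ _)%E; apply: eq_integral => x _.
by rewrite abse_EFin poweR_EFin powR_mulrn ?normr_ge0// ger0_norm// cabs_ge0.
Qed.

Lemma cLnorm2_lty f : (cLnorm 2%:E f < +oo)%E = (nsq f < +oo)%E.
Proof.
rewrite cLnorm2E; apply/idP/idP => [|/poweR_lty//].
by apply: lty_poweRy; rewrite invr_eq0.
Qed.

Lemma cLnorm2_le f (e : R) : 0 <= e ->
  (cLnorm 2%:E f <= e%:E)%E = (nsq f <= (e ^+ 2)%:E)%E.
Proof.
move=> e0; rewrite cLnorm2E; have n0 := nsq_ge0 f.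
apply/idP/idP => h.
  have := @gt0_ler_poweR R 2 (ler0n _ _) (nsq f `^ 2^-1)%E e%:E.
  rewrite -poweRrM mulVf// poweRe1// poweR_EFin powR_mulrn//; apply => //.
  - by rewrite in_itv/= poweR_ge0 leey.
  - by rewrite in_itv/= lee_fin e0 leey.
have i2 : 0 <= 2^-1 :> R by [].
have := @gt0_ler_poweR R 2^-1 i2 (nsq f) (e ^+ 2)%:E.
rewrite poweR_EFin -powR_mulrn// -powRrM mulfV// powRr1//; apply => //.
- by rewrite in_itv/= n0 leey.
- by rewrite in_itv/= lee_fin powR_ge0 leey.
- by rewrite powR_mulrn.
Qed.

Lemma cLnorm2_cvg0_near (h : (T -> R[i])^nat) : (fun n => cLnorm 2%:E (h n)) @ \oo --> 0%E ->
  forall e : R, 0 < e -> \forall n \near \oo, (nsq (h n) <= e%:E)%E.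
Proof.
move=> h0 e e0; have s0 : 0 < Num.sqrt e by rewrite sqrtr_gt0.
have s0' := nbhs_open_ereal_lt (f := fun=> Num.sqrt e) s0.
have : \forall n \near \oo, (cLnorm 2%:E (h n) < (Num.sqrt e)%:E)%E by exact: h0 _ s0'.
apply: filterS => n /ltW; rewrite cLnorm2_le ?sqrtr_ge0//.
by rewrite sqr_sqrtr// ltW.
Qed.

Lemma cLnorm2_cvg0 (h : (T -> R[i])^nat) (r : R^nat) : (forall n, 0 <= r n) ->
  r @ \oo --> 0 -> (forall n, (nsq (h n) <= (r n ^+ 2)%:E)%E) ->
  (fun n => cLnorm 2%:E (h n)) @ \oo --> 0%E.
Proof.
move=> r0 rc hr; apply: (@squeeze_cvge _ _ _ _ (cst 0%E) _ (fun n => (r n)%:E)).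
- by apply: nearW => n; rewrite Lnorm_ge0/= cLnorm2_le.
- exact: cvg_cst.
- by apply: cvg_EFin; [exact: nearW|exact: rc].
Qed.

Lemma cLnorm1E f : cLnorm 1%:E f = (\int[mu]_x (cabs (f x))%:E)%E.
Proof.
by rewrite /cLnorm Lnorm1; apply: eq_integral => x _; rewrite abse_EFin ger0_norm// cabs_ge0.
Qed.

Lemma cL1P f : cLp 1%:E f <->
  mu.-integrable setT (EFin \o (fun x => complex.Re (f x))) /\
  mu.-integrable setT (EFin \o (fun x => complex.Im (f x))).
Proof.
split=> [[mf]|[ir ii]].
  rewrite cLnorm1E => fi; have mc := measurable_cabs mf; case: mf => mr mi.
  have ic : mu.-integrable setT (EFin \o (fun x => cabs (f x))).
    apply/integrableP; split; first exact/measurable_EFinP.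
    by under eq_integral do rewrite /= ger0_norm ?cabs_ge0//.
  split; apply: (le_integrable measurableT _ _ ic); do ?exact/measurable_EFinP.
    by move=> x _; rewrite /= lee_fin (ger0_norm (cabs_ge0 _)) normr_Re.
  by move=> x _; rewrite /= lee_fin (ger0_norm (cabs_ge0 _)) normr_Im.
have /integrableP[/measurable_EFinP mr fr] := ir.
have /integrableP[/measurable_EFinP mi fi] := ii.
have mf : cmeasurable f by split.
split=> //; rewrite cLnorm1E.
apply: (@le_lt_trans _ _ (\int[mu]_x (`|(complex.Re (f x))%:E| + `|(complex.Im (f x))%:E|))%E).
  apply: ge0_le_integral => //.
  - by move=> x _; rewrite lee_fin cabs_ge0.
  - by apply/measurable_EFinP; exact: measurable_cabs.
  - by apply: emeasurable_funD; apply: measurableT_comp => //; exact/measurable_EFinP.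
  - move=> x _; rewrite !abse_EFin -EFinD lee_fin.
    rewrite -(@ler_pXn2r _ 2)// ?nnegrE ?cabs_ge0 ?addr_ge0//.
    rewrite sqr_cabs sqrrD !real_normK ?num_real//.
    have : 0 <= `|complex.Re (f x)| * `|complex.Im (f x)| by rewrite mulr_ge0.
    lra.
rewrite ge0_integralD//; last 2 first.
- by apply: measurableT_comp => //; exact/measurable_EFinP.
- by apply: measurableT_comp => //; exact/measurable_EFinP.
by rewrite lte_add_pinfty.
Qed.

Lemma fourier_L1E f xi : cLp 1%:E f ->
  fourier_L1 f xi = Complex
    (fcos (fun x => complex.Re (f x)) xi + fsin (fun x => complex.Im (f x)) xi)
    (fcos (fun x => complex.Im (f x)) xi - fsin (fun x => complex.Re (f x)) xi).
Proof.
move=> /cL1P[ir ii]; rewrite /fourier_L1 /cintegral; congr Complex.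
  rewrite /fcos /fsin -RintegralD//; [|exact: integrable_cos|exact: integrable_sin].
  by apply: eq_Rintegral => x _; rewrite /fourier_kernel; case: (f x) => a b /=; ring.
rewrite /fcos /fsin -RintegralB//; [|exact: integrable_cos|exact: integrable_sin].
by apply: eq_Rintegral => x _; rewrite /fourier_kernel; case: (f x) => a b /=; ring.
Qed.

Lemma cmeasurable_fourier_L1 f : cLp 1%:E f -> cmeasurable (fourier_L1 f).
Proof.
move=> f1; have [[mr mi] _] := f1.
split.
  under eq_fun do rewrite fourier_L1E//=.
  by apply: measurable_funD; [exact: measurable_fcos|exact: measurable_fsin].
under eq_fun do rewrite fourier_L1E//=.
by apply: measurable_funB; [exact: measurable_fcos|exact: measurable_fsin].
Qed.

Lemma cL1B f g : cLp 1%:E f -> cLp 1%:E g -> cLp 1%:E (fun x => f x - g x).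
Proof.
move=> /cL1P[fr fi] /cL1P[gr gi]; apply/cL1P; split.
  have := integrableB measurableT fr gr; apply: eq_integrable => // x _.
  by rewrite /= ReB.
have := integrableB measurableT fi gi; apply: eq_integrable => // x _.
by rewrite /= ImB.
Qed.

Lemma fourier_L1B f g xi : cLp 1%:E f -> cLp 1%:E g ->
  fourier_L1 (fun x => f x - g x) xi = fourier_L1 f xi - fourier_L1 g xi.
Proof.
move=> f1 g1; rewrite !fourier_L1E//; last exact: cL1B.
have /cL1P[fr fi] := f1; have /cL1P[gr gi] := g1.
have cB (u v : T -> R) : mu.-integrable setT (EFin \o u) -> mu.-integrable setT (EFin \o v) ->
    fcos (fun x => u x - v x) xi = fcos u xi - fcos v xi.
  move=> iu iv; rewrite /fcos -RintegralB//; [|exact: integrable_cos|exact: integrable_cos].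
  by apply: eq_Rintegral => x _; rewrite mulrBl.
have sB (u v : T -> R) : mu.-integrable setT (EFin \o u) -> mu.-integrable setT (EFin \o v) ->
    fsin (fun x => u x - v x) xi = fsin u xi - fsin v xi.
  move=> iu iv; rewrite /fsin -RintegralB//; [|exact: integrable_sin|exact: integrable_sin].
  by apply: eq_Rintegral => x _; rewrite mulrBl.
have rE : (fun x => complex.Re (f x - g x)) = (fun x => complex.Re (f x) - complex.Re (g x)).
  by apply/funext => x; rewrite ReB.
have iE : (fun x => complex.Im (f x - g x)) = (fun x => complex.Im (f x) - complex.Im (g x)).
  by apply/funext => x; rewrite ImB.
rewrite rE iE !cB// !sB//; apply/eqP; rewrite eq_complex/=.
by apply/andP; split; apply/eqP; ring.
Qed.

(** The constant of [bessel], doubled to recombine real and imaginary parts. *)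
Definition bessel_cst : R := 2 * (4 * pi) ^+ d.

Lemma bessel_cst_gt0 : 0 < bessel_cst.
Proof. by rewrite mulr_gt0// exprn_gt0// mulr_gt0// pi_gt0. Qed.

Lemma nsq_fourier_L1 f : cLp 1%:E f -> (nsq (fourier_L1 f) <= bessel_cst%:E * nsq f)%E.
Proof.
move=> f1; have [[mr mi] _] := f1; have /cL1P[ir ii] := f1.
set a := (fun x => complex.Re (f x)) in mr ir; set b := (fun x => complex.Im (f x)) in mi ii.
have mfd (u : T -> R) : measurable_fun setT u -> measurable_fun setT (fun xi => (fdot u u xi)%:E).
  by move=> mu'; apply/measurable_EFinP; exact: measurable_fdot.
have fd0 (u : T -> R) xi : (0 <= (fdot u u xi)%:E)%E by rewrite lee_fin fdot_ge0.
apply: (@le_trans _ _ (\int[mu]_xi (2%:E * ((fdot a a xi)%:E + (fdot b b xi)%:E)))%E).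
  apply: ge0_le_integral => //.
  - by move=> x _; rewrite lee_fin sqr_ge0.
  - by apply: measurable_sqr_cabs; exact: cmeasurable_fourier_L1.
  - by apply: measurable_funeM; apply: emeasurable_funD; exact: mfd.
  - move=> xi _; rewrite -EFinD -EFinM lee_fin sqr_cabs fourier_L1E// -/a -/b /fdot/=.
    have := sqr_ge0 (fcos a xi - fsin b xi).
    have := sqr_ge0 (fcos b xi + fsin a xi); lra.
rewrite (@ge0_integralZl_EFin _ _ _ _ _ measurableT)//; last 2 first.
- by move=> xi _; rewrite adde_ge0.
- by apply: emeasurable_funD; exact: mfd.
rewrite ge0_integralD//; [|exact: mfd|exact: mfd].
rewrite /bessel_cst EFinM -muleA lee_pmul2l ?lte_fin//.
apply: (le_trans (leeD (bessel ir) (bessel ii))).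
rewrite -ge0_muleDr ?sqint_ge0//.
rewrite /sqint -ge0_integralD//; last 4 first.
- by move=> x _; rewrite lee_fin sqr_ge0.
- by apply/measurable_EFinP; exact: measurable_funX.
- by move=> x _; rewrite lee_fin sqr_ge0.
- by apply/measurable_EFinP; exact: measurable_funX.
by rewrite /nsq; under [X in (_ <= _ * X)%E]eq_integral do rewrite sqr_cabs EFinD.
Qed.

Lemma nsq_fourier_L1B f g : cLp 1%:E f -> cLp 1%:E g ->
  (nsq (fun xi => fourier_L1 f xi - fourier_L1 g xi)%R <=
   bessel_cst%:E * nsq (fun x => f x - g x)%R)%E.
Proof.
move=> f1 g1; apply: le_trans (nsq_fourier_L1 (cL1B f1 g1)).
rewrite le_eqVlt; apply/orP; left; apply/eqP; apply: eq_integral => xi _.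
by rewrite fourier_L1B.
Qed.

(* The extension of the transform to L^2 is controlled independently of the
   approximating sequence. *)
Lemma is_fourier_L2_dist f F u : cmeasurable f -> is_fourier_L2 f F -> cLp 1%:E u ->
  (nsq (fun xi => F xi - fourier_L1 u xi)%R <=
   (4 * bessel_cst)%:E * nsq (fun x => f x - u x)%R)%E.
Proof.
move=> mf [[mF F2] [v v12 [vf vF]]] u1.
have mu' : cmeasurable u by case: u1.
apply/lee_addgt0Pr => e e0.
(* Chosen so that the two errors, [2 * e1] and [4 * bessel_cst * e2], are each [e / 2]. *)
pose e1 := e / 2 / 2; pose e2 := e / 2 / (4 * bessel_cst).
have e10 : 0 < e1 by rewrite !divr_gt0.
have e20 : 0 < e2 by rewrite !divr_gt0// mulr_gt0// bessel_cst_gt0.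
have [n [h1 h2]] : exists n, (nsq (fun xi => fourier_L1 (v n) xi - F xi)%R <= e1%:E)%E /\
   (nsq (fun x => v n x - f x)%R <= e2%:E)%E.
  have n1 := cLnorm2_cvg0_near vF e10; have n2 := cLnorm2_cvg0_near vf e20.
  have : \forall n \near \oo, (nsq (fun xi => fourier_L1 (v n) xi - F xi)%R <= e1%:E)%E /\
      (nsq (fun x => v n x - f x)%R <= e2%:E)%E.
    by near=> n; split; near: n.
  by move=> [N _ HN]; exists N; exact: (HN N (leqnn N)).
have v1 := (v12 n).1; have mv : cmeasurable (v n) by case: v1.
have mFv := cmeasurable_fourier_L1 v1; have mFu := cmeasurable_fourier_L1 u1.
apply: (le_trans (nsq_triangle mF mFv mFu)).
have B0 := bessel_cst_gt0.
have s1 : (2%:E * nsq (fun x => F x - fourier_L1 (v n) x)%R <= (e / 2)%:E)%E.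
  rewrite nsqBC; apply: (@le_trans _ _ (2%:E * e1%:E)%E); first by rewrite lee_pmul2l ?lte_fin.
  by rewrite -EFinM lee_fin /e1 mulrC divfK.
have s2 : (2%:E * nsq (fun x => fourier_L1 (v n) x - fourier_L1 u x)%R <=
    (4 * bessel_cst)%:E * nsq (fun x => f x - u x)%R + (e / 2)%:E)%E.
  apply: (@le_trans _ _ (2%:E * (bessel_cst%:E *
     (2%:E * nsq (fun x => v n x - f x)%R + 2%:E * nsq (fun x => f x - u x)%R)))%E).
    rewrite lee_pmul2l ?lte_fin//; apply: (le_trans (nsq_fourier_L1B v1 u1)).
    by rewrite lee_pmul2l ?lte_fin//; exact: nsq_triangle.
  rewrite ge0_muleDr ?mule_ge0 ?nsq_ge0// ge0_muleDr ?mule_ge0 ?nsq_ge0// ?lee_fin ?(ltW B0)//.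
  rewrite addeC; apply: leeD.
    rewrite !muleA -!EFinM le_eqVlt; apply/orP; left; apply/eqP.
    by congr (_%:E * _)%E; ring.
  rewrite !muleA -!EFinM.
  apply: (@le_trans _ _ ((2 * bessel_cst * 2)%:E * e2%:E)%E).
    apply: lee_wpmul2l; last exact: h2.
    by rewrite lee_fin; do 2 ?apply: mulr_ge0 => //; exact: ltW.
  rewrite -EFinM lee_fin /e2 le_eqVlt; apply/orP; left; apply/eqP; field.
  exact: lt0r_neq0.
rewrite addeC; apply: (le_trans (leeD s2 s1)).
by rewrite -addeA -EFinD -splitr.
Unshelve. all: by end_near. Qed.

End complex_square_norm.

(** * Completeness of L^2 *)

Section l2_complete.
Context {dT} {T : measurableType dT} {R : realType}.
Variable mu : {measure set T -> \bar R}.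

Lemma limn_einf_le (u : (\bar R)^nat) (c : \bar R) :
  (forall n, u n <= c)%E -> (limn_einf u <= c)%E.
Proof.
move=> uc; rewrite limn_einf_lim (cvg_lim _ (@cvg_einfs_sup _ u))//.
apply: ge_ereal_sup => _ [n _ <-]; apply: le_trans (uc n).
by apply: ereal_inf_lbound; exists n => /=.
Qed.

(** The increments are at most [Num.sqrt M * 2 ^- n], hence absolutely summable. *)
Lemma cvg_of_weighted_increments (v : R^nat) (M : R) :
  (forall n, 4 ^+ n * (v n.+1 - v n) ^+ 2 <= M) -> cvgn v.
Proof.
move=> vM; have M0 : 0 <= M.
  by apply: le_trans (vM 0); rewrite mulr_ge0// sqr_ge0.
have -> : v = fun n => v 0 + series (telescope v) n.
  by apply/funext => n; exact: eq_sum_telescope.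
suff cs : cvgn (series (telescope v)) by apply: is_cvgD => //; exact: is_cvg_cst.
apply: normed_cvg.
apply: (@series_le_cvg _ _ (geometric (Num.sqrt M) 2^-1)) => //.
- by move=> n; exact: normr_ge0.
- by move=> n; rewrite /geometric/= mulr_ge0 ?sqrtr_ge0// exprn_ge0.
- move=> n; rewrite /geometric/telescope/= -(@ler_pXn2r _ 2)// ?nnegrE ?mulr_ge0 ?sqrtr_ge0 ?exprn_ge0//.
  rewrite real_normK ?num_real// exprMn sqr_sqrtr// exprAC.
  have -> : (2^-1 ^+ 2) ^+ n = (4 ^+ n)^-1 :> R by rewrite -exprVn; congr (_ ^+ _); field.
  by rewrite ler_pdivlMr ?exprn_gt0// mulrC.
- by apply: is_cvg_geometric_series; rewrite ger0_norm// invf_lt1// ltr1n.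
Qed.

(** The Riesz-Fischer argument for a sequence with an explicit rate, so that no subsequence is
    extracted: the weighted squares of the increments have an integrable sum, this forces
    convergence almost everywhere, and Fatou's lemma transfers the rate to the limit. *)
Lemma l2_complete (h : (T -> R)^nat) (c : R) :
  (forall n, measurable_fun setT (h n)) ->
  (forall n m, (n <= m)%N ->
    (\int[mu]_x ((h n x - h m x) ^+ 2)%:E <= (c * 16 ^- n)%:E)%E) ->
  exists2 H : T -> R, measurable_fun setT H &
    forall n, (\int[mu]_x ((h n x - H x) ^+ 2)%:E <= (c * 16 ^- n)%:E)%E.
Proof.
move=> mh hh.
have c0 : 0 <= c.
  have := hh 0 0 (leqnn _); rewrite expr0 invr1 mulr1 -lee_fin; apply: le_trans.
  by apply: integral_ge0 => x _; rewrite lee_fin sqr_ge0.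
(* The weight [4 ^+ n] is small enough against the rate [16 ^- n] for the sum to be integrable, and
   large enough to make the increments summable pointwise. *)
pose D n x := (4 ^+ n * (h n.+1 x - h n x) ^+ 2)%:E.
have D0 n x : (0 <= D n x)%E by rewrite lee_fin mulr_ge0// sqr_ge0.
have mD n : measurable_fun setT (D n).
  apply/measurable_EFinP; apply: measurable_funM => //; apply: measurable_funX.
  exact: measurable_funB.
pose S x := (\sum_(0 <= n <oo) D n x)%E.
have S0 x : (0 <= S x)%E by exact: nneseries_ge0.
have mS : measurable_fun setT S by exact: ge0_emeasurable_sum.
have SI : (\int[mu]_x S x < +oo)%E.
  rewrite integral_nneseries//.
  apply: (@le_lt_trans _ _ (2 * c)%:E); last exact: ltry.
  apply: lime_le; first by apply: is_cvg_nneseries => n _ _; exact: integral_ge0.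
  apply: nearW => n.
  apply: (@le_trans _ _ (\sum_(0 <= k < n) (c * 4 ^- k)%:E)%E).
    apply: lee_sum => k _; rewrite /D; under eq_integral do rewrite EFinM.
    rewrite (@ge0_integralZl_EFin _ _ _ _ _ measurableT)//; last 2 first.
    - by move=> x _; rewrite lee_fin sqr_ge0.
    - by apply/measurable_EFinP; apply: measurable_funX; exact: measurable_funB.
    apply: (@le_trans _ _ ((4 ^+ k)%:E * (c * 16 ^- k)%:E)%E).
      apply: lee_wpmul2l; first by rewrite lee_fin exprn_ge0.
      under eq_integral do rewrite -sqrrN opprB.
      exact: hh.
    rewrite -EFinM lee_fin mulrCA; apply: ler_wpM2l => //.
    have -> : 16 ^- k = 4 ^- k * 4 ^- k :> R.
      by rewrite -invfM -exprMn; congr (_ ^- _); ring.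
    by rewrite mulrA mulfV ?mul1r// expf_neq0.
  rewrite sumEFin lee_fin -mulr_sumr mulrC; apply: ler_wpM2r => //.
  have e0 : 0 <= 4 ^- n :> R by rewrite invr_ge0 exprn_ge0.
  (* The sum is [4 / 3 - 4 / 3 * 4 ^- n]; keeping the subtracted term makes the induction go
     through. *)
  suff : \sum_(0 <= k < n) 4 ^- k <= 2 - 4 / 3 * 4 ^- n :> R.
    by move: (\sum_(0 <= k < n) 4 ^- k : R) (4 ^- n : R) e0 => s u; lra.
  elim: n {e0} => [|n IH]; first by rewrite big_geq// expr0 invr1; lra.
  rewrite big_nat_recr//=; have : 4 ^- n = 4 * 4 ^- n.+1 :> R.
    by rewrite exprS invfM mulrA mulfV ?mul1r.
  move: IH; move: (\sum_(0 <= k < n) 4 ^- k : R) (4 ^- n : R) (4 ^- n.+1 : R) => s u v.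
  lra.
have iS : mu.-integrable setT S.
  by apply/integrableP; split => //; under eq_integral do rewrite gee0_abs//.
pose G := [set x | (S x < +oo)%E].
have mG : measurable G.
  by have := emeasurable_fun_infty_o measurableT mS +oo%E; rewrite setTI.
(* The functions are set to 0 off [G], whose complement is null, so that the limit exists everywhere
   and is measurable. *)
pose k n x := h n x * \1_G x.
have mk n : measurable_fun setT (k n).
  by apply: measurable_funM => //; exact: measurable_indic.
have ck x : cvgn (k ^~ x).
  have [Gx|Gx] := pselect (G x); last first.
    rewrite (_ : k^~ x = cst 0); first exact: is_cvg_cst.
    by apply/funext => n; rewrite /k indicE memNset// mulr0.
  apply: (@cvg_of_weighted_increments _ (fine (S x))) => n.
  rewrite /k indicE mem_set// !mulr1 -lee_fin fineK ?ge0_fin_numE//.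
  apply: le_trans (nneseries_lim_ge n.+1 _) => [|i _ _]; last exact: D0.
  by rewrite big_nat_recr//= leeDr// sume_ge0.
pose H x := limn (k ^~ x).
have kH x : k ^~ x @ \oo --> H x by exact: ck.
have mH : measurable_fun setT H by apply: (measurable_fun_cvg mk) => x _; exact: kH.
exists H => // n.
have mnH : measurable_fun setT (fun x => ((k n x - H x) ^+ 2)%:E).
  by apply/measurable_EFinP; apply: measurable_funX; exact: measurable_funB.
apply: (@le_trans _ _ (\int[mu]_x ((k n x - H x) ^+ 2)%:E)%E).
  apply: ae_ge0_le_integral => //.
  - by move=> x _; rewrite lee_fin sqr_ge0.
  - by apply/measurable_EFinP; apply: measurable_funX; exact: measurable_funB.
  - by move=> x _; rewrite lee_fin sqr_ge0.
  - have := integrable_ae measurableT iS; apply: filterS => x /(_ I) Sx _.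
    by rewrite /k indicE mem_set ?mulr1// /G/= -ge0_fin_numE.
(* The index [m + n] is at least [n], so the hypothesis bounds every integral by the rate at [n]. *)
pose g m x := ((k n x - k (m + n)%N x) ^+ 2)%:E.
have -> : (\int[mu]_x ((k n x - H x) ^+ 2)%:E = \int[mu]_x limn_einf (g ^~ x))%E.
  apply: eq_integral => x _; apply/esym.
  have gH : g ^~ x @ \oo --> ((k n x - H x) ^+ 2)%:E.
    apply: cvg_EFin; first exact: nearW.
    rewrite /comp/=; under eq_fun do rewrite expr2.
    rewrite expr2; apply: cvgM; (apply: cvgB; [exact: cvg_cst|]);
      by have := kH x; rewrite -(cvg_shiftn n).
  by have [-> _] := cvg_limn_einf_sup gH.
have mg m : measurable_fun setT (g m).
  by apply/measurable_EFinP; apply: measurable_funX; exact: measurable_funB.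
apply: (le_trans (fatou mu measurableT mg _)).
  by move=> m x _; rewrite lee_fin sqr_ge0.
apply: limn_einf_le => m; apply: le_trans (hh n (m + n)%N (leq_addl _ _)).
apply: ge0_le_integral => //.
- by move=> x _; rewrite lee_fin sqr_ge0.
- by apply/measurable_EFinP; apply: measurable_funX; exact: measurable_funB.
- move=> x _; rewrite lee_fin /k -mulrBl exprMn -[leRHS]mulr1 ler_wpM2l ?sqr_ge0//.
Qed.

End l2_complete.

(** * Truncation and existence of the transform *)

Section fourier_existence.
Context {R : realType} {d : nat}.
Local Notation T := (d.-tuple R).
Local Notation mu :=
  (lebesgue_tuple d : {sigma_finite_measure set T -> \bar R}).
Implicit Types f g : T -> R[i].

(** The part of [f] of modulus above [e]. It serves twice: as an integrable approximation of an L^2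
    function when [e] is small, and as the large part of [phi] in the splitting. *)
Definition ctrunc (e : R) f (x : T) : R[i] := if e < cabs (f x) then f x else 0.

Lemma cabs0 : cabs (0 : R[i]) = 0.
Proof. by rewrite /cabs/= expr0n addr0 sqrtr0. Qed.

Lemma cmeasurable_ctrunc e f : cmeasurable f -> cmeasurable (ctrunc e f).
Proof.
move=> mf; have mc := measurable_cabs mf; case: mf => mr mi; split.
  rewrite (_ : (fun x => _) = fun x => if e < cabs (f x) then complex.Re (f x) else 0).
    by apply: measurable_fun_ifT => //; exact: measurable_fun_ltr.
  by apply/funext => x; rewrite /ctrunc; case: ifP.
rewrite (_ : (fun x => _) = fun x => if e < cabs (f x) then complex.Im (f x) else 0).
  by apply: measurable_fun_ifT => //; exact: measurable_fun_ltr.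
by apply/funext => x; rewrite /ctrunc; case: ifP.
Qed.

Lemma cabs_ctrunc_le e f x : cabs (ctrunc e f x) <= cabs (f x).
Proof. by rewrite /ctrunc; case: ifP => // _; rewrite cabs0 cabs_ge0. Qed.

Lemma cabsB_ctrunc e f x :
  cabs (f x - ctrunc e f x) = if e < cabs (f x) then 0 else cabs (f x).
Proof. by rewrite /ctrunc; case: ifP => _; rewrite ?subrr ?subr0// cabs0. Qed.

Lemma nsq_ctrunc_lty e f : cmeasurable f -> (nsq f < +oo)%E -> (nsq (ctrunc e f) < +oo)%E.
Proof.
move=> mf; apply: le_lt_trans; apply: le_nsq => //; first exact: cmeasurable_ctrunc.
exact: cabs_ctrunc_le.
Qed.

(** Where the truncation is nonzero, [|f| <= |f|^2 / e]. *)
Lemma cL1_ctrunc e f : 0 < e -> cmeasurable f -> (nsq f < +oo)%E -> cLp 1%:E (ctrunc e f).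
Proof.
move=> e0 mf f2; split; first exact: cmeasurable_ctrunc.
rewrite cLnorm1E; apply: (@le_lt_trans _ _ (e^-1%:E * nsq f)%E); last first.
  by rewrite lte_mul_pinfty// lee_fin invr_ge0 ltW.
rewrite -(@ge0_integralZl_EFin _ _ _ _ _ measurableT)//; last 3 first.
- by move=> x _; rewrite lee_fin sqr_ge0.
- exact: measurable_sqr_cabs.
- by rewrite invr_ge0 ltW.
apply: ge0_le_integral => //.
- by move=> x _; rewrite lee_fin cabs_ge0.
- by apply/measurable_EFinP; apply: measurable_cabs; exact: cmeasurable_ctrunc.
- by apply: measurable_funeM; exact: measurable_sqr_cabs.
- move=> x _; rewrite -EFinM lee_fin /ctrunc; case: ifP => [ef|_].
    by rewrite mulrC ler_pdivlMr// expr2 ler_wpM2l ?cabs_ge0// ltW.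
  by rewrite cabs0 mulr_ge0 ?sqr_ge0// invr_ge0 ltW.
Qed.

(** Dominated convergence along the levels [1 / (n + 1)]: the modulus of the remainder is at most
    the level and at most that of [f]. *)
Lemma ctrunc_approx f (e : R) : cmeasurable f -> (nsq f < +oo)%E -> 0 < e ->
  exists2 t, 0 < t & (nsq (fun x => f x - ctrunc t f x)%R <= e%:E)%E.
Proof.
move=> mf f2 e0.
pose h n x := (cabs (f x - ctrunc n.+1%:R^-1 f x) ^+ 2)%:E.
have mh n : measurable_fun setT (h n).
  by apply: measurable_sqr_cabs; apply: cmeasurableB => //; exact: cmeasurable_ctrunc.
have iF : mu.-integrable setT (fun x => (cabs (f x) ^+ 2)%:E).
  apply/integrableP; split; first exact: measurable_sqr_cabs.
  by under eq_integral do rewrite gee0_abs ?lee_fin ?sqr_ge0//.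
have [] := @dominated_convergence _ _ _ mu setT measurableT h (cst 0%E)
   (fun x => (cabs (f x) ^+ 2)%:E) mh.
- exact: measurable_cst.
- apply: aeW => x _; apply: (@squeeze_cvge _ _ _ _ (cst 0%E) _
    (fun n => (n.+1%:R^-1 * n.+1%:R^-1)%:E)).
  + apply: nearW => n; rewrite /h !lee_fin sqr_ge0/= cabsB_ctrunc.
    case: ifPn => [_|]; first by rewrite expr0n mulr_ge0// invr_ge0.
    by rewrite -leNgt => hx; rewrite expr2 ler_pM// cabs_ge0.
  + exact: cvg_cst.
  + apply: cvg_EFin; first exact: nearW.
    rewrite -[X in _ --> X](mul0r 0); apply: cvgM; exact: cvg_harmonic.
- exact: iF.
- apply: aeW => x n _; rewrite gee0_abs ?lee_fin ?sqr_ge0// cabsB_ctrunc.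
  by case: ifP => // _; rewrite expr0n sqr_ge0.
move=> _ _; rewrite integral0 => cv.
have e' := nbhs_open_ereal_lt (f := fun=> e) e0.
have [N _ HN] : \forall n \near \oo, (\int[mu]_x h n x < e%:E)%E by exact: cv _ e'.
by exists N.+1%:R^-1; [rewrite invr_gt0|exact/ltW/(HN N (leqnn N))].
Qed.

Lemma nsq_ReIm f : cmeasurable f ->
  (nsq f = sqint (fun x => complex.Re (f x)) + sqint (fun x => complex.Im (f x)))%E.
Proof.
move=> [mr mi]; rewrite /sqint -ge0_integralD//; last 4 first.
- by move=> x _; rewrite lee_fin sqr_ge0.
- by apply/measurable_EFinP; exact: measurable_funX.
- by move=> x _; rewrite lee_fin sqr_ge0.
- by apply/measurable_EFinP; exact: measurable_funX.
by apply: eq_integral => x _; rewrite sqr_cabs EFinD.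
Qed.

(* Completeness of L^2 and Bessel's inequality. *)
Lemma is_fourier_L2_exists f : cmeasurable f -> (nsq f < +oo)%E ->
  exists F, is_fourier_L2 f F.
Proof.
move=> mf f2.
(* The squared error [16 ^- n] is the rate that [l2_complete] asks for. *)
have /choice[t ht] : forall n, exists t, 0 < t /\
    (nsq (fun x => f x - ctrunc t f x)%R <= ((4 ^- n) ^+ 2)%:E)%E.
  move=> n; have [|t t0 h] := @ctrunc_approx f ((4 ^- n) ^+ 2) mf f2.
    by rewrite exprn_gt0// invr_gt0 exprn_gt0.
  by exists t.
pose u n := ctrunc (t n) f.
have u1 n : cLp 1%:E (u n) by apply: cL1_ctrunc => //; case: (ht n).
have mu' n : cmeasurable (u n) by case: (u1 n).
have u2 n : cLp 2%:E (u n).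
  by split; [exact: mu'|rewrite cLnorm2_lty; exact: nsq_ctrunc_lty].
have uf n : (nsq (fun x => u n x - f x)%R <= ((4 ^- n) ^+ 2)%:E)%E.
  by rewrite nsqBC; case: (ht n).
have B0 := @bessel_cst_gt0 R d.
have mF n := cmeasurable_fourier_L1 (u1 n).
(* Bessel's constant, times [2 + 2] from the squared triangle inequality through [f]. *)
pose c := 4 * @bessel_cst R d.
have c0 : 0 < c by rewrite mulr_gt0.
have hU n m : (n <= m)%N ->
    (nsq (fun xi => fourier_L1 (u n) xi - fourier_L1 (u m) xi)%R <= (c * 16 ^- n)%:E)%E.
  move=> nm; apply: (le_trans (nsq_fourier_L1B (u1 n) (u1 m))).
  have k4 (k : nat) : (4 ^- k) ^+ 2 = 16 ^- k :> R.
    by rewrite -exprVn exprAC -exprVn; congr (_ ^+ _); field.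
  have -> : (c * 16 ^- n)%:E = ((@bessel_cst R d)%:E * (4 * 16 ^- n)%:E)%E :> \bar R.
    by rewrite -EFinM; congr EFin; rewrite /c; ring.
  apply: lee_wpmul2l; first by rewrite lee_fin ltW.
  apply: (le_trans (nsq_triangle (mu' n) mf (mu' m))).
  have -> : (4 * 16 ^- n)%:E = (2%:E * (16 ^- n)%:E + 2%:E * (16 ^- n)%:E)%E :> \bar R.
    by rewrite -!EFinM -EFinD; congr EFin; ring.
  apply: leeD; apply: lee_wpmul2l => //; first by rewrite -k4.
  rewrite nsqBC; apply: (le_trans (uf m)); rewrite k4 lee_fin lef_pV2 ?posrE ?exprn_gt0//.
  by rewrite ler_weXn2l// ler1n.
(* [P] stands for the real or the imaginary part: the limit is taken in each separately. *)
have part (P : R[i] -> R) : (forall z w, P (z - w) = P z - P w) ->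
    (forall z, P z ^+ 2 <= cabs z ^+ 2) ->
    (forall n, measurable_fun setT (fun xi => P (fourier_L1 (u n) xi))) ->
    exists2 H : T -> R, measurable_fun setT H & forall n,
     (\int[mu]_xi ((P (fourier_L1 (u n) xi) - H xi) ^+ 2)%:E <= (c * 16 ^- n)%:E)%E.
  move=> PB Pc mP; apply: l2_complete => // n m nm; apply: le_trans (hU n m nm).
  apply: ge0_le_integral => //.
  - by move=> x _; rewrite lee_fin sqr_ge0.
  - by apply/measurable_EFinP; apply: measurable_funX; exact: measurable_funB.
  - by apply: measurable_sqr_cabs; exact: cmeasurableB.
  - by move=> x _; rewrite lee_fin -PB.
have [H1 mH1 hH1] : exists2 H : T -> R, measurable_fun setT H & forall n,
    (\int[mu]_xi ((complex.Re (fourier_L1 (u n) xi) - H xi) ^+ 2)%:E <= (c * 16 ^- n)%:E)%E.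
  apply: part => [z w|z|n]; [exact: ReB| |exact: (mF n).1].
  by rewrite sqr_cabs lerDl sqr_ge0.
have [H2 mH2 hH2] : exists2 H : T -> R, measurable_fun setT H & forall n,
    (\int[mu]_xi ((complex.Im (fourier_L1 (u n) xi) - H xi) ^+ 2)%:E <= (c * 16 ^- n)%:E)%E.
  apply: part => [z w|z|n]; [exact: ImB| |exact: (mF n).2].
  by rewrite sqr_cabs lerDr sqr_ge0.
pose F xi := Complex (H1 xi) (H2 xi).
have mFF : cmeasurable F by split.
have FF n : (nsq (fun xi => fourier_L1 (u n) xi - F xi)%R <= (2 * c * 16 ^- n)%:E)%E.
  rewrite nsq_ReIm; last exact: cmeasurableB.
  have -> : (2 * c * 16 ^- n)%:E = ((c * 16 ^- n)%:E + (c * 16 ^- n)%:E)%E :> \bar R.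
    by rewrite -EFinD; congr EFin; ring.
  apply: leeD.
    by apply: le_trans (hH1 n); rewrite /sqint; under eq_integral do rewrite ReB.
  by apply: le_trans (hH2 n); rewrite /sqint; under eq_integral do rewrite ImB.
have c4 : (fun n => 4 ^- n : R) @ \oo --> (0 : R).
  under eq_fun do rewrite -exprVn; apply: cvg_expr.
  by rewrite ger0_norm// invf_lt1// ltr1n.
exists F; split.
  split => //; rewrite cLnorm2_lty.
  have m0 : cmeasurable (fun _ : T => 0 : R[i]) by split; exact: measurable_cst.
  apply: (@le_lt_trans _ _ (2%:E * nsq (fun xi => F xi - fourier_L1 (u 0) xi)%R +
     2%:E * nsq (fun xi => fourier_L1 (u 0) xi - 0)%R)%E).
    apply: le_trans (nsq_triangle mFF (mF 0) m0).
    by rewrite le_eqVlt; apply/orP; left; apply/eqP; apply: eq_integral => x _; rewrite subr0.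
  apply: lte_add_pinfty; apply: lte_mul_pinfty => //.
    by rewrite nsqBC; apply: le_lt_trans (FF 0) _; exact: ltry.
  have -> : nsq (fun xi => fourier_L1 (u 0) xi - 0)%R = nsq (fourier_L1 (u 0)).
    by apply: eq_integral => x _; rewrite subr0.
  apply: le_lt_trans (nsq_fourier_L1 (u1 0)) _; apply: lte_mul_pinfty => //.
    by rewrite lee_fin ltW.
  by rewrite -cLnorm2_lty; case: (u2 0).
exists u => //; split.
  by apply: (cLnorm2_cvg0 _ c4 uf) => n; rewrite invr_ge0 exprn_ge0.
apply: (@cLnorm2_cvg0 _ _ _ (fun n => Num.sqrt (2 * c) * 4 ^- n)).
- by move=> n; rewrite mulr_ge0 ?sqrtr_ge0// invr_ge0 exprn_ge0.
- rewrite -[X in _ --> X](mulr0 (Num.sqrt (2 * c))); apply: cvgM => //; exact: cvg_cst.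
- move=> n; rewrite exprMn sqr_sqrtr; last by rewrite mulr_ge0// ltW.
  have -> // : (4 ^- n) ^+ 2 = 16 ^- n :> R.
  by rewrite -exprVn exprAC -exprVn; congr (_ ^+ _); field.
Qed.

(** All that is known of the representative chosen by [xget]; this is why [is_fourier_L2_dist]
    speaks of an arbitrary transform of [f]. *)
Lemma fourierP f : cmeasurable f -> (nsq f < +oo)%E -> is_fourier_L2 f (fourier f).
Proof.
move=> mf f2; have [F hF] := is_fourier_L2_exists mf f2.
exact: (xgetPex (fun=> 0) (ex_intro _ F hF)).
Qed.

End fourier_existence.

(** * Rearrangements *)

Section tails.
Context {dT} {T : measurableType dT} {R : realType}.
Variable mu : {sigma_finite_measure set T -> \bar R}.
Local Notation lam := (@lebesgue_measure R).

(** The boolean [b] selects [<=] when true and [<] when false, as the tails on the two sides of a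
    comparison are of different kinds. *)
Lemma measurable_cmp (p : T -> R) (b : bool) : measurable_fun setT p ->
  measurable_fun setT (fun q : T * measurableTypeR R => q.2 < p q.1 ?<= if b).
Proof.
move=> mp.
have mp1 : measurable_fun setT (fun q : T * measurableTypeR R => p q.1).
  exact: measurableT_comp.
have m2 : measurable_fun setT (fun q : T * measurableTypeR R => q.2 : R) by exact: measurable_snd.
by case: b; [exact: measurable_fun_ler|exact: measurable_fun_ltr].
Qed.

Lemma measurable_tail (p : T -> R) (b : bool) : measurable_fun setT p ->
  measurable_fun setT (fun l : R => mu [set x | (l < p x ?<= if b)%R]).
Proof.
move=> mp; pose A := [set q : T * measurableTypeR R | q.2 < p q.1 ?<= if b].
have mA : measurable A.
  by have := measurable_cmp b mp; move=> /(_ measurableT [set true] I); rewrite setTI.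
have := measurable_fun_ysection mu mA; congr (measurable_fun _ _).
by apply/funext => l /=; congr (mu _); apply/seteqP; split => x; rewrite /ysection/= inE.
Qed.

(** Tonelli on the region under the graph of [p]. The interval from 0 to [p x] has length [p x] with
    or without its right endpoint, so strict and large tails give the same integral. *)
Lemma integral_tail (p : T -> R) (b : bool) : measurable_fun setT p -> (forall x, 0 <= p x) ->
  (\int[mu]_x (p x)%:E =
   \int[lam]_(l in `]0%R, +oo[) mu [set x | (l < p x ?<= if b)%R])%E.
Proof.
move=> mp p0.
have mb := measurable_cmp b mp.
pose f (q : T * measurableTypeR R) : \bar R :=
  (if (0 < q.2) && (q.2 < p q.1 ?<= if b) then 1 else 0)%:E.
have mf : measurable_fun setT f.
  apply/measurable_EFinP; apply: measurable_fun_ifT => //.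
  apply: measurable_and => //; apply: measurable_fun_ltr => //; exact: measurable_snd.
have f0 q : (0 <= f q)%E by rewrite lee_fin; case: ifP.
transitivity (\int[mu]_x \int[lam]_l f (x, l))%E.
  apply: eq_integral => x _.
  have -> : (p x)%:E = lam [set` Interval (BRight 0) (BSide (~~ b) (p x))].
    rewrite lebesgue_measure_itv/= lte_fin; have := p0 x; rewrite le_eqVlt.
    by case: ltgtP => //= [_ _|<- _]; rewrite ?sube0.
  rewrite -[X in lam X]setIT -integral_indic//; apply: eq_integral => l _.
  rewrite /f indicE/= mem_setE in_itv/= negbK; congr (_%:E); by case: ifP.
rewrite (fubini_tonelli f)// [RHS]integral_mkcond; apply: eq_integral => l _.
rewrite patchE mem_setE in_itv/= andbT.
case: ifPn => l0; last by rewrite integral0_eq// => x _; rewrite /f/= (negbTE l0).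
have mA : measurable [set x | (l < p x ?<= if b)%R].
  have := measurable_fun_pair1 (l : measurableTypeR R) mb.
  by move=> /(_ measurableT [set true] I); rewrite setTI.
rewrite -[X in mu X]setIT -integral_indic//; apply: eq_integral => x _.
by rewrite /f/= l0/= indicE; congr (_%:E); case: ifP => h;
  [rewrite mem_set|rewrite memNset//= h].
Qed.

(* Layer cake; the mismatch between [<] and [<=] is harmless. *)
Lemma le_integral_of_tails (p q : T -> R) :
  measurable_fun setT p -> measurable_fun setT q ->
  (forall x, 0 <= p x) -> (forall x, 0 <= q x) ->
  (forall l : R, (0 < l)%R -> mu [set x | (l < p x)%R] <= mu [set x | (l <= q x)%R])%E ->
  (\int[mu]_x (p x)%:E <= \int[mu]_x (q x)%:E)%E.
Proof.
move=> mp mq p0 q0 pq; rewrite (integral_tail false mp p0) (integral_tail true mq q0).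
apply: ge0_le_integral => //.
- by apply: measurable_funTS; exact: measurable_tail.
- by apply: measurable_funTS; exact: measurable_tail.
- by move=> l /=; rewrite in_itv/= andbT => l0; exact: pq.
Qed.

End tails.

Section rearrangement_facts.
Context {R : realType} {d : nat}.
Local Notation T := (d.-tuple R).
Local Notation lam := (@lebesgue_measure R).
Local Notation mu :=
  (lebesgue_tuple d : {sigma_finite_measure set T -> \bar R}).
Hypothesis d0 : (0 < d)%N.

Lemma measurable_enorm_le0 : measurable [set x : T | enorm x <= 0].
Proof.
have := @measurable_fun_ler _ _ R setT (@enorm R d) (cst 0) measurable_enorm.
by move=> /(_ (measurable_cst _) measurableT [set true] I); rewrite setTI.
Qed.

(** The set lies in a box with all sides reduced to a point. The origin has to be discarded
    repeatedly, since the rearrangement may be infinite there. *)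
Lemma mu_enorm_le0 : mu [set x : T | enorm x <= 0] = 0%E.
Proof.
have mN := measurable_enorm_le0.
apply/eqP; rewrite eq_le measure_ge0 andbT.
have -> : 0%E = (\prod_(i < d) @lebesgue_measure R [set 0%R])%E.
  case: d d0 => // n _; rewrite big_ord_recl lebesgue_measure_set1 mul0e//.
rewrite -lebesgue_tuple_box//; apply: le_measure; rewrite ?inE//.
  exact: (measurable_box (fun _ => measurable_set1 (0 : R))).
move=> x /= x0 i; apply/eqP; rewrite -normr_le0.
exact: le_trans (normr_tnth_le_enorm x i) x0.
Qed.

Lemma ae_enorm_gt0 : {ae mu, forall x : T, 0 < enorm x}.
Proof.
exists [set x : T | enorm x <= 0]; split.
- exact: measurable_enorm_le0.
- exact: mu_enorm_le0.
- by move=> x /= /negP; rewrite -leNgt.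
Qed.

(** Stated through volumes because [vradius] is specified by a volume only, which leaves it free
    among the nonpositive numbers when the set is null. *)
Lemma le_ball_radius (r s : R) : (mu (oball0 r) <= mu (oball0 s))%E ->
  oball0 r `<=` (oball0 s : set T).
Proof.
move=> rs x; rewrite /oball0/= => xr; have [sr|rs'] := ltP s r; last first.
  exact: lt_le_trans rs'.
have r0 : 0 < r by apply: le_lt_trans (enorm_ge0 x) xr.
move: rs; rewrite lebesgue_tuple_ball//; have [s0|s0] := leP s 0.
  rewrite oball0_le0// measure0 lee_fin leNgt => /negP[].
  by rewrite mulr_gt0 ?vball1_gt0// exprn_gt0.
rewrite lebesgue_tuple_ball// lee_fin ler_pM2r ?vball1_gt0//.
by rewrite ler_pXn2r ?nnegrE ?(ltW r0) ?(ltW s0)// leNgt sr.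
Qed.

Variable phi : T -> R[i].
Hypothesis mphi : cmeasurable phi.
Hypothesis phi2 : (nsq phi < +oo)%E.

Local Notation E l := [set y | l < cabs (phi y)].
Local Notation B l := (srearr_set (E l)).

Let mE l : measurable (E l).
Proof.
have := @measurable_fun_ltr _ _ R setT (cst l) _ (measurable_cst _) (measurable_cabs mphi).
by move=> /(_ measurableT [set true] I); rewrite setTI.
Qed.

Lemma chebyshev_cabs l : 0 < l -> ((l ^+ 2)%:E * mu (E l) <= nsq phi)%E.
Proof.
move=> l0; rewrite -[X in mu X]setIT -integral_indic//.
rewrite -(@ge0_integralZl_EFin _ _ _ _ _ measurableT)//; last 2 first.
- by apply/measurable_EFinP; exact: measurable_indic.
- by rewrite sqr_ge0.
apply: ge0_le_integral => //.
- by move=> x _; rewrite mule_ge0// lee_fin// sqr_ge0.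
- by apply: measurable_funeM; apply/measurable_EFinP; exact: measurable_indic.
- exact: measurable_sqr_cabs.
- move=> x _; rewrite -EFinM lee_fin indicE.
  have [/set_mem/= xl|_] := boolP (x \in _); last by rewrite mulr0 sqr_ge0.
  by rewrite mulr1 ler_pXn2r ?nnegrE ?cabs_ge0 ?ltW.
Qed.

Lemma mu_level_lty l : 0 < l -> (mu (E l) < +oo)%E.
Proof.
move=> l0; have := le_lt_trans (chebyshev_cabs l0) phi2.
move=> h; rewrite ltNge leye_eq; apply/negP => /eqP e; move: h.
by rewrite e gt0_muley// lte_fin exprn_gt0.
Qed.

Lemma mu_srearr_set l : 0 < l -> mu (B l) = mu (E l).
Proof.
move=> l0; have [r hr] : exists r, mu (oball0 r) = mu (E l).
  by apply: lebesgue_tuple_ball_surj => //; rewrite measure_ge0 mu_level_lty.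
exact: (xgetPex 0 (ex_intro (fun r => mu (oball0 r) = mu (E l)) r hr)).
Qed.

Lemma srearr_set_anti l l' : 0 < l -> l <= l' -> B l' `<=` B l.
Proof.
move=> l0 ll'; apply: le_ball_radius.
have l'0 : 0 < l' by exact: lt_le_trans ll'.
rewrite -/(B l) -/(B l') !mu_srearr_set//; apply: le_measure; rewrite ?inE//.
by move=> x /=; exact: le_lt_trans.
Qed.

(** The levels whose ball contains [x]. They form an interval starting at 0, and [srearr phi x] is
    its length; whether the right endpoint belongs to it is left open, hence the alternation of
    strict and large inequalities below. *)
Let D (x : T) : set R := [set l | 0 < l /\ B l x].

Let D_down x l l' : D x l -> 0 < l' -> l' <= l -> D x l'.
Proof. by move=> [l0 Bx] l'0 ll'; split => //; exact: (srearr_set_anti l'0 ll'). Qed.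

Let mD x : measurable (D x).
Proof.
apply: is_interval_measurable => a b Da Db c /andP[ac cb].
by apply: (D_down Db) => //; apply: lt_le_trans ac; case: Da.
Qed.

Lemma srearrE x : srearr phi x = lam (D x).
Proof.
rewrite /srearr integral_mkcond -[X in lam X]setIT -integral_indic//; last exact: mD.
apply: eq_integral => l _; rewrite patchE mem_setE in_itv/= andbT !indicE.
case: ifPn => l0; congr (_%:E); last by rewrite memNset// => -[] /=; rewrite (negbTE l0).
have -> // : (x \in srearr_set (E l)) = (l \in D x).
by apply/idP/idP => /set_mem h; apply/mem_set; [split|case: h].
Qed.

Lemma srearr_ge0 x : (0 <= srearr phi x)%E.
Proof. by rewrite srearrE. Qed.

Lemma srearr_ge_of_ball l x : 0 < l -> B l x -> (l%:E <= srearr phi x)%E.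
Proof.
move=> l0 Bx; rewrite srearrE.
have -> : l%:E = lam `]0, l]%classic by rewrite lebesgue_measure_itv/= lte_fin l0 sube0.
apply: le_measure; rewrite ?inE//; first exact: mD.
move=> l' /=; rewrite in_itv/= => /andP[l'0 l'l]; exact: (@D_down x l l').
Qed.

Lemma ball_of_srearr_gt l x : 0 < l -> (l%:E < srearr phi x)%E -> B l x.
Proof.
move=> l0; rewrite srearrE => lD; apply: contrapT => nB.
move: lD; rewrite ltNge => /negP; apply.
have -> : l%:E = lam `]0, l]%classic by rewrite lebesgue_measure_itv/= lte_fin l0 sube0.
apply: le_measure; rewrite ?inE//; first exact: mD.
move=> l' Dl' /=; rewrite in_itv/=; case: (Dl') => -> _ /=.
rewrite leNgt; apply/negP => ll'; apply: nB.
by case: (D_down Dl' l0 (ltW ll')).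
Qed.

Lemma srearr_anti x y : enorm x <= enorm y -> (srearr phi y <= srearr phi x)%E.
Proof.
move=> xy; rewrite !srearrE; apply: le_measure; rewrite ?inE//; [exact: mD|exact: mD|].
by move=> l [l0 By]; split => //; exact: le_lt_trans xy By.
Qed.

(** By monotonicity in the norm, a superlevel set is the preimage under [enorm] of the interval
    [J]. *)
Lemma measurable_srearr : measurable_fun setT (srearr phi).
Proof.
apply: (measurability _ (ErealGenOInfty.measurableE R)).
move=> _ [_ [r ->] <-]; rewrite setTI.
pose J := [set t : R | exists2 x : T, (r%:E < srearr phi x)%E & t <= enorm x].
have mJ : measurable J.
  apply: is_interval_measurable => a b Ja [x xr bx] c /andP[ac cb].
  by exists x => //; exact: le_trans bx.
have -> : srearr phi @^-1` `]r%:E, +oo[ = enorm @^-1` J.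
  apply/seteqP; split => x /=; rewrite in_itv/= andbT.
    by move=> rx; exists x.
  by move=> [y ry xy]; exact: lt_le_trans (srearr_anti xy).
by rewrite -[X in measurable X]setTI; exact: measurable_enorm.
Qed.

(** An infinite value at [x] would put [x] in the ball of every level, so every level set would have
    at least the volume [c] of the ball of radius [enorm x]. Chebyshev's inequality forbids this at
    the level with [l ^+ 2 * c = fine (nsq phi) + 1]. *)
Lemma srearr_lty x : 0 < enorm x -> (srearr phi x < +oo)%E.
Proof.
move=> x0; rewrite ltNge leye_eq; apply/negP => /eqP xoo.
pose c := enorm x ^+ d * vball1 d.
have c0 : 0 < c by rewrite mulr_gt0 ?vball1_gt0// exprn_gt0.
pose l := Num.sqrt ((fine (nsq phi) + 1) / c).
have n0 : 0 <= fine (nsq phi) by rewrite fine_ge0// nsq_ge0.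
have l0 : 0 < l by rewrite sqrtr_gt0 divr_gt0// ltr_wpDl.
have Bx : B l x by apply: ball_of_srearr_gt => //; rewrite xoo ltry.
have := chebyshev_cabs l0; rewrite -mu_srearr_set//.
have nE : nsq phi = (fine (nsq phi))%:E by rewrite fineK// ge0_fin_numE// nsq_ge0.
rewrite leNgt => /negP; apply.
apply: (@lt_le_trans _ _ ((l ^+ 2)%:E * c%:E)%E).
  rewrite -EFinM sqr_sqrtr ?divr_ge0 ?addr_ge0 ?(ltW c0)// divfK ?gt_eqF//.
  by rewrite {1}nE lte_fin ltrDl.
apply: lee_wpmul2l; first by rewrite lee_fin sqr_ge0.
rewrite /c -lebesgue_tuple_ball//; apply: le_measure; rewrite ?inE; try exact: measurable_oball0.
by move=> y; rewrite /oball0/= => yx; exact: lt_trans yx Bx.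
Qed.

(** [fine] sends a possible value [+oo] at the origin to 0, so monotonicity is claimed only away
    from the origin. *)
Definition rdecr (x : T) : R := fine (srearr phi x).

Lemma csrearrE : csrearr phi = fun x => Complex (rdecr x) 0.
Proof. by []. Qed.

Lemma rdecr_ge0 x : 0 <= rdecr x.
Proof. by rewrite fine_ge0// srearr_ge0. Qed.

Lemma measurable_rdecr : measurable_fun setT rdecr.
Proof. exact: (measurableT_comp (@fine_measurable _ _ measurableT) measurable_srearr). Qed.

Lemma rdecr_anti x y : 0 < enorm x -> enorm x <= enorm y -> rdecr y <= rdecr x.
Proof.
move=> x0 xy; apply: fine_le; last exact: srearr_anti.
- by rewrite ge0_fin_numE ?srearr_ge0// srearr_lty// (lt_le_trans x0).
- by rewrite ge0_fin_numE ?srearr_ge0// srearr_lty.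
Qed.

Let EFin_rdecr x : 0 < enorm x -> (rdecr x)%:E = srearr phi x.
Proof. by move=> x0; rewrite fineK// ge0_fin_numE ?srearr_ge0// srearr_lty. Qed.

(** This lemma and the next are the two halves of equimeasurability, in the form that
    [le_integral_of_tails] accepts. *)
Lemma rdecr_tail_ge l : 0 < l -> (mu (E l) <= mu [set x | (l <= rdecr x)%R])%E.
Proof.
move=> l0; rewrite -mu_srearr_set//.
have mG : measurable [set x | l <= rdecr x].
  have := @measurable_fun_ler _ _ R setT (cst l) rdecr (measurable_cst _) measurable_rdecr.
  by move=> /(_ measurableT [set true] I); rewrite setTI.
(* The ball contains the origin as soon as it is nonempty, and [rdecr] need not reach [l] there; a
   null set is added to cover it. *)
rewrite -(measureU0 mG measurable_enorm_le0 mu_enorm_le0).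
apply: le_measure; rewrite ?inE.
- exact: measurable_oball0.
- by apply: measurableU => //; exact: measurable_enorm_le0.
- move=> x Bx; have [x0|x0] := ltP 0 (enorm x); last by right.
  by left; rewrite /= -lee_fin EFin_rdecr//; exact: srearr_ge_of_ball.
Qed.

Lemma rdecr_tail_le l : 0 < l -> (mu [set x | (l < rdecr x)%R] <= mu (E l))%E.
Proof.
move=> l0; rewrite -mu_srearr_set//; apply: le_measure; rewrite ?inE.
- have := @measurable_fun_ltr _ _ R setT (cst l) rdecr (measurable_cst _) measurable_rdecr.
  by move=> /(_ measurableT [set true] I); rewrite setTI.
- exact: measurable_oball0.
- move=> x /= lx; apply: ball_of_srearr_gt => //.
  have := srearr_ge0 x; move: lx; rewrite /rdecr.
  by case: (srearr phi x) => [r| |] //=; rewrite ?lte_fin ?ltry.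
Qed.

End rearrangement_facts.

(** * Upper bound *)

Section upper_bound.
Context {R : realType} {d : nat}.
Local Notation T := (d.-tuple R).
Local Notation mu :=
  (lebesgue_tuple d : {sigma_finite_measure set T -> \bar R}).

Lemma normr_fcos_le (g : T -> R) (m : R) xi : mu.-integrable setT (EFin \o g) ->
  (\int[mu]_x (`|g x|)%:E <= m%:E)%E -> `|fcos g xi| <= m.
Proof.
move=> ig gm; rewrite -lee_fin -abse_EFin EFin_fcos//; apply: le_trans gm.
have /integrableP[mc _] := integrable_cos xi ig.
have /integrableP[/measurable_EFinP mg _] := ig.
apply: (le_trans (le_abse_integral _ measurableT mc)); apply: ge0_le_integral => //.
- exact: measurableT_comp.
- by apply/measurable_EFinP; exact: measurableT_comp.
- by move=> x _; rewrite abse_EFin lee_fin normrM ler_piMr// cos_max.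
Qed.

Lemma normr_fsin_le (g : T -> R) (m : R) xi : mu.-integrable setT (EFin \o g) ->
  (\int[mu]_x (`|g x|)%:E <= m%:E)%E -> `|fsin g xi| <= m.
Proof.
move=> ig gm; rewrite -lee_fin -abse_EFin EFin_fsin//; apply: le_trans gm.
have /integrableP[mc _] := integrable_sin xi ig.
have /integrableP[/measurable_EFinP mg _] := ig.
apply: (le_trans (le_abse_integral _ measurableT mc)); apply: ge0_le_integral => //.
- exact: measurableT_comp.
- by apply/measurable_EFinP; exact: measurableT_comp.
- by move=> x _; rewrite abse_EFin lee_fin normrM ler_piMr// sin_max.
Qed.

(** The real and the imaginary part are each a combination of two real integrals of modulus at most
    [m], so each square is at most [4 * m ^+ 2]. *)
Lemma sqr_cabs_fourier_L1_le (f : T -> R[i]) (m : R) xi : cLp 1%:E f ->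
  (\int[mu]_x (cabs (f x))%:E <= m%:E)%E -> cabs (fourier_L1 f xi) ^+ 2 <= 8 * m ^+ 2.
Proof.
move=> f1 fm; have [mf _] := f1; have mc := measurable_cabs mf.
have /cL1P[ir ii] := f1; have [mr mi] := mf.
have hr : (\int[mu]_x (`|complex.Re (f x)|)%:E <= m%:E)%E.
  apply: le_trans fm; apply: ge0_le_integral => //.
  - by apply/measurable_EFinP; exact: measurableT_comp.
  - exact/measurable_EFinP.
  - by move=> x _; rewrite lee_fin normr_Re.
have hi : (\int[mu]_x (`|complex.Im (f x)|)%:E <= m%:E)%E.
  apply: le_trans fm; apply: ge0_le_integral => //.
  - by apply/measurable_EFinP; exact: measurableT_comp.
  - exact/measurable_EFinP.
  - by move=> x _; rewrite lee_fin normr_Im.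
have sq (p q : R) : `|p| <= m -> `|q| <= m -> (p + q) ^+ 2 <= 4 * m ^+ 2.
  move=> pm qm; have m0 : 0 <= m by exact: le_trans (normr_ge0 p) pm.
  rewrite -(real_normK (num_real (p + q))).
  have -> : 4 * m ^+ 2 = (m + m) ^+ 2 by ring.
  rewrite ler_pXn2r ?nnegrE ?addr_ge0//; apply: (le_trans (ler_normD _ _)).
  exact: lerD.
have h1 := sq _ _ (normr_fcos_le xi ir hr) (normr_fsin_le xi ii hi).
have h2 : `|- fsin (fun x => complex.Re (f x)) xi| <= m.
  by rewrite normrN; exact: normr_fsin_le.
have {}h2 := sq _ _ (normr_fcos_le xi ii hi) h2.
rewrite sqr_cabs fourier_L1E//=; move: h1 h2.
set p := (fcos _ _ + _); set q := (fcos _ _ + _) => h1 h2; lra.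
Qed.

(** Write [f] as [(f - u) + u]: Bessel's inequality handles the first term, and the transform of [u]
    is bounded pointwise by the L^1 norm. *)
Lemma integral_fourier_le (f F : T -> R[i]) u (m : R) (A : set T) :
  cmeasurable f -> is_fourier_L2 f F -> cLp 1%:E u -> measurable A ->
  (\int[mu]_x (cabs (u x))%:E <= m%:E)%E ->
  (\int[mu]_(xi in A) (cabs (F xi) ^+ 2)%:E <=
   (8 * @bessel_cst R d)%:E * nsq (fun x => f x - u x)%R + (16 * m ^+ 2)%:E * mu A)%E.
Proof.
move=> mf hF u1 mA um; have [[mF _] _] := hF; have mU := cmeasurable_fourier_L1 u1.
have m0 : cmeasurable (fun _ : T => 0 : R[i]) by split; exact: measurable_cst.
have := integral_sqr_cabs_triangle mA mF mU m0.
under eq_integral do rewrite subr0.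
under [in X in (_ <= _ + X)%E -> _]eq_integral do rewrite subr0.
move=> /le_trans; apply; apply: leeD.
  rewrite (_ : 8 * @bessel_cst R d = 2 * (4 * @bessel_cst R d)); last by ring.
  rewrite EFinM -muleA; apply: lee_wpmul2l => //.
  apply: le_trans (is_fourier_L2_dist mf hF u1); apply: ge0_subset_integral => //.
  - exact: (measurable_sqr_cabs (cmeasurableB mF mU)).
  - by move=> x _; rewrite lee_fin sqr_ge0.
rewrite (_ : 16 * m ^+ 2 = 2 * (8 * m ^+ 2)); last by ring.
rewrite EFinM -muleA; apply: lee_wpmul2l => //.
rewrite -integral_cst//; apply: ge0_le_integral => //.
- by move=> x _; rewrite lee_fin sqr_ge0.
- by apply: measurable_funTS; exact: measurable_sqr_cabs.
- by move=> xi _; rewrite lee_fin; exact: sqr_cabs_fourier_L1_le.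
Qed.

Hypothesis d0 : (0 < d)%N.
Variable phi : T -> R[i].
Hypothesis mphi : cmeasurable phi.
Hypothesis phi2 : (nsq phi < +oo)%E.
Local Notation g := (rdecr phi).

Let mg : measurable_fun setT g := measurable_rdecr d0 mphi phi2.
Let mc : measurable_fun setT (fun x => cabs (phi x)) := measurable_cabs mphi.

Let lt_sqrt (l t : R) : 0 < l -> 0 <= t -> (l < t ^+ 2) = (Num.sqrt l < t).
Proof.
move=> l0 t0; rewrite -{1}(sqr_sqrtr (ltW l0)) ltr_pXn2r// nnegrE ?sqrtr_ge0//.
Qed.

Let le_sqrt (l t : R) : 0 < l -> 0 <= t -> (l <= t ^+ 2) = (Num.sqrt l <= t).
Proof.
move=> l0 t0; rewrite -{1}(sqr_sqrtr (ltW l0)) ler_pXn2r// nnegrE ?sqrtr_ge0//.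
Qed.

(** Ensures that the rearrangement has a transform. The tail of a square at [l] is the tail of the
    function at [Num.sqrt l]. *)
Lemma sqint_rdecr_le : (sqint g <= nsq phi)%E.
Proof.
apply: (le_integral_of_tails (p := fun x => g x ^+ 2)
    (q := fun x => cabs (phi x) ^+ 2)).
- exact: measurable_funX.
- exact: measurable_funX.
- by move=> x; exact: sqr_ge0.
- by move=> x; exact: sqr_ge0.
- move=> l l0; have s0 : 0 < Num.sqrt l by rewrite sqrtr_gt0.
  have -> : [set x | l < g x ^+ 2] = [set x | Num.sqrt l < g x].
    by apply/funext => x /=; rewrite lt_sqrt// rdecr_ge0.
  apply: (le_trans (rdecr_tail_le d0 mphi phi2 s0)).
  apply: le_measure; rewrite ?inE//.
  + have := @measurable_fun_ltr _ _ R setT (cst (Num.sqrt l)) _ (measurable_cst _) mc.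
    by move=> /(_ measurableT [set true] I); rewrite setTI.
  + have := @measurable_fun_ler _ _ R setT (cst l) _ (measurable_cst _) (measurable_funX 2 mc).
    by move=> /(_ measurableT [set true] I); rewrite setTI.
  + by move=> x /= /ltW; rewrite le_sqrt// cabs_ge0.
Qed.

(** Where [|phi| > 2 lam] one has [|phi| <= 2 (|phi| - lam)]. Hence the factor 2 in the level: the
    truncation is dominated by the excess over [lam], whose tails are those of [|phi|] shifted by
    [lam] and so pass to [g]. *)
Lemma integral_ctrunc_le lam : 0 <= lam ->
  (\int[mu]_x (cabs (ctrunc (2 * lam) phi x))%:E <=
   2%:E * \int[mu]_x (Num.max 0 (g x - lam))%:E)%E.
Proof.
move=> lam0.
have mM (h : T -> R) : measurable_fun setT h ->
    measurable_fun setT (fun x => Num.max 0 (h x - lam)).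
  by move=> mh; apply: measurable_maxr => //; exact: measurable_funB.
apply: (@le_trans _ _ (2%:E * \int[mu]_x (Num.max 0 (cabs (phi x) - lam))%:E)%E).
  rewrite -(@ge0_integralZl_EFin _ _ _ _ _ measurableT)//; last 2 first.
  - by move=> x _; rewrite lee_fin le_max lexx.
  - by apply/measurable_EFinP; exact: mM.
  apply: ge0_le_integral => //.
  - by move=> x _; rewrite lee_fin cabs_ge0.
  - by apply/measurable_EFinP; apply: measurable_cabs; exact: cmeasurable_ctrunc.
  - by apply: measurable_funeM; apply/measurable_EFinP; exact: mM.
  - move=> x _; rewrite -EFinM lee_fin /ctrunc.
    case: ifPn => h; last by rewrite cabs0 mulr_ge0// le_max lexx.
    apply: (@le_trans _ _ (2 * (cabs (phi x) - lam))); first by lra.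
    by rewrite ler_wpM2l// le_max lexx orbT.
apply: lee_wpmul2l => //.
apply: (le_integral_of_tails (p := fun x => Num.max 0 (cabs (phi x) - lam))
    (q := fun x => Num.max 0 (g x - lam))).
- exact: mM.
- exact: mM.
- by move=> x; rewrite le_max lexx.
- by move=> x; rewrite le_max lexx.
- move=> l l0; have l1 : 0 < l + lam by rewrite ltr_pwDl.
  have -> : [set x | l < Num.max 0 (cabs (phi x) - lam)] = [set x | l + lam < cabs (phi x)].
    by apply/funext => x /=; rewrite lt_max ltNge (ltW l0)/= ltrBrDr.
  have -> : [set x | l <= Num.max 0 (g x - lam)] = [set x | l + lam <= g x].
    by apply/funext => x /=; rewrite le_max leNgt l0/= lerBrDr.
  exact: rdecr_tail_ge.
Qed.

(** Where [|phi| <= 2 lam] one has [|phi| <= 2 min(|phi|, lam)], and capping at [lam] is compatible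
    with rearrangement. *)
Lemma nsq_ctrunc_le lam : 0 <= lam ->
  (nsq (fun x => phi x - ctrunc (2 * lam) phi x)%R <=
   4%:E * \int[mu]_x (Num.min (g x) lam ^+ 2)%:E)%E.
Proof.
move=> lam0.
have mM (h : T -> R) : measurable_fun setT h ->
    measurable_fun setT (fun x => Num.min (h x) lam ^+ 2).
  by move=> mh; apply: measurable_funX; exact: measurable_minr.
apply: (@le_trans _ _ (4%:E * \int[mu]_x (Num.min (cabs (phi x)) lam ^+ 2)%:E)%E).
  rewrite -(@ge0_integralZl_EFin _ _ _ _ _ measurableT)//; last 2 first.
  - by move=> x _; rewrite lee_fin sqr_ge0.
  - by apply/measurable_EFinP; exact: mM.
  apply: ge0_le_integral => //.
  - by move=> x _; rewrite lee_fin sqr_ge0.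
  - by apply: measurable_sqr_cabs; apply: cmeasurableB => //; exact: cmeasurable_ctrunc.
  - by apply: measurable_funeM; apply/measurable_EFinP; exact: mM.
  - move=> x _; rewrite -EFinM lee_fin cabsB_ctrunc.
    case: ifPn => h; first by rewrite expr0n mulr_ge0// sqr_ge0.
    rewrite -leNgt in h.
    have -> : 4 * Num.min (cabs (phi x)) lam ^+ 2 = (2 * Num.min (cabs (phi x)) lam) ^+ 2 by ring.
    have c0 := cabs_ge0 (phi x).
    have m0 : 0 <= Num.min (cabs (phi x)) lam by rewrite le_min c0.
    rewrite ler_pXn2r ?nnegrE ?mulr_ge0//; case: (leP (cabs (phi x)) lam) => h'; lra.
apply: lee_wpmul2l => //.
apply: (le_integral_of_tails (p := fun x => Num.min (cabs (phi x)) lam ^+ 2)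
    (q := fun x => Num.min (g x) lam ^+ 2)).
- exact: mM.
- exact: mM.
- by move=> x; exact: sqr_ge0.
- by move=> x; exact: sqr_ge0.
- move=> l l0; have s0 : 0 < Num.sqrt l by rewrite sqrtr_gt0.
  (* A function capped at [lam] has no value above [lam]; below that level its tails are those of
     the function itself. *)
  have [sl|ls] := ltP (Num.sqrt l) lam; last first.
    rewrite [X in (mu X <= _)%E](_ : _ = set0) ?measure0//.
    apply/seteqP; split => // x /=.
    by rewrite lt_sqrt ?le_min ?cabs_ge0// lt_min (ltNge _ lam) ls andbF.
  have -> : [set x | l < Num.min (cabs (phi x)) lam ^+ 2] =
      [set x | Num.sqrt l < cabs (phi x)].
    by apply/funext => x /=; rewrite lt_sqrt ?le_min ?cabs_ge0// lt_min sl andbT.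
  have -> : [set x | l <= Num.min (g x) lam ^+ 2] = [set x | Num.sqrt l <= g x].
    by apply/funext => x /=; rewrite le_sqrt ?le_min ?rdecr_ge0// (ltW sl) andbT.
  exact: rdecr_tail_ge.
Qed.

End upper_bound.

(** * Lower bound *)

Section lower_bound.
Context {R : realType} {d : nat}.
Local Notation T := (d.-tuple R).
Local Notation mu :=
  (lebesgue_tuple d : {sigma_finite_measure set T -> \bar R}).

Definition tneg (x : T) : T := [tuple - tnth x i | i < d].

Lemma enorm_tneg x : enorm (tneg x) = enorm x.
Proof.
by rewrite /enorm /dotp; congr Num.sqrt; apply: eq_bigr => i _; rewrite tnth_mktuple mulrNN.
Qed.

Lemma lebesgue_tuple_shift_ball (b : T) r : 0 < r ->
  mu (taff 1 (tneg b) @^-1` oball0 r) = (r ^+ d * vball1 d)%:E.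
Proof.
move=> r0; rewrite lebesgue_tuple_taff_preimage//; last exact: measurable_oball0.
by rewrite expr1n invr1 mul1e lebesgue_tuple_ball.
Qed.

(* The ball of radius [r] tangent internally at [y] to the sphere through [y]. *)
Definition inner_ball (r : R) (y : T) : set T :=
  taff 1 (tneg [tuple (1 - r / enorm y) * tnth y i | i < d]) @^-1` oball0 r.

Lemma inner_ballP r (y x : T) : 0 < r -> 2 * r <= enorm y -> inner_ball r y x ->
  [/\ 0 < enorm x, enorm x <= enorm y & forall i, `|tnth x i - tnth y i| <= 2 * r].
Proof.
move=> r0 ry; set c := 1 - r / enorm y; set b := [tuple c * tnth y i | i < d].
rewrite /inner_ball -/c -/b /oball0/=; set z := taff 1 (tneg b) x => zr.
have y0 : 0 < enorm y by apply: lt_le_trans ry; rewrite mulr_gt0.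
have ry1 : r / enorm y <= 1 by rewrite ler_pdivrMr// mul1r; lra.
have c0 : 0 <= c by rewrite subr_ge0.
pose t0 : T := [tuple 0 | i < d].
have t00 : enorm t0 = 0.
  by rewrite /enorm /dotp big1 ?sqrtr0// => i _; rewrite tnth_mktuple mul0r.
have bE : b = taff c t0 y.
  by apply: eq_from_tnth => i; rewrite !tnth_mktuple addr0.
have bn : enorm b <= enorm y - r.
  rewrite bE; apply: (le_trans (enorm_taff _ _ c0)).
  by rewrite t00 addr0 /c mulrBl mul1r divfK// gt_eqF.
have nb : enorm y - r <= enorm b.
  have -> : y = taff (r / enorm y) b y.
    by apply: eq_from_tnth => i; rewrite !tnth_mktuple /c; ring.
  have := enorm_taff b y (_ : 0 <= r / enorm y); rewrite -?bE.
  have ry0 : 0 <= r / enorm y by rewrite divr_ge0 ?enorm_ge0// ltW.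
  move=> /(_ ry0); rewrite divfK ?gt_eqF//.
  have <- : y = taff (r / enorm y) b y.
    by apply: eq_from_tnth => i; rewrite !tnth_mktuple /c; ring.
  lra.
have xE : x = taff 1 b z.
  by apply: eq_from_tnth => i; rewrite !tnth_mktuple; ring.
have bE' : b = taff 1 x (tneg z).
  by apply: eq_from_tnth => i; rewrite !tnth_mktuple; ring.
split.
- have := enorm_taff x (tneg z) (@ler01 R); rewrite -bE' enorm_tneg mul1r.
  by move: nb zr ry; rewrite -/z; lra.
- rewrite xE; apply: (le_trans (enorm_taff _ _ (@ler01 R))); rewrite mul1r; lra.
- move=> i; have -> : tnth x i - tnth y i = tnth z i - r / enorm y * tnth y i.
    by rewrite !tnth_mktuple /c; ring.
  apply: (le_trans (ler_normB _ _)).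
  have h1 := normr_tnth_le_enorm z i; have h2 := normr_tnth_le_enorm y i.
  have h3 : `|r / enorm y * tnth y i| <= r.
    rewrite normrM ger0_norm ?divr_ge0 ?(ltW r0) ?(ltW y0)//.
    by rewrite mulrAC ler_pdivrMr// ler_wpM2l// ltW.
  lra.
Qed.

(** [u] will be a cut-off of the rearrangement and [A] the ball of radius tau. By [arho], the kernel
    is at least [kap] between points whose coordinates differ by at most [2 * rho]. *)
Variables (a rho : R) (A : set T) (u : T -> R).
Hypothesis a0 : 0 < a.
Hypothesis rho0 : 0 < rho.
Hypothesis arho : 2 * pi * (2 * rho) * a <= 1.
Hypothesis mA : measurable A.
Hypothesis Aa : forall xi, ~ A xi -> ttri a xi = 0.
Hypothesis u0 : forall x, 0 <= u x.
Hypothesis u_anti : forall x y, 0 < enorm x -> enorm x <= enorm y -> u y <= u x.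
Hypothesis iu : mu.-integrable setT (EFin \o u).
Hypothesis u2 : (sqint u < +oo)%E.

Let mu' : measurable_fun setT u.
Proof. by have /integrableP[/measurable_EFinP] := iu. Qed.

Let kap := (a * cos 1) ^+ d.
Let Cb : R := (4 * pi) ^+ d.

Let kap0 : 0 < kap.
Proof. by rewrite exprn_gt0// mulr_gt0// cos1_gt0. Qed.

Let Cb0 : 0 < Cb.
Proof. by rewrite exprn_gt0// mulr_gt0// pi_gt0. Qed.

Let N := (\int[mu]_(xi in A) (fdot u u xi)%:E)%E.

Let Nfin : N \is a fin_num.
Proof.
have N0 : (0 <= N)%E by apply: integral_ge0 => x _; rewrite lee_fin fdot_ge0.
rewrite ge0_fin_numE//; apply: (@le_lt_trans _ _ (Cb%:E * sqint u)%E); last first.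
  by rewrite lte_mul_pinfty// lee_fin ltW.
apply: le_trans (bessel iu); apply: ge0_subset_integral => //.
- by apply/measurable_EFinP; exact: measurable_fdot.
- by move=> x _; rewrite lee_fin fdot_ge0.
Qed.

Let kernel_lower (x y : T) : (forall i, `|tnth x i - tnth y i| <= 2 * rho) ->
  kap <= tfejer a (tsub x y).
Proof.
move=> xy; apply: tfejer_lower => // i; rewrite tnth_mktuple; apply: le_trans arho.
by rewrite ler_pM2r// ler_wpM2l// mulr_ge0// pi_ge0.
Qed.

(* The parameter of [pairing_le] is chosen so that both of its terms balance. *)
Let pairing_square (w : T -> R) (q v : R) : mu.-integrable setT (EFin \o w) ->
  0 < v -> 0 < q -> (sqint w <= q%:E)%E ->
  (v%:E <= \int[sfprod mu mu]_p (u p.1 * w p.2 * tfejer a (tsub p.1 p.2))%:E)%E ->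
  v ^+ 2 <= Cb * q * fine N.
Proof.
move=> iw v0 q0 wq vP; have s0 : 0 < Cb * q / v by rewrite divr_gt0// mulr_gt0.
have w2 : (sqint w < +oo)%E by apply: le_lt_trans wq _; exact: ltry.
have := pairing_le a0 s0 mA Aa iu iw u2 w2; rewrite -/N => h.
have {h} : ((2 * v)%:E <= (Cb * q / v * fine N + v)%:E)%E.
  rewrite EFinD !EFinM (fineK Nfin) -EFinM; apply: le_trans.
    by apply: (@lee_wpmul2l _ 2%:E _ _ _ vP); rewrite lee_fin.
  apply: (le_trans h); apply: leeD => //.
  apply: (@le_trans _ _ ((Cb * q / v)^-1%:E * (Cb * q)%:E)%E).
    apply: lee_wpmul2l; first by rewrite lee_fin invr_ge0 ltW.
    apply: (le_trans (bessel iw)); rewrite -/Cb EFinM; apply: lee_wpmul2l => //.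
    by rewrite lee_fin ltW.
  rewrite -EFinM lee_fin invf_div divfK// gt_eqF// mulr_gt0//.
rewrite lee_fin => h.
have : v * (2 * v) <= v * (Cb * q / v * fine N + v) by rewrite ler_pM2l.
have -> : v * (Cb * q / v * fine N + v) = Cb * q * fine N + v ^+ 2.
  by field; rewrite gt_eqF.
lra.
Qed.

Let V : R := rho ^+ d * vball1 d.

Let V0 : 0 < V.
Proof. by rewrite mulr_gt0 ?vball1_gt0// exprn_gt0. Qed.

Let mB : measurable (oball0 rho : set T).
Proof. exact: measurable_oball0. Qed.

Let mK : measurable_fun setT (fun p : T * T => tfejer a (tsub p.1 p.2)).
Proof. exact: measurable_tfejer_tsub. Qed.

(** Pair [u] with the indicator of the ball. Two points of the ball are close enough for the lower
    bound of the kernel, so the pairing is at least [kap * (I * V)], against the squared norm [V] of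
    the indicator. *)
Lemma lower_bound_ball (I : R) : (\int[mu]_(x in oball0 rho) (u x)%:E = I%:E)%E ->
  kap ^+ 2 * V * I ^+ 2 <= Cb * fine N.
Proof.
move=> uI; have N0 : 0 <= fine N.
  by rewrite fine_ge0//; apply: integral_ge0 => x _; rewrite lee_fin fdot_ge0.
have : 0 <= I by rewrite -lee_fin -uI; apply: integral_ge0 => x _; rewrite lee_fin.
(* [pairing_square] needs a positive lower bound of the pairing, so [I = 0] is settled apart. *)
rewrite le_eqVlt => /predU1P[<-|I0].
  by rewrite expr0n mulr0 mulr_ge0// ltW.
pose w : T -> R := \1_(oball0 rho).
have muB : mu (oball0 rho) = V%:E by rewrite lebesgue_tuple_ball.
have mw : measurable_fun setT w by exact: measurable_indic.
have wge0 x : 0 <= w x by rewrite /w indicE.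
have iw : mu.-integrable setT (EFin \o w).
  apply/integrableP; split; first exact/measurable_EFinP.
  under eq_integral do rewrite /= ger0_norm//.
  by rewrite integral_indic// setIT [ltLHS]muB ltry.
have ww x : w x ^+ 2 = w x by rewrite /w indicE; case: (_ \in _); rewrite ?expr1n// expr0n.
have intw : (\int[mu]_x (w x)%:E = V%:E)%E by rewrite integral_indic// setIT.
have iuw : mu.-integrable setT (EFin \o (fun x => u x * w x)).
  apply: (le_integrable measurableT _ _ iu).
    by apply/measurable_EFinP; exact: measurable_funM.
  move=> x _; rewrite /= lee_fin normrM ler_piMr// /w indicE.
  by case: (_ \in _); rewrite ?normr1// normr0.
have intuw : (\int[mu]_x (u x * w x)%:E = I%:E)%E.
  rewrite -uI [RHS]integral_mkcond; apply: eq_integral => x _.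
  by rewrite patchE /w indicE; case: (_ \in _); rewrite ?mulr1// mulr0.
have v0 : 0 < kap * (I * V) := mulr_gt0 kap0 (mulr_gt0 I0 V0).
have := @pairing_square w V (kap * (I * V)) iw v0 V0.
have -> : sqint w = V%:E by rewrite /sqint -intw; apply: eq_integral => x _; rewrite ww.
move=> /(_ (lexx _)) H.
have {H} : (kap * (I * V)) ^+ 2 <= Cb * V * fine N.
  apply: H; rewrite EFinM EFinM -[in leLHS]intuw -[in leLHS]intw.
  rewrite -integral_prodM// -(@ge0_integralZl_EFin _ _ _ _ _ measurableT)//; last 3 first.
  - move=> p _; rewrite lee_fin !mulr_ge0// /w indicE//.
  - apply/measurable_EFinP; apply: measurable_funM; last exact: measurableT_comp.
    by apply: measurable_funM; exact: measurableT_comp.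
  - exact: ltW.
  apply: ge0_le_integral => //.
  - by move=> p _; rewrite mule_ge0 ?lee_fin ?(ltW kap0)// !mulr_ge0// /w indicE//.
  - apply: measurable_funeM; apply/measurable_EFinP.
    apply: measurable_funM; last exact: measurableT_comp.
    by apply: measurable_funM; exact: measurableT_comp.
  - apply/measurable_EFinP; apply: measurable_funM => //.
    by apply: measurable_funM; exact: measurableT_comp.
  - move=> p _; rewrite -EFinM lee_fin /w !indicE.
    have [/set_mem h1|h1] := boolP (p.1 \in _); last first.
      by rewrite mulr0 mul0r mulr0 !mulr_ge0// tfejer_ge0.
    have [/set_mem h2|h2] := boolP (p.2 \in _); last by rewrite !(mulr0, mul0r).
    rewrite !mulr1 mulrC ler_wpM2l//; apply: kernel_lower => i.
    apply: (le_trans (ler_normB _ _)); rewrite mulr_natl mulr2n lerD//.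
      by apply: (le_trans (normr_tnth_le_enorm _ _)); exact: ltW.
    by apply: (le_trans (normr_tnth_le_enorm _ _)); exact: ltW.
have -> : (kap * (I * V)) ^+ 2 = V * (kap ^+ 2 * V * I ^+ 2) by ring.
by rewrite [leRHS]mulrAC [leRHS]mulrC ler_pM2l.
Qed.

Let kap' := kap * ((rho / 2) ^+ d * vball1 d).

(** Pair [u] with its restriction [w] to the complement of the ball. For [y] outside, on the inner
    ball of radius [rho / 2] at [y] both [u x >= u y] and the kernel bound hold, so integrating in
    [x] gives at least [kap' * u y]; integrating against [w] gives [kap' * q], while [w] has squared
    norm [q]. *)
Lemma lower_bound_compl (q : R) :
  (\int[mu]_(x in ~` oball0 rho) (u x ^+ 2)%:E = q%:E)%E ->
  kap' ^+ 2 * q <= Cb * fine N.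
Proof.
move=> uq; have N0 : 0 <= fine N.
  by rewrite fine_ge0//; apply: integral_ge0 => x _; rewrite lee_fin fdot_ge0.
have : 0 <= q by rewrite -lee_fin -uq; apply: integral_ge0 => x _; rewrite lee_fin sqr_ge0.
rewrite le_eqVlt => /predU1P[<-|q0].
  by rewrite mulr0 mulr_ge0// ltW.
pose c : T -> R := \1_(~` oball0 rho); pose w x := u x * c x.
have mcB : measurable (~` oball0 rho : set T) by exact: measurableC.
have mc : measurable_fun setT c by exact: measurable_indic.
have mw : measurable_fun setT w by exact: measurable_funM.
have c1 x : 0 <= c x <= 1 by rewrite /c indicE; case: (_ \in _); rewrite /= ?lexx ler01.
have iw : mu.-integrable setT (EFin \o w).
  apply: (le_integrable measurableT _ _ iu); first exact/measurable_EFinP.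
  move=> x _; rewrite /= lee_fin normrM ler_piMr//; case/andP: (c1 x) => h1 h2.
  by rewrite ger0_norm.
have w2q : sqint w = q%:E.
  rewrite /sqint -uq [RHS]integral_mkcond; apply: eq_integral => x _.
  by rewrite patchE /w /c indicE; case: (_ \in _); rewrite ?mulr1// mulr0 expr0n.
have wu x : w x * u x = w x ^+ 2.
  by rewrite /w /c indicE; case: (_ \in _); rewrite ?mulr1 ?mulr0 ?mul0r ?expr0n// expr2.
have w0 x : 0 <= w x by rewrite /w mulr_ge0//; case/andP: (c1 x).
have r20 : 0 < rho / 2 by rewrite divr_gt0.
have k'0 : 0 < kap' := mulr_gt0 kap0 (mulr_gt0 (exprn_gt0 d r20) (vball1_gt0 d)).
have v0 : 0 < kap' * q := mulr_gt0 k'0 q0.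
have := @pairing_square w q (kap' * q) iw v0 q0.
rewrite w2q => /(_ (lexx _)) H.
have {H} : (kap' * q) ^+ 2 <= Cb * q * fine N.
  apply: H.
  have mF : measurable_fun setT (fun p : T * T =>
      (u p.1 * w p.2 * tfejer a (tsub p.1 p.2))%:E).
    apply/measurable_EFinP; apply: measurable_funM => //.
    by apply: measurable_funM; exact: measurableT_comp.
  have F0 (p : T * T) : (0 <= (u p.1 * w p.2 * tfejer a (tsub p.1 p.2))%:E)%E.
    by rewrite lee_fin !mulr_ge0// tfejer_ge0.
  rewrite /sfprod (fubini_tonelli2 (fun p : T * T =>
    (u p.1 * w p.2 * tfejer a (tsub p.1 p.2))%:E))//.
  rewrite EFinM -w2q /sqint -(@ge0_integralZl_EFin _ _ _ _ _ measurableT)//; last 3 first.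
  - by move=> x _; rewrite lee_fin sqr_ge0.
  - by apply/measurable_EFinP; exact: measurable_funX.
  - exact: ltW.
  apply: ge0_le_integral => //.
  - by move=> y _; rewrite mule_ge0 ?lee_fin ?sqr_ge0// ltW.
  - by apply: measurable_funeM; apply/measurable_EFinP; exact: measurable_funX.
  - exact: measurable_fun_fubini_tonelli_G.
  move=> y _; have [yB|yB] := boolP (y \in (~` oball0 rho : set T)); last first.
    rewrite /w /c indicE (negbTE yB) mulr0 expr0n mule0.
    by apply: integral_ge0 => x _; exact: (F0 (x, y)).
  have ry : 2 * (rho / 2) <= enorm y.
    by rewrite mulrC divfK//; move/set_mem: yB; rewrite /oball0/= => /negP; rewrite -leNgt.
  have mP : measurable (inner_ball (rho / 2) y).
    rewrite /inner_ball -[X in measurable X]setTI; apply: measurable_taff => //.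
    exact: measurable_oball0.
  apply: (@le_trans _ _ (\int[mu]_x ((w y * u y * kap)%:E * (\1_(inner_ball (rho / 2) y) x)%:E))%E).
    rewrite (@ge0_integralZl_EFin _ _ _ _ _ measurableT)//; last 2 first.
    - by apply/measurable_EFinP; exact: measurable_indic.
    - by rewrite !mulr_ge0// ltW.
    have muP : mu (inner_ball (rho / 2) y) = ((rho / 2) ^+ d * vball1 d)%:E.
      exact: lebesgue_tuple_shift_ball.
    rewrite integral_indic// setIT [X in (_ <= _ * X)%E]muP.
    by rewrite -!EFinM lee_fin wu /kap' le_eqVlt; apply/orP; left; apply/eqP; ring.
  apply: ge0_le_integral => //.
  - by move=> x _; rewrite mule_ge0// lee_fin ?indicE// !mulr_ge0// ltW.
  - by apply: measurable_funeM; apply/measurable_EFinP; exact: measurable_indic.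
  - exact: measurable_fun_pair1 mF.
  move=> x _; rewrite -EFinM lee_fin indicE /=.
  have [/set_mem hx|hx] := boolP (x \in _); last first.
    by rewrite mulr0 !mulr_ge0// tfejer_ge0.
  have [x0 xy hi] := inner_ballP r20 ry hx.
  rewrite mulr1 (mulrC (w y)); apply: ler_pM => //.
  - by rewrite mulr_ge0.
  - exact: ltW.
  - by rewrite ler_wpM2r// u_anti.
  - apply: kernel_lower => i; apply: (le_trans (hi i)); rewrite mulrC divfK//; lra.
have -> : (kap' * q) ^+ 2 = q * (kap' ^+ 2 * q) by ring.
by rewrite [leRHS]mulrAC [leRHS]mulrC ler_pM2l.
Qed.

End lower_bound.

(** * Removing the truncation of the rearrangement *)

Section truncated_rearrangement.
Context {R : realType} {d : nat}.
Local Notation T := (d.-tuple R).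
Local Notation mu :=
  (lebesgue_tuple d : {sigma_finite_measure set T -> \bar R}).
Hypothesis d0 : (0 < d)%N.
Variable phi : T -> R[i].
Hypothesis mphi : cmeasurable phi.
Hypothesis phi2 : (nsq phi < +oo)%E.
Local Notation g := (rdecr phi).
Local Notation psi := (csrearr phi).

Let mg : measurable_fun setT g := measurable_rdecr d0 mphi phi2.

Let g0 x : 0 <= g x := rdecr_ge0 d0 mphi phi2 x.

Let cabs_psi x : cabs (psi x) = g x.
Proof. by rewrite csrearrE cabs_real ger0_norm. Qed.

Lemma cmeasurable_csrearr : cmeasurable psi.
Proof. by rewrite csrearrE; split => //=; exact: mg. Qed.

Lemma nsq_csrearr_lty : (nsq psi < +oo)%E.
Proof.
have -> : nsq psi = sqint g by apply: eq_integral => x _; rewrite cabs_psi.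
exact: le_lt_trans (sqint_rdecr_le d0 mphi phi2) phi2.
Qed.

(** A cut by level, which gives an integrable function for [t > 0] and preserves the decrease along
    the radius. *)
Definition trdecr (t : R) (x : T) : R := if t < g x then g x else 0.

Lemma trdecr_ge0 t x : 0 <= trdecr t x.
Proof. by rewrite /trdecr; case: ifP. Qed.

Lemma trdecr_anti t x y : 0 < enorm x -> enorm x <= enorm y -> trdecr t y <= trdecr t x.
Proof.
move=> x0 xy; have gg := rdecr_anti d0 mphi phi2 x0 xy.
rewrite /trdecr; case: ifP => ty; last by case: ifP.
by rewrite (lt_le_trans ty gg).
Qed.

Lemma ctrunc_csrearr t : ctrunc t psi = fun x => Complex (trdecr t x) 0.
Proof. by apply/funext => x; rewrite /ctrunc cabs_psi /trdecr; case: ifP. Qed.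

Section fixed_level.
Variable t : R.
Hypothesis t0 : 0 < t.
Local Notation u := (trdecr t).

Let u1 : cLp 1%:E (ctrunc t psi).
Proof. exact: cL1_ctrunc t0 cmeasurable_csrearr nsq_csrearr_lty. Qed.

Lemma integrable_trdecr : mu.-integrable setT (EFin \o u).
Proof. by have /cL1P[] := u1; rewrite ctrunc_csrearr. Qed.

Lemma measurable_trdecr : measurable_fun setT u.
Proof. by have /integrableP[/measurable_EFinP] := integrable_trdecr. Qed.

Lemma sqint_trdecr_lty : (sqint u < +oo)%E.
Proof.
apply: le_lt_trans (nsq_ctrunc_lty t cmeasurable_csrearr nsq_csrearr_lty).
rewrite le_eqVlt; apply/orP; left; apply/eqP; apply: eq_integral => x _.
by rewrite ctrunc_csrearr cabs_real real_normK// num_real.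
Qed.

Lemma sqr_cabs_fourier_trdecr xi : cabs (fourier_L1 (ctrunc t psi) xi) ^+ 2 = fdot u u xi.
Proof.
rewrite sqr_cabs fourier_L1E// ctrunc_csrearr /=.
have -> : fsin (fun=> 0 : R) xi = 0.
  by rewrite /fsin; under eq_Rintegral do rewrite mul0r; rewrite /Rintegral integral0.
have -> : fcos (fun=> 0 : R) xi = 0.
  by rewrite /fcos; under eq_Rintegral do rewrite mul0r; rewrite /Rintegral integral0.
by rewrite addr0 add0r sqrrN.
Qed.

(** Passes from the transform of the cut-off to that of the rearrangement, at the price of a factor
    2 and of an error that is small with the L^2 distance. *)
Lemma integral_fdot_trdecr_le (G : T -> R[i]) (A : set T) : is_fourier_L2 psi G ->
  measurable A ->
  (\int[mu]_(xi in A) (fdot u u xi)%:E <=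
   2%:E * \int[mu]_(xi in A) (cabs (G xi) ^+ 2)%:E +
   (8 * @bessel_cst R d)%:E * nsq (fun x => psi x - ctrunc t psi x)%R)%E.
Proof.
move=> hG mA; have [[mG _] _] := hG; have mU := cmeasurable_fourier_L1 u1.
have m0 : cmeasurable (fun _ : T => 0 : R[i]) by split; exact: measurable_cst.
have := integral_sqr_cabs_triangle mA mU mG m0.
under eq_integral do rewrite subr0 sqr_cabs_fourier_trdecr.
under [in X in (_ <= _ + X)%E -> _]eq_integral do rewrite subr0.
move=> /le_trans; apply; rewrite addeC; apply: leeD => //.
rewrite (_ : 8 * @bessel_cst R d = 2 * (4 * @bessel_cst R d)); last by ring.
rewrite EFinM -muleA; apply: lee_wpmul2l => //.
apply: le_trans (is_fourier_L2_dist cmeasurable_csrearr hG u1).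
rewrite -nsqBC; apply: ge0_subset_integral => //.
- exact: (measurable_sqr_cabs (cmeasurableB mU mG)).
- by move=> x _; rewrite lee_fin sqr_ge0.
Qed.

Let sub_psi x : cabs (psi x - ctrunc t psi x) = g x - u x.
Proof.
by rewrite cabsB_ctrunc cabs_psi /trdecr; case: ifP; rewrite ?subrr ?subr0.
Qed.

Lemma integral_sqr_rdecr_le (A : set T) : measurable A ->
  (\int[mu]_(x in A) (g x ^+ 2)%:E <=
   2%:E * \int[mu]_(x in A) (u x ^+ 2)%:E +
   2%:E * nsq (fun x => psi x - ctrunc t psi x)%R)%E.
Proof.
move=> mA; have mu2 : measurable_fun A (fun x => (u x ^+ 2)%:E).
  by apply/measurable_EFinP; apply: measurable_funTS; apply: measurable_funX;
    exact: measurable_trdecr.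
have md : measurable_fun setT (fun x => (cabs (psi x - ctrunc t psi x) ^+ 2)%:E).
  apply: measurable_sqr_cabs; apply: cmeasurableB; first exact: cmeasurable_csrearr.
  by apply: cmeasurable_ctrunc; exact: cmeasurable_csrearr.
apply: (@le_trans _ _ (2%:E * \int[mu]_(x in A) (u x ^+ 2)%:E +
   2%:E * \int[mu]_(x in A) (cabs (psi x - ctrunc t psi x) ^+ 2)%:E)%E); last first.
  apply: leeD => //; apply: lee_wpmul2l => //; apply: ge0_subset_integral => //.
  by move=> x _; rewrite lee_fin sqr_ge0.
have mdA := measurable_funS measurableT (@subsetT _ A) md.
have sq0 (h : T -> R) x : (0 <= (h x ^+ 2)%:E)%E by rewrite lee_fin sqr_ge0.
rewrite -!(@ge0_integralZl_EFin _ _ _ _ _ mA)//; last first.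
  by move=> x _; rewrite lee_fin sqr_ge0.
rewrite -ge0_integralD//; last 4 first.
- by move=> x _; rewrite mule_ge0// lee_fin sqr_ge0.
- exact: measurable_funeM.
- by move=> x _; rewrite mule_ge0// lee_fin sqr_ge0.
- exact: measurable_funeM.
apply: ge0_le_integral => //.
- by apply/measurable_EFinP; apply: measurable_funTS; exact: measurable_funX.
- by apply: emeasurable_funD; exact: measurable_funeM.
- move=> x _; rewrite -!EFinM -EFinD lee_fin sub_psi.
  have := sqr_ge0 (g x - 2 * u x); lra.
Qed.

(** A number [v >= 0] satisfies [v <= e + v ^+ 2 / e]. Applied to [v = g - u], this controls an L^1
    distance on a set of finite measure by an L^2 distance. *)
Lemma integral_rdecr_le (A : set T) (e : R) : measurable A -> 0 < e ->
  (\int[mu]_(x in A) (g x)%:E <= \int[mu]_(x in A) (u x)%:E +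
   (e%:E * mu A + (e^-1)%:E * nsq (fun x => psi x - ctrunc t psi x)%R))%E.
Proof.
move=> mA e0.
have md : measurable_fun setT (fun x => (cabs (psi x - ctrunc t psi x) ^+ 2)%:E).
  apply: measurable_sqr_cabs; apply: cmeasurableB; first exact: cmeasurable_csrearr.
  by apply: cmeasurable_ctrunc; exact: cmeasurable_csrearr.
have mdA := measurable_funS measurableT (@subsetT _ A) md.
have muA : measurable_fun A (fun x => (u x)%:E).
  by apply/measurable_EFinP; apply: measurable_funTS; exact: measurable_trdecr.
have ei0 : 0 <= e^-1 by rewrite invr_ge0 ltW.
apply: (@le_trans _ _ (\int[mu]_(x in A) (u x)%:E + (e%:E * mu A +
   (e^-1)%:E * \int[mu]_(x in A) (cabs (psi x - ctrunc t psi x) ^+ 2)%:E))%E); last first.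
  apply: leeD => //; apply: leeD => //; apply: lee_wpmul2l; first by rewrite lee_fin.
  by apply: ge0_subset_integral => // x _; rewrite lee_fin sqr_ge0.
rewrite -(@ge0_integralZl_EFin _ _ _ _ _ mA)//; last first.
  by move=> x _; rewrite lee_fin sqr_ge0.
rewrite -integral_cst//.
have mc : measurable_fun A (fun x => ((e^-1)%:E * (cabs (psi x - ctrunc t psi x) ^+ 2)%:E)%E).
  exact: measurable_funeM.
have c0 x : (0 <= (e^-1)%:E * (cabs (psi x - ctrunc t psi x) ^+ 2)%:E)%E.
  by rewrite mule_ge0// lee_fin ?sqr_ge0.
rewrite -ge0_integralD//; last by move=> x _; rewrite lee_fin ltW.
rewrite -ge0_integralD//; last 3 first.
- by move=> x _; rewrite lee_fin trdecr_ge0.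
- by move=> x _; rewrite adde_ge0// lee_fin ltW.
- by apply: emeasurable_funD => //; exact: measurable_cst.
apply: ge0_le_integral => //.
- by move=> x _; rewrite lee_fin.
- by apply/measurable_EFinP; exact: measurable_funTS.
- by apply: emeasurable_funD => //; apply: emeasurable_funD => //; exact: measurable_cst.
- move=> x _; rewrite -EFinM -!EFinD lee_fin sub_psi.
  have v0 : 0 <= g x - u x by rewrite -sub_psi cabs_ge0.
  have [ve|ev] := leP (g x - u x) e.
    have : 0 <= e^-1 * (g x - u x) ^+ 2 by rewrite mulr_ge0// sqr_ge0.
    lra.
  have : g x - u x <= e^-1 * (g x - u x) ^+ 2.
    by rewrite mulrC ler_pdivlMr// expr2 ler_wpM2l// ltW.
  lra.
Qed.

End fixed_level.

Variables (a rho tau : R) (G : T -> R[i]).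
Hypothesis a0 : 0 < a.
Hypothesis rho0 : 0 < rho.
Hypothesis arho : 2 * pi * (2 * rho) * a <= 1.
Hypothesis Aa : forall xi : T, ~ oball0 tau xi -> ttri a xi = 0.
Hypothesis hG : is_fourier_L2 psi G.

Let kap := (a * cos 1) ^+ d.
Let Cb : R := (4 * pi) ^+ d.
Let V : R := rho ^+ d * vball1 d.
Let kap' := kap * ((rho / 2) ^+ d * vball1 d).
Let B := @bessel_cst R d.

Let N := (\int[mu]_(xi in oball0 tau) (cabs (G xi) ^+ 2)%:E)%E.

Lemma integral_fourier_fin_num : N \is a fin_num.
Proof.
have [[mG G2] _] := hG.
have N0 : (0 <= N)%E by apply: integral_ge0 => x _; rewrite lee_fin sqr_ge0.
rewrite ge0_fin_numE//; move: G2; rewrite cLnorm2_lty; apply: le_lt_trans.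
apply: ge0_subset_integral => //; first exact: measurable_oball0.
  exact: measurable_sqr_cabs.
by move=> x _; rewrite lee_fin sqr_ge0.
Qed.

Let Cb0 : 0 < Cb.
Proof. by rewrite exprn_gt0// mulr_gt0// pi_gt0. Qed.

Let B0 : 0 < B.
Proof. exact: bessel_cst_gt0. Qed.

Let mB : measurable (oball0 rho : set T).
Proof. exact: measurable_oball0. Qed.

Let approx (e : R) : 0 < e -> exists2 t, 0 < t &
  (nsq (fun x => psi x - ctrunc t psi x)%R <= e%:E)%E /\
  fine (\int[mu]_(xi in oball0 tau) (fdot (trdecr t) (trdecr t) xi)%:E)%E <=
    2 * fine N + 8 * B * e.
Proof.
move=> e0; have [t t0 ht] := ctrunc_approx cmeasurable_csrearr nsq_csrearr_lty e0.
exists t => //; split => //; rewrite -lee_fin.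
have h : (\int[mu]_(xi in oball0 tau) (fdot (trdecr t) (trdecr t) xi)%:E <=
    (2 * fine N + 8 * B * e)%:E)%E.
  apply: (le_trans (integral_fdot_trdecr_le t0 hG (measurable_oball0 tau))).
  have -> : (2 * fine N + 8 * B * e)%:E = (2%:E * N + (8 * B)%:E * e%:E)%E.
    by rewrite -[in RHS](fineK integral_fourier_fin_num) -!EFinM -EFinD.
  apply: leeD => //; apply: lee_wpmul2l => //.
  by rewrite lee_fin mulr_ge0// ltW// bessel_cst_gt0.
rewrite fineK// ge0_fin_numE; first by apply: le_lt_trans h _; exact: ltry.
by apply: integral_ge0 => x _; rewrite lee_fin fdot_ge0.
Qed.

(** [lower_bound_compl] for a cut-off, up to an arbitrary [e]. The 4 is a factor 2 from comparing
    [g ^+ 2] with its cut-off, times a factor 2 from comparing the transforms. *)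
Lemma rdecr_compl_le (q : R) :
  (\int[mu]_(x in ~` oball0 rho) (g x ^+ 2)%:E = q%:E)%E -> kap' ^+ 2 * q <= 4 * Cb * fine N.
Proof.
move=> gq; apply/ler_addgt0Pr => e e0.
(* The total coefficient of the error [e / K] in the estimates below, plus 1 to make it positive. *)
pose K := 16 * Cb * B + 2 * kap' ^+ 2 + 1.
have K0 : 0 < K.
  by rewrite /K; have := sqr_ge0 kap'; have := mulr_gt0 Cb0 B0; lra.
have eK0 : 0 < e / K by rewrite divr_gt0.
have [t t0 [h1 h2]] := approx eK0.
have mcB : measurable (~` oball0 rho : set T) by exact: measurableC.
have ufin : (\int[mu]_(x in ~` oball0 rho) (trdecr t x ^+ 2)%:E)%E \is a fin_num.
  rewrite ge0_fin_numE; last by apply: integral_ge0 => x _; rewrite lee_fin sqr_ge0.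
  apply: le_lt_trans (sqint_trdecr_lty t); apply: ge0_subset_integral => //.
    by apply/measurable_EFinP; apply: measurable_funX; exact: measurable_trdecr.
  by move=> x _; rewrite lee_fin sqr_ge0.
have := lower_bound_compl a0 rho0 arho (measurable_oball0 tau) Aa (@trdecr_ge0 t)
  (@trdecr_anti t) (integrable_trdecr t0) (sqint_trdecr_lty t) (esym (fineK ufin)).
set qt := fine _ => h3.
have h4 : q <= 2 * qt + 2 * (e / K).
  rewrite -lee_fin -gq.
  have -> : (2 * qt + 2 * (e / K))%:E = (2%:E * qt%:E + 2%:E * (e / K)%:E)%E.
    by rewrite -!EFinM -EFinD.
  rewrite (fineK ufin); apply: (le_trans (integral_sqr_rdecr_le t0 mcB)).
  by apply: leeD => //; apply: lee_wpmul2l.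
have h5 : kap' ^+ 2 * q <= kap' ^+ 2 * (2 * qt + 2 * (e / K)) by rewrite ler_wpM2l// sqr_ge0.
have h6 := ler_wpM2l (ltW Cb0) h2.
have h7 : K * (e / K) = e by rewrite mulrC divfK// gt_eqF.
move: h7 h5 h6 h3; rewrite -/kap -/kap' -/Cb /K.
set s := e / _; have s0 : 0 <= s by exact: ltW.
move: s0; move: (fine (integral _ _ _)) (kap' ^+ 2) => Nt k2; nra.
Qed.

Lemma rdecr_ball_le (I : R) :
  (\int[mu]_(x in oball0 rho) (g x)%:E = I%:E)%E ->
  kap ^+ 2 * V * I ^+ 2 <= 4 * Cb * fine N.
Proof.
move=> gI; apply/ler_addgt0Pr => e e0.
have V0 : 0 < V by rewrite mulr_gt0 ?vball1_gt0// exprn_gt0.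
(* Again the coefficient of the error, plus 1; here an L^2 error [s ^+ 2] becomes an L^1 error
   [s * (V + 1)]. *)
pose K := 16 * Cb * B + 2 * (kap ^+ 2 * V) * (V + 1) ^+ 2 + 1.
have k20 : 0 <= kap ^+ 2 * V by apply: mulr_ge0; [exact: sqr_ge0|exact: ltW].
have K0 : 0 < K.
  rewrite /K; have := mulr_ge0 k20 (sqr_ge0 (V + 1)); have := mulr_gt0 Cb0 B0; lra.
(* Capping at 1 gives [s ^+ 2 <= s], so the quadratic errors are bounded by [s * K <= e]. *)
pose s := Num.min 1 (e / K).
have s0 : 0 < s by rewrite lt_min ltr01 divr_gt0.
have s1 : s <= 1 by rewrite ge_min lexx.
have sK : s * K <= e by rewrite -ler_pdivlMr// ge_min lexx orbT.
have ss : s ^+ 2 <= s by rewrite expr2 ler_piMl// ltW.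
have [t t0 [h1 h2]] := approx (exprn_gt0 2 s0).
have ufin : (\int[mu]_(x in oball0 rho) (trdecr t x)%:E)%E \is a fin_num.
  rewrite ge0_fin_numE; last by apply: integral_ge0 => x _; rewrite lee_fin trdecr_ge0.
  have /integrableP[mu' ] := integrable_trdecr t0; apply: le_lt_trans.
  have -> : (\int[mu]_x `|(EFin \o trdecr t) x| = \int[mu]_x (trdecr t x)%:E)%E.
    by apply: eq_integral => x _; rewrite /= ger0_norm// trdecr_ge0.
  by apply: ge0_subset_integral => // x _; rewrite lee_fin trdecr_ge0.
have := lower_bound_ball a0 rho0 arho (measurable_oball0 tau) Aa (@trdecr_ge0 t)
  (integrable_trdecr t0) (sqint_trdecr_lty t) (esym (fineK ufin)).
set It := fine _ => h3.
have I0 : 0 <= I by rewrite -lee_fin -gI; apply: integral_ge0 => x _; rewrite lee_fin.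
have h4 : I <= It + s * (V + 1).
  rewrite -lee_fin -gI; apply: (le_trans (integral_rdecr_le t0 mB s0)).
  rewrite EFinD (fineK ufin); apply: leeD => //.
  have -> : s * (V + 1) = s * V + s^-1 * s ^+ 2 by field; rewrite gt_eqF.
  rewrite EFinD; apply: leeD.
    by rewrite EFinM; apply: lee_wpmul2l; rewrite ?lee_fin ?(ltW s0)// -lebesgue_tuple_ball.
  by rewrite EFinM; apply: lee_wpmul2l => //; rewrite lee_fin invr_ge0 ltW.
have h5 : I ^+ 2 <= 2 * It ^+ 2 + 2 * (s ^+ 2 * (V + 1) ^+ 2).
  apply: (@le_trans _ _ ((It + s * (V + 1)) ^+ 2)).
    by rewrite ler_pXn2r// nnegrE// (le_trans I0).
  rewrite -exprMn; move: (s * (V + 1)) => r; have := sqr_ge0 (It - r); lra.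
have h6 := ler_wpM2l k20 h5.
have h7 := ler_wpM2l (ltW Cb0) h2.
have h8 : (2 * (kap ^+ 2 * V) * (V + 1) ^+ 2) * s ^+ 2 <= (2 * (kap ^+ 2 * V) * (V + 1) ^+ 2) * s.
  by apply: ler_wpM2l => //; apply: mulr_ge0; [apply: mulr_ge0|exact: sqr_ge0].
have h9 : 16 * Cb * B * s ^+ 2 <= 16 * Cb * B * s.
  by apply: ler_wpM2l => //; apply/ltW/mulr_gt0 => //; exact: mulr_gt0.
move: h3 h6 h7 h8 h9 sK s0; rewrite -/kap -/V -/Cb /K.
move: (kap ^+ 2 * V) (It ^+ 2) (I ^+ 2) ((V + 1) ^+ 2) => k i1 i2 v.
move: (fine (integral _ _ _)) => Nt.
move: (s ^+ 2) => s2; lra.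
Qed.

End truncated_rearrangement.

(** * The splitting level *)

Section split_level.
Context {R : realType} {d : nat}.
Local Notation T := (d.-tuple R).
Local Notation mu :=
  (lebesgue_tuple d : {sigma_finite_measure set T -> \bar R}).
Hypothesis d0 : (0 < d)%N.
Variable phi : T -> R[i].
Hypothesis mphi : cmeasurable phi.
Hypothesis phi2 : (nsq phi < +oo)%E.
Local Notation g := (rdecr phi).
Variables (rho lam I J : R).
Hypothesis rho0 : 0 < rho.
Hypothesis lam0 : 0 <= lam.
Hypothesis lam_in : forall x, 0 < enorm x -> enorm x < rho -> lam <= g x.
Hypothesis lam_out : forall x, rho <= enorm x -> g x <= lam.
Hypothesis gI : (\int[mu]_(x in oball0 rho) (g x)%:E = I%:E)%E.
Hypothesis gJ : (\int[mu]_(x in ~` oball0 rho) (g x ^+ 2)%:E = J%:E)%E.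
Let V : R := rho ^+ d * vball1 d.

Let mg : measurable_fun setT g := measurable_rdecr d0 mphi phi2.
Let g0 x : 0 <= g x := rdecr_ge0 d0 mphi phi2 x.
Let mB : measurable (oball0 rho : set T).
Proof. exact: measurable_oball0. Qed.

(** The excess over [lam] vanishes outside the ball by [lam_out]; this is why the level is the value
    of [g] at radius [rho]. *)
Lemma integral_excess_le : (\int[mu]_x (Num.max 0 (g x - lam))%:E <= I%:E)%E.
Proof.
rewrite -gI (integral_mkcond (oball0 rho)); apply: ge0_le_integral => //.
- by move=> x _; rewrite lee_fin le_max lexx.
- apply/measurable_EFinP; apply: measurable_maxr => //; exact: measurable_funB.
- apply/(measurable_restrictT _ mB); apply: measurable_funTS; exact/measurable_EFinP.
- move=> x _; rewrite patchE; case: ifPn => [_|].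
    by rewrite lee_fin ge_max g0/= gerBl.
  rewrite notin_setE/= /oball0/= => /negP; rewrite -leNgt => /lam_out gl.
  by rewrite lee_fin ge_max lexx/= subr_le0.
Qed.

Lemma level_volume_le : lam * V <= I.
Proof.
rewrite -lee_fin -gI EFinM -lebesgue_tuple_ball// -integral_cst//.
apply: ae_ge0_le_integral => //.
- by move=> x _; rewrite lee_fin.
- by apply/measurable_EFinP; exact: measurable_funTS.
- by apply: filterS (ae_enorm_gt0 d0) => x x0 xB; rewrite lee_fin; exact: lam_in.
Qed.

Lemma integral_capped_le :
  (\int[mu]_x (Num.min (g x) lam ^+ 2)%:E <= (J + lam ^+ 2 * V)%:E)%E.
Proof.
have mM : measurable_fun setT (fun x => Num.min (g x) lam ^+ 2).
  by apply: measurable_funX; exact: measurable_minr.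
have min0 x : 0 <= Num.min (g x) lam by rewrite le_min g0.
rewrite -(setvU (oball0 rho)) ge0_integral_setU//; last 4 first.
- exact: measurableC mB.
- by rewrite setvU; exact/measurable_EFinP.
- by move=> x _; rewrite lee_fin sqr_ge0.
- by apply/disj_setPS => x [].
rewrite EFinD; apply: leeD.
  rewrite -gJ; apply: ge0_le_integral => //.
  - exact: measurableC.
  - by move=> x _; rewrite lee_fin sqr_ge0.
  - by apply: measurable_funTS; exact/measurable_EFinP.
  - by apply: measurable_funTS; apply/measurable_EFinP; exact: measurable_funX.
  - by move=> x _; rewrite lee_fin ler_pXn2r ?nnegrE// ge_min lexx.
rewrite EFinM -lebesgue_tuple_ball// -integral_cst//; apply: ge0_le_integral => //.
- by move=> x _; rewrite lee_fin sqr_ge0.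
- by apply: measurable_funTS; exact/measurable_EFinP.
- by move=> x _; rewrite lee_fin ler_pXn2r ?nnegrE// ge_min lexx orbT.
Qed.

(** The low part inside the ball is also charged to [I], as [lam ^+ 2 * V <= I ^+ 2 / V] by
    [level_volume_le]. The constants are [32 = 8 * 4] from the small part and [64 = 16 * 2 ^+ 2]
    from the large part, whose L^1 norm is at most [2 * I]. *)
Lemma integral_fourier_level_le (F : T -> R[i]) (Sigma : set T) (S : R) :
  is_fourier_L2 phi F -> measurable Sigma -> mu Sigma = S%:E ->
  (\int[mu]_(xi in Sigma) (cabs (F xi) ^+ 2)%:E <=
   (32 * @bessel_cst R d * J + (32 * @bessel_cst R d / V + 64 * S) * I ^+ 2)%:E)%E.
Proof.
move=> hF mS SE; set B := @bessel_cst R d.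
have B0 : 0 < B by exact: bessel_cst_gt0.
have V0 : 0 < V by rewrite mulr_gt0 ?vball1_gt0// exprn_gt0.
have hm : (\int[mu]_x (cabs (ctrunc (2 * lam) phi x))%:E <= (2 * I)%:E)%E.
  apply: (le_trans (integral_ctrunc_le d0 mphi phi2 lam0)).
  by rewrite EFinM; apply: lee_wpmul2l => //; exact: integral_excess_le.
have u1 : cLp 1%:E (ctrunc (2 * lam) phi).
  split; first exact: cmeasurable_ctrunc.
  by rewrite cLnorm1E; apply: le_lt_trans hm _; exact: ltry.
apply: (le_trans (integral_fourier_le mphi hF u1 mS hm)).
rewrite [X in (_ + _ * X)%E]SE -EFinM -/B.
apply: (@le_trans _ _ ((8 * B)%:E * (4 * (J + lam ^+ 2 * V))%:E + (16 * (2 * I) ^+ 2 * S)%:E)%E).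
  apply: leeD => //; apply: lee_wpmul2l; first by rewrite lee_fin mulr_ge0// ltW.
  apply: (le_trans (nsq_ctrunc_le d0 mphi phi2 lam0)); rewrite EFinM.
  by apply: lee_wpmul2l => //; exact: integral_capped_le.
rewrite -EFinM -EFinD lee_fin.
have lV : lam ^+ 2 * V <= I ^+ 2 / V.
  rewrite ler_pdivlMr// -mulrA -expr2 -exprMn.
  have := level_volume_le => h; rewrite ler_pXn2r// nnegrE.
    by rewrite mulr_ge0// ltW.
  by rewrite (le_trans _ h)// mulr_ge0// ltW.
have h := ler_wpM2l (ltW B0) lV.
have -> : (32 * B / V + 64 * S) * I ^+ 2 = 32 * (B * (I ^+ 2 / V)) + 64 * S * I ^+ 2.
  by field; rewrite gt_eqF.
move: h; move: (B * (I ^+ 2 / V)) => w; lra.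
Qed.

End split_level.

(** The weight lives on a cube whose points have coordinates of absolute sum at most [tau / 2]; the
    factor 2 in the width secures the strict inequality of the open ball. *)
Lemma ttri_eq0_out (R : realType) (d : nat) (tau : R) (xi : d.-tuple R) : (0 < d)%N ->
  0 < tau -> ~ oball0 tau xi -> ttri (tau / (2 * d%:R)) xi = 0.
Proof.
move=> d0 tau0 xiN; apply: contrapT => /eqP h; apply: xiN.
rewrite /oball0/= (le_lt_trans (enorm_le_sum xi))//.
have dR : 0 < d%:R :> R by rewrite ltr0n.
apply: (@le_lt_trans _ _ (\sum_(i < d) tau / (2 * d%:R))).
  apply: ler_sum => i _; rewrite leNgt; apply/negP => hi.
  move: h; rewrite /ttri /tprod (bigD1 i)//= /tri max_l ?mul0r ?eqxx//.
  rewrite subr_le0 ler_pdivlMr ?mul1r ?ltW//.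
  by rewrite divr_gt0// mulr_gt0.
rewrite sumr_const card_ord -(mulr_natr (_ / _)).
have -> : tau / (2 * d%:R) * d%:R = tau / 2 by field; rewrite gt_eqF.
by rewrite ltr_pdivrMr// ltr_pMr// ltr1n.
Qed.

(** Supplies a point at distance [rho] from the origin, at which the splitting level is read off. *)
Lemma exists_enorm (R : realType) (d : nat) (r : R) : (0 < d)%N -> 0 <= r ->
  exists x : d.-tuple R, enorm x = r.
Proof.
move=> d0 r0; exists [tuple if i == Ordinal d0 then r else 0 | i < d].
rewrite /enorm /dotp (bigD1 (Ordinal d0))//= big1 => [|i /negbTE ni].
  by rewrite tnth_mktuple eqxx addr0 -expr2 sqrtr_sqr ger0_norm.
by rewrite tnth_mktuple ni mul0r.
Qed.

Theorem theorem1p3 (R : realType) (d : nat) (d_ge1 : (1 <= d)%N) :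
  exists kappa : R,
    forall (Sigma : set (d.-tuple R)) (phi : d.-tuple R -> R[i]) (tau : R),
      measurable Sigma ->
      (0 < lebesgue_tuple d Sigma < +oo)%E ->
      cLp 2%:E phi ->
      lebesgue_tuple d (oball0 tau) = lebesgue_tuple d Sigma ->
      (\int[lebesgue_tuple d]_(xi in Sigma) ((cabs (fourier phi xi)) ^+ 2)%:E <=
       kappa%:E * \int[lebesgue_tuple d]_(xi in oball0 tau)
                    ((cabs (fourier (csrearr phi) xi)) ^+ 2)%:E)%E.
Proof.
pose v := @vball1 R d; have v0 : 0 < v := vball1_gt0 d.
pose B := @bessel_cst R d; pose Cb : R := (4 * pi) ^+ d.
have B0 : 0 < B by exact: bessel_cst_gt0.
have p0 : 0 < pi :> R := pi_gt0 R.
(* These are [kap'], [kap * V] and [|Sigma| * V] once the values of [a] and [rho] are inserted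
   ([k1E], [k2E], [k3E]): tau cancels, so the constant depends on [d] only. *)
pose k1 : R := (cos 1 / (8 * pi)) ^+ d * v; pose k2 : R := (cos 1 / (4 * pi)) ^+ d * v.
pose k3 : R := (d%:R / (2 * pi)) ^+ d * v ^+ 2.
(* The coefficients of [J] and [I ^+ 2 / V] in [integral_fourier_level_le], times the factors in the
   bounds of these two quantities by the right-hand side. *)
exists (32 * B * (4 * Cb / k1 ^+ 2) + (32 * B + 64 * k3) * (4 * Cb / k2 ^+ 2)).
move=> Sigma phi tau mS /andP[S0 _] [mphi]; rewrite cLnorm2_lty => phi2 tauS.
have tau0 : 0 < tau.
  by rewrite ltNge; apply/negP => t0; move: S0; rewrite -tauS oball0_le0// measure0 ltxx.
have dR : 0 < d%:R :> R by rewrite ltr0n.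
have SE : lebesgue_tuple d Sigma = (tau ^+ d * v)%:E by rewrite -tauS lebesgue_tuple_ball.
pose a : R := tau / (2 * d%:R); have a0 : 0 < a by rewrite divr_gt0// mulr_gt0.
(* The largest radius allowed by [arho], which becomes an equality. *)
pose rho : R := (4 * pi * a)^-1; have rho0 : 0 < rho by rewrite invr_gt0 mulr_gt0// mulr_gt0.
have arho : 2 * pi * (2 * rho) * a <= 1.
  rewrite le_eqVlt; apply/orP; left; apply/eqP; rewrite /rho.
  by move: p0; move: (pi : R) => p p0; field; rewrite !gt_eqF.
have Aa (xi : d.-tuple R) : ~ oball0 tau xi -> ttri a xi = 0 by exact: (ttri_eq0_out d_ge1 tau0).
have mpsi := cmeasurable_csrearr d_ge1 mphi phi2.
have hF := fourierP mphi phi2.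
have hG := fourierP mpsi (nsq_csrearr_lty d_ge1 mphi phi2).
set N := (\int[_]_(xi in oball0 tau) _)%E.
have Nfin : N \is a fin_num := integral_fourier_fin_num tau hG.
have mg := measurable_rdecr d_ge1 mphi phi2.
have g0 (x : d.-tuple R) := rdecr_ge0 d_ge1 mphi phi2 x.
have g2 : (sqint (rdecr phi) < +oo)%E.
  exact: le_lt_trans (sqint_rdecr_le d_ge1 mphi phi2) phi2.
have mB : measurable (oball0 rho : set (d.-tuple R)) by exact: measurable_oball0.
(* [g <= 1 + g ^+ 2], and the ball has finite measure. *)
have /fineK gI : (\int[lebesgue_tuple d]_(x in oball0 rho) (rdecr phi x)%:E)%E \is a fin_num.
  rewrite ge0_fin_numE; last by apply: integral_ge0 => x _; rewrite lee_fin.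
  apply: (@le_lt_trans _ _ (\int[lebesgue_tuple d]_(x in oball0 rho)
      (1%:E + (rdecr phi x ^+ 2)%:E))%E).
    apply: ge0_le_integral => //.
    - by move=> x _; rewrite lee_fin.
    - by apply: measurable_funTS; exact/measurable_EFinP.
    - apply: measurable_funTS; apply: emeasurable_funD => //.
      by apply/measurable_EFinP; exact: measurable_funX.
    - move=> x _; rewrite -EFinD lee_fin.
      by have := sqr_ge0 (rdecr phi x - 1); have := g0 x; rewrite !expr2; lra.
  rewrite ge0_integralD//; last 2 first.
  - by move=> x _; rewrite lee_fin sqr_ge0.
  - by apply: measurable_funTS; apply/measurable_EFinP; exact: measurable_funX.
  rewrite integral_cst// [X in (_ * X + _)%E](@lebesgue_tuple_ball R d rho rho0) -EFinM lte_add_pinfty ?ltry//.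
  apply: le_lt_trans g2; apply: ge0_subset_integral => //.
    by apply/measurable_EFinP; exact: measurable_funX.
  by move=> x _; rewrite lee_fin sqr_ge0.
have /fineK gJ : (\int[lebesgue_tuple d]_(x in ~` oball0 rho) (rdecr phi x ^+ 2)%:E)%E
    \is a fin_num.
  rewrite ge0_fin_numE; last by apply: integral_ge0 => x _; rewrite lee_fin sqr_ge0.
  apply: le_lt_trans g2; apply: ge0_subset_integral => //.
  - exact: measurableC.
  - by apply/measurable_EFinP; exact: measurable_funX.
  - by move=> x _; rewrite lee_fin sqr_ge0.
move: gI gJ; set I := fine _; set J := fine _ => gI gJ.
have hI := rdecr_ball_le d_ge1 mphi phi2 a0 rho0 arho Aa hG (esym gI).
have hJ := rdecr_compl_le d_ge1 mphi phi2 a0 rho0 arho Aa hG (esym gJ).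
(* The level is [lam = rdecr phi x0]; monotonicity then gives the two comparisons required on either
   side of the sphere. *)
have [x0 x0E] := exists_enorm d_ge1 (ltW rho0).
apply: (le_trans (integral_fourier_level_le d_ge1 mphi phi2 rho0 (g0 x0) _ _
  (esym gI) (esym gJ) hF mS SE)).
- by move=> x xpos xr; apply: (rdecr_anti d_ge1 mphi phi2) => //; rewrite x0E ltW.
- by move=> x xr; apply: (rdecr_anti d_ge1 mphi phi2); rewrite x0E.
rewrite -(fineK Nfin) -EFinM lee_fin.
move: hI hJ; rewrite -/Cb -/B -/v; set n := fine _ => hI hJ.
have c0 : 0 < cos 1 :> R by exact: cos1_gt0.
have pos_pow (x : R) : 0 < x -> 0 < x ^+ d by move=> ?; exact: exprn_gt0.
have k10 : 0 < k1 by rewrite mulr_gt0// pos_pow// divr_gt0// mulr_gt0.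
have k20 : 0 < k2 by rewrite mulr_gt0// pos_pow// divr_gt0// mulr_gt0.
have k30 : 0 < k3 by rewrite mulr_gt0 ?exprn_gt0// divr_gt0// mulr_gt0.
have [p_neq0 a_neq0 d_neq0] : [/\ (pi : R) != 0, a != 0 & d%:R != 0 :> R].
  by rewrite !gt_eqF.
have k1E : (a * cos 1) ^+ d * ((rho / 2) ^+ d * v) = k1.
  rewrite mulrA -exprMn; congr (_ ^+ _ * _); rewrite /rho.
  by move: p_neq0 (cos 1 : R); move: (pi : R) => p hp c; field; rewrite hp a_neq0.
have k2E : (a * cos 1) ^+ d * (rho ^+ d * v) = k2.
  rewrite mulrA -exprMn; congr (_ ^+ _ * _); rewrite /rho.
  by move: p_neq0 (cos 1 : R); move: (pi : R) => p hp c; field; rewrite hp a_neq0.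
have k3E : tau ^+ d * v * (rho ^+ d * v) = k3.
  rewrite mulrACA -exprMn -expr2; congr (_ ^+ _ * _); rewrite /rho /a.
  move: p_neq0; move: (pi : R) => p hp; field.
  by rewrite ?hp ?(gt_eqF tau0) ?d_neq0.
move: hI hJ; rewrite k1E; set V := rho ^+ d * v in k2E k3E *; set c := (a * _) ^+ d in k2E *.
have V0 : 0 < V by rewrite mulr_gt0// pos_pow.
rewrite (_ : c ^+ 2 * V * I ^+ 2 = k2 ^+ 2 * (I ^+ 2 / V)); last first.
  by rewrite -k2E; field; rewrite gt_eqF.
have -> : (32 * B / V + 64 * (tau ^+ d * v)) * I ^+ 2 =
    (32 * B + 64 * k3) * (I ^+ 2 / V).
  by rewrite -k3E; field; rewrite gt_eqF.
rewrite -(ler_pdivlMl _ _ (exprn_gt0 2 k20)) -(ler_pdivlMl _ _ (exprn_gt0 2 k10)) => hI hJ.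
rewrite [leRHS]mulrDl; apply: lerD; rewrite -[leRHS]mulrA.
  by apply: ler_wpM2l; [rewrite mulr_ge0// ltW|rewrite [leRHS]mulrAC [leRHS]mulrC].
apply: ler_wpM2l; last by rewrite [leRHS]mulrAC [leRHS]mulrC.
by rewrite addr_ge0// mulr_ge0// ltW.
Qed.
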